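(* Let $\alpha>-1$, let $\psi$ be an Orlicz function satisfying the $\Delta^2$-condition, and let $\phi$ be a holomorphic self-map of the unit disc $\mathbb{D}$. Then $$\|C_\phi\|_{e,A_\alpha^\psi}\simeq\lim_{r\to1}\sup_{|\phi(z)|>r}\frac{\psi^{-1}(1/(1-|\phi(z)|))}{\psi^{-1}(1/(1-|z|))}\simeq\limsup_{n\to\infty}\frac{\|\phi^n\|_{A_\alpha^\psi}}{\|z^n\|_{A_\alpha^\psi}},$$ where $\simeq$ means two-sided estimates up to positive constants not depending on $\phi$. In particular $C_\phi$ is compact on $A_\alpha^\psi(\mathbb{D})$ if and only if $$\limsup_{|z|\to1}\frac{\psi^{-1}(1/(1-|\phi(z)|))}{\psi^{-1}(1/(1-|z|))}=0,$$ and also if and only if $$\limsup_{n\to\infty}\frac{\|\phi^n\|_{A_\alpha^\psi}}{\|z^n\|_{A_\alpha^\psi}}=0.$$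
   Context: $\mathbb{D}$ is the open unit disc of $\mathbb{C}$, $H(\mathbb{D})$ the space of holomorphic functions on it, and $dv_\alpha=c_\alpha(1-|z|^2)^\alpha dv$ is the normalized (probability) weighted Lebesgue measure on $\mathbb{D}$. An Orlicz function is a strictly convex function $\psi:[0,\infty)\to[0,\infty)$ with $\psi(0)=0$, continuous at $0$, and with $\psi(x)/x\to+\infty$ as $x\to+\infty$; $\psi^{-1}$ is its inverse. $\psi$ satisfies the $\Delta^2$-condition if there is $C>0$ with $\psi(x)^2\le\psi(Cx)$ for all $x$ large enough. $A_\alpha^\psi(\mathbb{D})$ is the space of $f\in H(\mathbb{D})$ such that $\int_{\mathbb{D}}\psi(|f|/C)\,dv_\alpha<\infty$ for some $C>0$, with the Luxemburg norm $\|f\|_{A_\alpha^\psi}=\inf\{C>0:\int_{\mathbb{D}}\psi(|f|/C)\,dv_\alpha\le1\}$. $C_\phi f=f\circ\phi$, and $\|C_\phi\|_{e,A_\alpha^\psi}$ is its essential norm on $A_\alpha^\psi(\mathbb{D})$, i.e. its distance in operator norm to the compact operators on $A_\alpha^\psi(\mathbb{D})$. $\phi^n$ is the $n$-th power (pointwise product) of $\phi$ and $z^n$ the monomial $z\mapsto z^n$. A supremum over the empty set is $0$. *)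

(* Defs.v *)
From mathcomp Require Export all_boot all_order all_algebra.
From mathcomp Require Export all_classical all_reals all_analysis.
From mathcomp Require Export complex.

Set Implicit Arguments.
Unset Strict Implicit.
Unset Printing Implicit Defensive.

Export Order.TTheory GRing.Theory Num.Theory.
Export ComplexField.Normc.
Export numFieldNormedType.Exports.

Local Open Scope classical_set_scope.
Local Open Scope ring_scope.

Section OrliczFunctions.
Variable R : realType.
Implicit Type psi : R -> R.

Definition strictly_convex_nneg psi : Prop :=
  forall x y t, 0 <= x -> 0 <= y -> x != y -> 0 < t -> t < 1 ->
    psi (t * x + (1 - t) * y) < t * psi x + (1 - t) * psi y.

(* An Orlicz function lives on [0, +oo[; its values at negative reals are
   irrelevant. *)
Definition orlicz psi : Prop :=
  [/\ (forall x, 0 <= x -> 0 <= psi x),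
      strictly_convex_nneg psi,
      psi 0 = 0,
      psi x @[x --> 0^'+] --> psi 0 &
      psi x / x @[x --> +oo] --> +oo].

Definition Delta2_upper psi : Prop :=
  exists2 C : R, 0 < C & \forall x \near +oo, psi x ^+ 2 <= psi (C * x).

Definition psi_inv psi : R -> R := 'pinv_(fun=> 0) `[0, +oo[ psi.

End OrliczFunctions.

Section Disc.
Variable R : realType.

Definition disc : set R[i] := [set z | normc z < 1].

Definition holomorphic_disc (f : R[i] -> R[i]) : Prop :=
  forall z, disc z -> derivable (f : R[i]^o -> R[i]^o) z 1.

Definition self_map (phi : R[i] -> R[i]) : Prop :=
  holomorphic_disc phi /\ (forall z, disc z -> disc (phi z)).

Definition plane_measure := (@lebesgue_measure R \x @lebesgue_measure R)%E.

(* The integral of g over the disc against area measure, z = x + i y. *)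
Definition disc_integral (g : R[i] -> \bar R) : \bar R :=
  (\int[plane_measure]_(p in [set p : R * R | disc (p.1 +i* p.2)%C])
     g (p.1 +i* p.2)%C)%E.

Definition weight (alpha : R) (z : R[i]) : R := (1 - normc z ^+ 2) `^ alpha.

Definition c_norm (alpha : R) : R :=
  (fine (disc_integral (fun z => (weight alpha z)%:E)))^-1.

(* The integral of a real function against dv_alpha. *)
Definition integral_v (alpha : R) (g : R[i] -> R) : \bar R :=
  disc_integral (fun z => (g z * (c_norm alpha * weight alpha z))%:E).

End Disc.

Arguments disc {R}.

Section BergmanOrlicz.
Variables (R : realType) (alpha : R) (psi : R -> R).
Local Notation C := R[i].
Implicit Types (f g : C -> C) (T K : (C -> C) -> (C -> C)).

Definition modular f (c : R) : \bar R :=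
  integral_v alpha (fun z => psi (normc (f z) / c)).

(* Elements of the space are represented by total functions, of which only the
   restriction to the disc matters. *)
Definition bergman_orlicz : set (C -> C) :=
  [set f | holomorphic_disc f /\
           exists2 c : R, 0 < c & (modular f c < +oo)%E].

Definition lux_norm f : \bar R :=
  ereal_inf [set c%:E | c in [set c : R | 0 < c /\ (modular f c <= 1)%E]].

(* Linear self-maps of the space; equality of functions is equality on the
   disc. *)
Definition linear_op T : Prop :=
  (forall f, bergman_orlicz f -> bergman_orlicz (T f)) /\
  (forall (a : C) f g, bergman_orlicz f -> bergman_orlicz g ->
     forall z, disc z -> T (fun w => a * f w + g w) z = a * T f z + T g z).

Definition compact_op T : Prop :=
  linear_op T /\
  forall f_ : nat -> C -> C,
    (forall n, bergman_orlicz (f_ n) /\ (lux_norm (f_ n) <= 1)%E) ->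
    exists s : nat -> nat, exists g : C -> C,
      [/\ increasing_seq s, bergman_orlicz g &
          lux_norm (fun z => T (f_ (s k)) z - g z) @[k --> \oo] --> 0%E].

Definition op_norm T : \bar R :=
  ereal_sup [set lux_norm (T f) |
              f in [set f | bergman_orlicz f /\ (lux_norm f <= 1)%E]].

Definition essential_norm T : \bar R :=
  ereal_inf [set op_norm (fun f z => T f z - K f z) | K in compact_op].

End BergmanOrlicz.

Section Quantities.
Variable R : realType.
Local Notation C := R[i].
Implicit Types (phi : C -> C) (psi : R -> R).

Definition comp_op phi : (C -> C) -> (C -> C) := fun f => f \o phi.

(* Supremum of a set of nonnegative values, with value 0 on the empty set
   (ereal_sup would give -oo). *)
Definition sup0 (A : set (\bar R)) : \bar R :=
  if `[< A = set0 >] then 0%E else ereal_sup A.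

Definition psi_ratio psi phi (z : C) : \bar R :=
  (psi_inv psi (1 / (1 - normc (phi z))) / psi_inv psi (1 / (1 - normc z)))%:E.

(* The limit exists: the supremum is nonincreasing in r. *)
Definition lim_sup_phi psi phi : \bar R :=
  lim (sup0 [set psi_ratio psi phi z | z in
               [set z | disc z /\ r < normc (phi z)]] @[r --> (1 : R)^'-]).

(* The filter |z| -> 1 inside the disc. *)
Definition to_circle : set (set C) :=
  [set A | \forall r \near (1 : R)^'-,
             [set z | disc z /\ r < normc z] `<=` A].

Definition limsup_circle (g : C -> \bar R) : \bar R :=
  limf_esup (g : C^o -> \bar R) to_circle.

Definition power_ratio alpha psi phi (n : nat) : \bar R :=
  (lux_norm alpha psi (fun z => (phi z ^+ n)%R) /
   lux_norm alpha psi (fun z => (z ^+ n)%R))%E.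

Definition comparable (D : set (C -> C)) (F G : (C -> C) -> \bar R) : Prop :=
  exists a b : R, [/\ 0 < a, 0 < b &
    forall phi, D phi -> (a%:E * G phi <= F phi <= b%:E * G phi)%E].

End Quantities.

(* Main.v *)
Require Import Defs.
From mathcomp Require Import ring lra measurable_realfun.

(** Everything rests on one comparison: for holomorphic [f], the Luxemburg norm
    is equivalent to the smallest [b] such that [|f z| <= b * G z] on the disc,
    where [G z] is [psi_inv psi (1 / (1 - |z|))], the critical growth. By the
    [Delta^2]-condition, raising the argument of [psi_inv] to a power costs only
    a multiplicative constant ([psi_inv_exp]), so that every polynomial loss in
    [1 / (1 - |z|)] is harmless. If [|f| <= G], then [psi (|f| / K)] is at most
    a small negative power of [1 - |z|], which is integrable against the weight
    because [alpha > -1] ([modular_upper]). Conversely the mean value of [|f|]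
    over a square of size comparable to [1 - |z|] dominates [|f z|], and the
    convexity of [psi] turns the bound on the modular into a bound on this mean
    by [psi_inv] of a power of [1 / (1 - |z|)] ([point_evaluation]).

    In the weighted supremum norm the statements become elementary. The monomial
    [z ^ n] has norm of order [1 / psi_inv n], and the supremum over [n] of
    [|w| ^ n * psi_inv n] is comparable to [G w] for [w] near the circle, being
    nearly attained for [n] of order [1 / (1 - |w|)] ([monomial_growth],
    [monomial_growth_sharp]). Applied at [w = phi z] this compares the ratios of
    norms of powers with the ratios [G (phi z) / G z]; points with
    [|phi z| <= r < 1] contribute only a geometrically small quantity
    ([power_ratio_comparison]).

    For the essential norm from above, [comp_op phi] is approximated by
    [comp_op (t phi)] with [t < 1], which is compact by Montel's theorem: where
    [|phi z| <= r] the difference is small by the Cauchy estimates, elsewhere it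
    is at most [2 * G (phi z)]. From below, consider the functions
    [psi_inv n_k * w ^ n_k] with [psi_inv n_k] at least doubling at each step.
    Their partial sums are bounded ([lacunary_sum]), so a compact operator sends
    them to functions that accumulate only at [0], as the image of a sum of [N]
    of them would otherwise have norm of order [N] ([compact_lacunary]). When
    the exponents are adapted to [phi], the operator [comp_op phi] does not make
    these functions small ([essential_norm_lower]).

    The two forms of the limit agree when they vanish, because [phi] maps
    smaller discs into smaller discs and [psi_inv] is unbounded
    ([limsup_circle_eq0]).

    The complex analysis is derived from Goursat's theorem on rectangles.
    The vanishing of the contour integral of a divided difference gives the
    mean value inequality [mean_rect]; used for divided differences again,
    that inequality yields Cauchy estimates for the first derivative and for
    the first order Taylor remainder, which are uniform over bounded
    families and make a cluster point of such a family holomorphic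
    ([montel]). *)

Set Implicit Arguments.
Unset Strict Implicit.
Unset Printing Implicit Defensive.

Local Open Scope classical_set_scope.
Local Open Scope ring_scope.

Local Notation Re := complex.Re.
Local Notation Im := complex.Im.

(** * Orlicz functions and their inverses *)

Lemma le_of_eq d (T : porderType d) (x y : T) : x = y -> (x <= y)%O.
Proof. by move=> ->. Qed.

Section Orlicz.
Variables (R : realType) (psi : R -> R).
Hypothesis psi_orlicz : orlicz psi.
Local Notation X := (psi_inv psi).

Lemma psi_ge0 x : 0 <= x -> 0 <= psi x.
Proof. by case: psi_orlicz => + _ _ _ _; apply. Qed.

Lemma psi0 : psi 0 = 0.
Proof. by case: psi_orlicz. Qed.

Lemma psi_scale_lt x t : 0 < x -> 0 < t -> t < 1 -> psi (t * x) < t * psi x.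
Proof.
move=> x0 t0 t1; case: psi_orlicz => _ cvx _ _ _.
have := cvx x 0 t (ltW x0) (lexx _) (lt0r_neq0 x0) t0 t1.
by rewrite psi0 !mulr0 !addr0.
Qed.

(** Convexity enters mostly in this form: [psi x / x] is nondecreasing. *)
Lemma psi_scale x l : 0 <= x -> 1 <= l -> psi (x / l) <= psi x / l.
Proof.
rewrite le_eqVlt => /orP[/eqP<-|x0]; first by rewrite mul0r psi0 mul0r.
rewrite le_eqVlt => /orP[/eqP<-|l1]; first by rewrite !divr1.
have l0 : 0 < l by apply: lt_trans l1.
rewrite ![_ / l]mulrC; apply/ltW/psi_scale_lt => //; first by rewrite invr_gt0.
by rewrite invf_lt1.
Qed.

Lemma psi_gt0 x : 0 < x -> 0 < psi x.
Proof.
move=> x0; have h : (0 : R) < 2^-1 by rewrite invr_gt0.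
have h1 : (2^-1 : R) < 1 by rewrite invf_lt1 // ltr1n.
have := psi_scale_lt x0 h h1.
have : 0 <= psi (2^-1 * x) by apply/psi_ge0/mulr_ge0/ltW/x0/ltW.
by move=> /le_lt_trans /[apply]; rewrite pmulr_rgt0.
Qed.

Lemma psi_lt x y : 0 <= x -> x < y -> psi x < psi y.
Proof.
rewrite le_eqVlt => /orP[/eqP<-|x0] xy; first by rewrite psi0 psi_gt0.
have y0 : 0 < y by apply: lt_trans xy.
have := @psi_scale_lt y (x / y) y0 (divr_gt0 x0 y0).
rewrite ltr_pdivrMr // mul1r => /(_ xy);
  rewrite divfK ?gt_eqF // => /lt_le_trans.
by apply; rewrite ler_piMl ?psi_ge0 ?ltW // ltr_pdivrMr // mul1r.
Qed.

Lemma psi_le x y : 0 <= x -> x <= y -> psi x <= psi y.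
Proof.
by move=> x0; rewrite le_eqVlt => /orP[/eqP->//|xy]; apply/ltW/psi_lt.
Qed.

(** Convexity bounds the increments of [psi] by a slope further to the right;
    this local Lipschitz bound is where its continuity comes from. *)
Lemma psi_increment x y : 0 <= x -> x <= y -> y <= x + 1 ->
  psi y - psi x <= (y - x) * psi (x + 1).
Proof.
move=> x0; rewrite le_eqVlt => /orP[/eqP<-|xy].
  by rewrite !subrr mul0r.
have px := psi_ge0 x0; have px1 : 0 <= psi (x + 1) by apply: psi_ge0; lra.
rewrite le_eqVlt => /orP[/eqP ey|yx].
  by rewrite ey; have -> : x + 1 - x = 1 by [ring]; rewrite mul1r gerBl.
case: psi_orlicz => _ cvx _ _ _.
have xx1 : x + 1 != x by apply/eqP; lra.
have h1 : 0 <= x + 1 by lra.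
have h2 : 0 < y - x by lra.
have h3 : y - x < 1 by lra.
have := cvx (x + 1) x (y - x) h1 x0 xx1 h2 h3.
have -> : (y - x) * (x + 1) + (1 - (y - x)) * x = y by ring.
by nra.
Qed.

(** [psi] may take any values at negative arguments, hence the truncation. *)
Lemma continuous_psi_max : continuous (fun x : R => psi (Num.max 0 x)).
Proof.
move=> x; apply/cvgrPdist_le => /= e e0.
set L := psi (Num.max 0 x + 2) + 1.
have mx0 : 0 <= Num.max 0 x by rewrite le_max lexx.
have L0 : 0 < L by rewrite ltr_wpDl // psi_ge0 // addr_ge0.
have d0 : 0 < Num.min 1 (e / L) by rewrite lt_min ltr01 divr_gt0.
near=> y.
have xy : `|x - y| < Num.min 1 (e / L) by near: y; exact: (nbhsx_ballx x _ d0).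
move: xy; rewrite lt_min => /andP[xy1 xyL].
have my0 : 0 <= Num.max 0 y by rewrite le_max lexx.
have mxy : `|Num.max 0 x - Num.max 0 y| <= `|x - y|.
  by rewrite /Num.max; do 2 case: ifP => ?; rewrite ler_norml;
    have := ler_norm (x - y); have := ler_norm (-(x - y)); rewrite normrN => *;
      lra.
have inc : forall a b, 0 <= a -> a <= b -> b <= a + 1 -> a <= Num.max 0 x + 1 ->
  psi b - psi a <= (b - a) * L.
  move=> a b a0 ab ba ax; apply: le_trans (psi_increment a0 ab ba) _.
  rewrite ler_wpM2l ?subr_ge0 // /L -[leLHS]addr0 lerD //.
  by apply: psi_le; lra.
have key : `|psi (Num.max 0 x) - psi (Num.max 0 y)| <=
  `|Num.max 0 x - Num.max 0 y| * L.
  have [h|/ltW h] := leP (Num.max 0 x) (Num.max 0 y).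
    rewrite distrC [X in _ <= X * _]distrC !ger0_norm ?subr_ge0 ?psi_le //.
    move: mxy; rewrite distrC ger0_norm ?subr_ge0 // => mxy.
    apply: inc => //; lra.
  rewrite !ger0_norm ?subr_ge0 ?psi_le //.
  move: mxy; rewrite ger0_norm ?subr_ge0 // => mxy.
  apply: inc => //; lra.
apply: le_trans key _; apply: le_trans (_ : `|x - y| * L <= _).
  by rewrite ler_wpM2r // ltW.
by rewrite -ler_pdivlMr // ltW.
Unshelve. all: by end_near. Qed.

Lemma psi_unbounded v : exists2 x, 0 < x & v <= psi x.
Proof.
case: psi_orlicz => _ _ _ _ /cvgryPge /(_ v) h.
near (pinfty_nbhs R) => x.
have x1 : 1 <= x by near: x; apply: nbhs_pinfty_ge; rewrite num_real.
have x0 : 0 < x by apply: lt_le_trans x1.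
exists x => //.
have : v <= psi x / x by near: x.
move=> /le_trans; apply.
by rewrite ler_pdivrMr // ler_peMr // psi_ge0 // ltW.
Unshelve. all: by end_near. Qed.

Lemma psi_surj v : 0 <= v -> exists2 x, 0 <= x & psi x = v.
Proof.
move=> v0; have [y y0 vy] := psi_unbounded v.
have c : {within `[0, y], continuous (fun x : R => psi (Num.max 0 x))}.
  exact/continuous_subspaceT/continuous_psi_max.
have m0 : Num.max 0 0 = 0 :> R by rewrite maxxx.
have my : Num.max 0 y = y by apply/max_idPr/ltW.
have [|x] := IVT (ltW y0) c (v := v).
  rewrite m0 my psi0; have p0 := psi_ge0 (ltW y0).
  by rewrite (min_idPl _) // (max_idPr _) // v0 vy.
rewrite in_itv /= => /andP[x0 _]; rewrite (max_idPr x0) => <-.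
by exists x.
Qed.

Lemma psi_inj x y : 0 <= x -> 0 <= y -> psi x = psi y -> x = y.
Proof.
move=> x0 y0 pxy; case: (ltgtP x y) => // h.
  by have := psi_lt x0 h; rewrite pxy ltxx.
by have := psi_lt y0 h; rewrite pxy ltxx.
Qed.

Lemma psiK x : 0 <= x -> X (psi x) = x.
Proof.
move=> x0; apply: pinvKV; last by rewrite inE /= in_itv /= x0.
by move=> a b; rewrite !inE /= !in_itv /= !andbT; exact: psi_inj.
Qed.

Lemma psi_invK v : 0 <= v -> psi (X v) = v.
Proof. by move=> /psi_surj[x x0 <-]; rewrite psiK. Qed.

Lemma psi_inv_ge0 v : 0 <= v -> 0 <= X v.
Proof. by move=> /psi_surj[x x0 <-]; rewrite psiK. Qed.

Lemma psi_inv_leP v y : 0 <= v -> 0 <= y -> (X v <= y) = (v <= psi y).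
Proof.
move=> v0 y0; have [h|h] := leP (X v) y.
  by rewrite -(psi_invK v0) psi_le // psi_inv_ge0.
by apply/esym/negbTE; rewrite -ltNge -[ltRHS](psi_invK v0) psi_lt.
Qed.

Lemma le_psi_inv u v : 0 <= u -> u <= v -> X u <= X v.
Proof.
move=> u0 uv; have v0 := le_trans u0 uv.
by rewrite psi_inv_leP ?psi_inv_ge0 // psi_invK.
Qed.

Lemma psi_inv_gt0 v : 0 < v -> 0 < X v.
Proof.
move=> v0; rewrite lt_neqAle psi_inv_ge0 ?ltW // andbT eq_sym.
by apply/eqP => h; have := psi_invK (ltW v0); rewrite h psi0; apply/eqP;
  rewrite lt_eqF.
Qed.

Lemma psi_inv_scale l v : 1 <= l -> 0 <= v -> X (l * v) <= l * X v.
Proof.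
move=> l1 v0; have l0 : 0 < l by apply: lt_le_trans l1.
have Xv := psi_inv_ge0 v0; have l0' := ltW l0.
rewrite psi_inv_leP ?mulr_ge0 //.
have := psi_scale (mulr_ge0 (ltW l0) Xv) l1.
rewrite [l * X v]mulrC mulfK ?gt_eqF // psi_invK // ler_pdivlMr //.
by rewrite [v * l]mulrC.
Qed.

Hypothesis psi_Delta2 : Delta2_upper psi.

(** For [x] large this is the [Delta^2]-condition read through [psi_inv]; the
    remaining [x] form a bounded interval, on which [psi_inv] is bounded
    below. *)
Lemma psi_inv_sqr : exists2 K, 1 <= K &
  forall x, 1 <= x -> X (x ^+ 2) <= K * X x.
Proof.
case: psi_Delta2 => C C0 [A [_ hA]].
(* [y] lies beyond the threshold [A] of the condition, and [X x] exceeds [y]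
   as soon as [x] exceeds [x0]. *)
set y := Num.max 1 (A + 1); set x0 := psi y.
have y1 : 1 <= y by rewrite /y le_max lexx.
have y0 : 0 <= y by apply: le_trans y1.
have Ay : A < y by rewrite /y lt_max [A < A + 1]ltrDl ltr01 orbT.
have X1 : 0 < X 1 by apply: psi_inv_gt0.
have q0 : 0 <= X (x0 ^+ 2) / X 1.
  by apply: divr_ge0 (ltW X1); apply: psi_inv_ge0; rewrite sqr_ge0.
exists (1 + C + X (x0 ^+ 2) / X 1) => [|x x1]; first lra.
have xx0 : 0 <= x by apply: le_trans x1.
have Xx : X 1 <= X x by apply: le_psi_inv.
have [xl|xg] := leP x x0.
  apply: le_trans (_ : X (x0 ^+ 2) / X 1 * X x <= _); last first.
    by rewrite ler_wpM2r ?psi_inv_ge0 //; lra.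
  apply: le_trans (_ : X (x0 ^+ 2) <= _).
    by apply: le_psi_inv; rewrite ?sqr_ge0 // lerXn2r // nnegrE // psi_ge0.
  rewrite mulrAC ler_pdivlMr // ler_wpM2l //.
  by apply: psi_inv_ge0; rewrite sqr_ge0.
apply: le_trans (_ : C * X x <= _); last first.
  by rewrite ler_wpM2r ?psi_inv_ge0 //; lra.
have hx : A < X x.
  apply: lt_trans Ay _; rewrite ltNge psi_inv_leP //; rewrite -ltNge //.
have := hA _ hx; rewrite psi_invK // => h.
by rewrite psi_inv_leP ?sqr_ge0 // mulr_ge0 ?psi_inv_ge0 //; exact: ltW.
Qed.

(** Iteration of [psi_inv_sqr]. Every polynomial loss in [1 / (1 - |z|)] will be
    absorbed in this way. *)
Lemma psi_inv_exp N : exists2 K, 1 <= K &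
  forall x, 1 <= x -> X (x ^+ N) <= K * X x.
Proof.
have [C C1 hC] := psi_inv_sqr.
have C0 : 0 <= C by apply: le_trans C1.
have hk k : forall x, 1 <= x -> X (x ^+ (2 ^ k)) <= C ^+ k * X x.
  elim: k => [|k IH] x x1; first by rewrite expn0 expr1 expr0 mul1r.
  rewrite expnS mulnC exprM; apply: le_trans (hC _ _) _;
    first exact: exprn_ege1.
  by rewrite exprS -mulrA ler_wpM2l // IH.
exists (C ^+ N) => [|x x1]; first exact: exprn_ege1.
apply: le_trans (hk N x x1); apply: le_psi_inv.
  by rewrite exprn_ge0 //; apply: le_trans x1.
by rewrite ler_weXn2l // ltnW // ltn_expl.
Qed.

End Orlicz.

(** * Complex differentiability in real terms *)

Section ComplexDifferentiability.
Variable R : realType.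
Local Notation C := R[i].
Implicit Types (f g : C -> C) (z w d : C).

Lemma normc_ge0 z : 0 <= normc z.
Proof. by case: z => a b; rewrite sqrtr_ge0. Qed.

Lemma normrE z : `|z| = (normc z)%:C%C.
Proof. by []. Qed.

Lemma normc_triangle z w : normc (z + w) <= normc z + normc w.
Proof. by rewrite -lecR rmorphD /= -!normrE ler_normD. Qed.

Lemma normc_opp z : normc (- z) = normc z.
Proof. by apply: (@complexI R); rewrite -!normrE normrN. Qed.

Lemma normc_dist z w : normc (z - w) = normc (w - z).
Proof. by rewrite -normc_opp opprB. Qed.

Lemma normc_real (a : R) : normc a%:C%C = `|a|.
Proof. by rewrite /= expr0n addr0 sqrtr_sqr. Qed.

Lemma normc_gt0 z : (0 < normc z) = (z != 0).
Proof.
rewrite lt_neqAle normc_ge0 andbT eq_sym; congr (~~ _).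
by apply/eqP/eqP => [/eq0_normc//|->]; rewrite normc0.
Qed.

Lemma normcX z n : normc (z ^+ n) = normc z ^+ n.
Proof. by elim: n => [|n IH]; rewrite ?normc1 // !exprS normcM IH. Qed.

Lemma normc_Re z : `|Re z| <= normc z.
Proof.
by case: z => a b /=; rewrite -sqrtr_sqr ler_wsqrtr // lerDl sqr_ge0.
Qed.

Lemma normc_Im z : `|Im z| <= normc z.
Proof.
by case: z => a b /=; rewrite -sqrtr_sqr ler_wsqrtr // lerDr sqr_ge0.
Qed.

Lemma normc_le_ReIm z : normc z <= `|Re z| + `|Im z|.
Proof.
case: z => a b /=.
rewrite -(@ger0_norm _ (`|a| + `|b|)) ?addr_ge0 // -sqrtr_sqr ler_wsqrtr //.
rewrite sqrrD !real_normK ?num_real // addrAC lerDl.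
by rewrite mulrn_wge0 // mulr_ge0.
Qed.

(** Stated with real [e] and [r], the form of all estimates below. *)
Definition cdiff f z d := forall e : R, 0 < e ->
  exists2 r : R, 0 < r &
    forall w, normc (w - z) < r ->
      normc (f w - f z - d * (w - z)) <= e * normc (w - z).

Definition ccont f z := forall e : R, 0 < e ->
  exists2 r : R, 0 < r & forall w, normc (w - z) < r -> normc (f w - f z) <= e.

(** The norm of [C] is itself complex-valued in the normed module structure, so
    radii and error bounds have to be moved between [R] and its image in [C]. *)
Lemma derivableP_cdiff f z :
  derivable (f : C^o -> C^o) z 1 <-> exists d, cdiff f z d.
Proof.
split=> [/cvg_ex[d /cvgrPdist_le h]|[d fd]].
- exists d => e e0.
  have e0' : (0 : C) < e%:C%C by rewrite ltcR.
  have /nbhs_ballP[r /= r0 hr] := h _ e0'.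
  have [rI rR] : Im r = 0 /\ 0 < Re r.
    by move: r0; rewrite ltcE => /andP[/eqP ? ?].
  exists (Re r) => // w wz.
  have [->|wz0] := eqVneq w z.
    by rewrite !subrr mulr0 subr0 normc0 mulr0.
  have u0 : w - z != 0 by rewrite subr_eq0.
  have := hr (w - z); rewrite -ball_normE /= sub0r normrN => /(_ _ u0).
  rewrite !normrE.
  have -> : r = (Re r)%:C%C by case: (r) rI => a b /= ->.
  rewrite ltcR => /(_ wz).
  rewrite [(w - z)%:A]mulr1 subrK lecR => {}hr.
  have -> : f w - f z - d * (w - z) = - (d - (w - z)^-1 * (f w - f z)) *
    (w - z).
    by field.
  by rewrite normcM normc_opp ler_wpM2r // normc_ge0.
- apply/cvg_ex; exists d; apply/cvgrPdist_le => e e0.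
  have [eI eR] : Im e = 0 /\ 0 < Re e.
    by move: e0; rewrite ltcE => /andP[/eqP ? ?].
  have -> : e = (Re e)%:C%C by case: (e) eI => a b /= ->.
  have [r r0 hr] := fd _ eR.
  apply/nbhs_ballP; exists r%:C%C => /=; first by rewrite ltcR.
  move=> h; rewrite -ball_normE /= sub0r normrN normrE ltcR => hr' h0.
  rewrite [h%:A]mulr1 lecR.
  have := hr (h + z); rewrite addrK => /(_ hr').
  have -> : f (h + z) - f z - d * h = - (d - h^-1 * (f (h + z) - f z)) * h.
    by field.
  by rewrite normcM normc_opp ler_pM2r // normc_gt0.
Qed.

Lemma cdiff_ccont f z d : cdiff f z d -> ccont f z.
Proof.
move=> fd e e0; have [r r0 hr] := fd 1 ltr01.
set L := 1 + normc d; have L0 : 0 < L by rewrite ltr_pwDl // normc_ge0.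
exists (Num.min r (e / L)); first by rewrite lt_min r0 divr_gt0.
move=> w; rewrite lt_min => /andP[/hr h1 h2].
have -> : f w - f z = (f w - f z - d * (w - z)) + d * (w - z) by ring.
apply: le_trans (normc_triangle _ _) _; rewrite normcM.
apply: le_trans (_ : normc (w - z) * L <= _);
  last by rewrite -ler_pdivlMr // ltW.
have -> : normc (w - z) * L = 1 * normc (w - z) + normc d * normc (w - z).
  by rewrite /L; ring.
by rewrite lerD2r.
Qed.

Lemma cdiff_comp f g z d d' : cdiff f z d -> cdiff g (f z) d' ->
  cdiff (g \o f) z (d' * d).
Proof.
move=> fd gd e e0.
set L := 1 + normc d; have L0 : 0 < L by rewrite ltr_pwDl // normc_ge0.
set L' := 1 + normc d'; have L'0 : 0 < L' by rewrite ltr_pwDl // normc_ge0.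
have e1 : 0 < e / 2 / L by rewrite !divr_gt0.
have e2 : 0 < Num.min 1 (e / 2 / L') by rewrite lt_min ltr01 !divr_gt0.
have [r r0 hr] := gd _ e1; have [s s0 hs] := fd _ e2.
exists (Num.min s (r / L)) => [|w]; first by rewrite lt_min s0 divr_gt0.
rewrite lt_min => /andP[/hs {}hs ws].
have fw : normc (f w - f z) <= L * normc (w - z).
  have -> : f w - f z = (f w - f z - d * (w - z)) + d * (w - z) by ring.
  apply: le_trans (normc_triangle _ _) _; rewrite normcM /L mulrDl lerD2r mul1r.
  apply: le_trans hs _; rewrite ler_piMl ?normc_ge0 //.
  by rewrite ge_min lexx.
have {}hr := hr (f w).
have /hr {}hr : normc (f w - f z) < r.
  by apply: le_lt_trans fw _; rewrite mulrC -ltr_pdivlMr.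
rewrite /= (_ : _ - _ = (g (f w) - g (f z) - d' * (f w - f z)) +
  d' * (f w - f z - d * (w - z))); last ring.
apply: le_trans (normc_triangle _ _) _; rewrite normcM.
rewrite [e](splitr e) mulrDl lerD //.
  apply: le_trans hr _; rewrite -mulrA ler_pM2l ?divr_gt0 //.
  by rewrite mulrC ler_pdivrMr // mulrC.
apply: le_trans (_ : normc d' * (e / 2 / L' * normc (w - z)) <= _).
  rewrite ler_wpM2l ?normc_ge0 //; apply: le_trans hs _.
  by rewrite ler_wpM2r ?normc_ge0 // ge_min lexx orbT.
rewrite mulrA ler_wpM2r ?normc_ge0 // mulrCA ler_piMr //;
  first by rewrite ltW ?divr_gt0.
by rewrite ler_pdivrMr // mul1r /L' lerDr.
Qed.

Lemma cdiff_local f g z d r : 0 < r ->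
  (forall w, normc (w - z) < r -> f w = g w) ->
  cdiff f z d -> cdiff g z d.
Proof.
move=> r0 fg fd e /fd[s s0 hs]; exists (Num.min r s);
  first by rewrite lt_min r0.
move=> w; rewrite lt_min => /andP[wr ws]; rewrite -!fg //; first exact: hs.
by rewrite subrr normc0.
Qed.

Lemma cdiff_divided g z d c p : z != p -> cdiff g z d ->
  exists d', cdiff (fun w => (g w - c) / (w - p)) z d'.
Proof.
move=> zp gd; apply/derivableP_cdiff.
have dg : derivable (g : C^o -> C^o) z 1 by apply/derivableP_cdiff; exists d.
have dc (e : C) : derivable (cst e : C^o -> C^o) z 1 by exact: derivable_cst.
have di : derivable (id : C^o -> C^o) z 1 by exact: derivable_id.
have d1 := derivableB dg (dc c).
have d2 := derivableB di (dc p).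
have d3 := @derivableV C C^o _ z 1 _ d2.
have zp0 : z - p != 0 by rewrite subr_eq0.
exact: (@derivableM C C^o _ _ z 1 d1 (d3 zp0)).
Qed.

End ComplexDifferentiability.

(** * Integrals of continuous functions over segments *)

Section SegmentIntegral.
Variable R : realType.
Implicit Types (f g : R -> R) (a b m : R).
Local Notation mu := (@lebesgue_measure R).

Definition sint a b f : R := \int[mu]_(x in `[a, b]) f x.

Definition scont a b f := forall x, a <= x -> x <= b -> {for x, continuous f}.

Lemma scontS a b a' b' f : a <= a' -> b' <= b -> scont a b f -> scont a' b' f.
Proof.
by move=> aa bb cf x ax xb; apply: cf; [exact: le_trans ax|exact: le_trans bb].
Qed.

Lemma scontB a b f g : scont a b f -> scont a b g ->
  scont a b (fun x => f x - g x).
Proof. by move=> cf cg x ax xb; apply: continuousB; [exact: cf|exact: cg]. Qed.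

Lemma scont_within a b f : scont a b f -> {within `[a, b], continuous f}.
Proof.
move=> cf; apply: continuous_in_subspaceT => x.
by rewrite inE /= in_itv /= => /andP[ax xb]; exact: cf.
Qed.

Lemma scont_integrable a b f : scont a b f ->
  mu.-integrable `[a, b] (EFin \o f).
Proof.
move=> cf; apply: continuous_compact_integrable; first exact: segment_compact.
exact: scont_within.
Qed.

Lemma sint_cst a b c : a <= b -> sint a b (fun=> c) = c * (b - a).
Proof.
move=> ab; rewrite /sint Rintegral_cst //; congr (_ * _).
transitivity (fine (if a%:E < b%:E then b%:E - a%:E else 0)%E).
  by congr fine; exact: (lebesgue_measure_itv `[a, b]).
rewrite lte_fin; move: ab; rewrite le_eqVlt => /orP[/eqP->|->] //.
by rewrite ltxx subrr.
Qed.

Lemma scont_cst a b c : scont a b (fun=> c).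
Proof. by move=> x _ _; exact: cvg_cst. Qed.

Lemma le_sint a b f g : scont a b f -> scont a b g ->
  (forall x, a <= x -> x <= b -> f x <= g x) -> sint a b f <= sint a b g.
Proof.
move=> cf cg fg; apply: le_Rintegral => //; try exact: scont_integrable.
by move=> x /=; rewrite in_itv /= => /andP[]; exact: fg.
Qed.

Lemma eq_sint a b f g : (forall x, a <= x -> x <= b -> f x = g x) ->
  sint a b f = sint a b g.
Proof.
move=> fg; apply: eq_Rintegral => x.
by rewrite inE /= in_itv /= => /andP[]; exact: fg.
Qed.

Lemma sintB a b f g : scont a b f -> scont a b g ->
  sint a b (fun x => f x - g x) = sint a b f - sint a b g.
Proof. by move=> cf cg; apply: RintegralB => //; exact: scont_integrable. Qed.

Lemma sint_split a b f m : a <= m -> m <= b -> scont a b f ->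
  sint a b f = sint a m f + sint m b f.
Proof.
move=> am mb cf; have i := scont_integrable cf.
rewrite /sint; have := @Rintegral_itvB R f (BLeft a) (BRight b) m i.
rewrite !bnd_simp => /(_ am mb) /eqP; rewrite subr_eq addrC => /eqP ->.
congr (_ + _); rewrite Rintegral_itv_obnd_cbnd //.
apply: integrableS (i) => //; apply: subset_itvr; by rewrite bnd_simp.
Qed.

(** The form in which integrals over the sides of a rectangle are estimated:
    an integrand close to a constant. *)
Lemma sint_near a b f c M : a <= b -> scont a b f ->
  (forall x, a <= x -> x <= b -> `|f x - c| <= M) ->
  `|sint a b f - c * (b - a)| <= M * (b - a).
Proof.
move=> ab cf h.
have lo : (c - M) * (b - a) <= sint a b f.
  rewrite -sint_cst //; apply: le_sint => // [|x ax xb]; first exact: scont_cst.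
  by have := h x ax xb; rewrite ler_norml; lra.
have hi : sint a b f <= (c + M) * (b - a).
  rewrite -sint_cst //; apply: le_sint => // [|x ax xb]; first exact: scont_cst.
  by have := h x ax xb; rewrite ler_norml; lra.
by rewrite ler_norml; lra.
Qed.

Lemma sint_point a f : sint a a f = 0.
Proof. by rewrite /sint set_itv1 Rintegral_set1. Qed.

Lemma scontD a b f g : scont a b f -> scont a b g ->
  scont a b (fun x => f x + g x).
Proof. by move=> cf cg x ax xb; apply: continuousD; [exact: cf|exact: cg]. Qed.

Lemma scontZ a b c f : scont a b f -> scont a b (fun x => c * f x).
Proof. by move=> cf x ax xb; apply: cvgM; [exact: cvg_cst|exact: cf]. Qed.

Lemma sintD a b f g : scont a b f -> scont a b g ->
  sint a b (fun x => f x + g x) = sint a b f + sint a b g.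
Proof. by move=> cf cg; apply: RintegralD => //; exact: scont_integrable. Qed.

Lemma sintZ a b c f : scont a b f ->
  sint a b (fun x => c * f x) = c * sint a b f.
Proof. by move=> cf; apply: RintegralZl => //; exact: scont_integrable. Qed.

Lemma sint_ge0 a b f : (forall x, a <= x -> x <= b -> 0 <= f x) ->
  0 <= sint a b f.
Proof.
by move=> f0; apply: Rintegral_ge0 => x /=; rewrite in_itv /= => /andP[];
  exact: f0.
Qed.

End SegmentIntegral.

(** * Goursat's theorem for rectangles *)

Section Goursat.
Variable R : realType.
Local Notation C := R[i].
Implicit Types (k : C -> C) (z c d : C) (x y : R).

Definition inrect x1 x2 y1 y2 z :=
  [/\ x1 <= Re z, Re z <= x2, y1 <= Im z & Im z <= y2].

Lemma dist_between (a b u v : R) : a <= u -> u <= b -> a <= v -> v <= b ->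
  `|u - v| <= b - a.
Proof. by rewrite ler_norml; lra. Qed.

(** The imaginary part of the contour integral of [k] along the boundary of the
    rectangle. Multiplying [k] by [i] turns the real part into it, so that its
    vanishing for all holomorphic [k] is the full statement of Cauchy's
    theorem. *)
Definition circ k x1 x2 y1 y2 : R :=
  sint x1 x2 (fun x => Im (k (x +i* y1)%C) - Im (k (x +i* y2)%C)) +
  sint y1 y2 (fun y => Re (k (x2 +i* y)%C) - Re (k (x1 +i* y)%C)).

Definition rcont k x1 x2 y1 y2 := forall z, inrect x1 x2 y1 y2 z -> ccont k z.

Lemma inrectS x1 x2 y1 y2 a1 a2 b1 b2 z :
  x1 <= a1 -> a2 <= x2 -> y1 <= b1 -> b2 <= y2 ->
  inrect a1 a2 b1 b2 z -> inrect x1 x2 y1 y2 z.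
Proof. by move=> ? ? ? ? [? ? ? ?]; split; lra. Qed.

Lemma rcontS k x1 x2 y1 y2 a1 a2 b1 b2 :
  x1 <= a1 -> a2 <= x2 -> y1 <= b1 -> b2 <= y2 ->
  rcont k x1 x2 y1 y2 -> rcont k a1 a2 b1 b2.
Proof. by move=> h1 h2 h3 h4 ck z /(inrectS h1 h2 h3 h4); exact: ck. Qed.

(** [T] is the modulus or one of the coordinates, and [e] parametrizes a
    horizontal or a vertical line; both are contractions. *)
Lemma ccont_slice (T : C -> R) (e : R -> C) k x :
  (forall z w, `|T z - T w| <= normc (z - w)) ->
  (forall x' x'', normc (e x' - e x'') <= `|x' - x''|) ->
  ccont k (e x) -> {for x, continuous (fun x' : R => T (k (e x')))}.
Proof.
move=> hT he ck; apply/cvgrPdist_le => /= eps eps0.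
have [r r0 hr] := ck _ eps0.
near=> t.
rewrite distrC; apply: le_trans (hT _ _) _; apply: hr;
  apply: le_lt_trans (he _ _) _.
by rewrite distrC; near: t; exact: (nbhsx_ballx x _ r0).
Unshelve. all: by end_near. Qed.

Lemma ReB z w : Re (z - w) = Re z - Re w.
Proof. by case: z w => [a b] [c d]. Qed.

Lemma ImB z w : Im (z - w) = Im z - Im w.
Proof. by case: z w => [a b] [c d]. Qed.

Lemma ReM z w : Re (z * w) = Re z * Re w - Im z * Im w.
Proof. by case: z w => [a b] [c d]. Qed.

Lemma ImM z w : Im (z * w) = Re z * Im w + Im z * Re w.
Proof. by case: z w => [a b] [c d]. Qed.

Lemma dist_Re z w : `|Re z - Re w| <= normc (z - w).
Proof. by rewrite -ReB normc_Re. Qed.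

Lemma dist_Im z w : `|Im z - Im w| <= normc (z - w).
Proof. by rewrite -ImB normc_Im. Qed.

Lemma dist_horizontal y x x' : normc ((x +i* y) - (x' +i* y))%C <= `|x - x'|.
Proof. by rewrite /= subrr expr0n addr0 sqrtr_sqr. Qed.

Lemma dist_vertical x y y' : normc ((x +i* y) - (x +i* y'))%C <= `|y - y'|.
Proof. by rewrite /= subrr expr0n add0r sqrtr_sqr. Qed.

Section Slices.
Variables (k : C -> C) (x1 x2 y1 y2 : R).
Hypothesis kc : rcont k x1 x2 y1 y2.

Lemma rcont_Im_x y : y1 <= y -> y <= y2 ->
  scont x1 x2 (fun x => Im (k (x +i* y)%C)).
Proof.
move=> ? ? x ? ?; apply: (ccont_slice dist_Im (dist_horizontal y)).
by apply: kc; split.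
Qed.

Lemma rcont_Re_y x : x1 <= x -> x <= x2 ->
  scont y1 y2 (fun y => Re (k (x +i* y)%C)).
Proof.
move=> ? ? y ? ?; apply: (ccont_slice dist_Re (dist_vertical x)).
by apply: kc; split.
Qed.

Lemma circ_splitx m : x1 <= m -> m <= x2 -> y1 <= y2 ->
  circ k x1 x2 y1 y2 = circ k x1 m y1 y2 + circ k m x2 y1 y2.
Proof.
move=> xm mx yy; have xx := le_trans xm mx; rewrite /circ.
rewrite (@sint_split _ _ _ _ m) //; last by apply: scontB; apply: rcont_Im_x.
have h : forall x, x1 <= x -> x <= x2 -> _ := rcont_Re_y.
have c1 := h x1 (lexx _) xx; have c2 := h x2 xx (lexx _); have cm := h m xm mx.
rewrite (sintB c2 c1) (sintB cm c1) (sintB c2 cm); ring.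
Qed.

Lemma circ_splity m : y1 <= m -> m <= y2 -> x1 <= x2 ->
  circ k x1 x2 y1 y2 = circ k x1 x2 y1 m + circ k x1 x2 m y2.
Proof.
move=> ym my xx; have yy := le_trans ym my; rewrite /circ.
rewrite (@sint_split _ y1 y2 _ m) //; last by apply: scontB; apply: rcont_Re_y.
have h : forall y, y1 <= y -> y <= y2 -> _ := rcont_Im_x.
have c1 := h y1 (lexx _) yy; have c2 := h y2 yy (lexx _); have cm := h m ym my.
rewrite (sintB c1 c2) (sintB c1 cm) (sintB cm c2); ring.
Qed.

(** The affine part contributes [Re d] times the area on both pairs of opposite
    sides, with opposite signs: this cancellation is the Cauchy-Riemann
    equations, and only the error [e] is left, times the perimeter. *)
Lemma circ_near_affine c d e : x1 <= x2 -> y1 <= y2 ->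
  (forall z, inrect x1 x2 y1 y2 z -> normc (k z - c - d * z) <= e) ->
  `|circ k x1 x2 y1 y2| <= 2 * e * ((x2 - x1) + (y2 - y1)).
Proof.
move=> xx yy h.
have hI z : inrect x1 x2 y1 y2 z ->
    `|Im (k z) - Im c - (Re d * Im z + Im d * Re z)| <= e.
  move=> /h; apply: le_trans; apply: le_trans (normc_Im _).
  by rewrite !(ReB, ImB, ReM, ImM).
have hR z : inrect x1 x2 y1 y2 z ->
    `|Re (k z) - Re c - (Re d * Re z - Im d * Im z)| <= e.
  move=> /h; apply: le_trans; apply: le_trans (normc_Re _).
  by rewrite !(ReB, ImB, ReM, ImM).
have A : `|sint x1 x2 (fun x => Im (k (x +i* y1)%C) - Im (k (x +i* y2)%C)) -
    (Re d * (y1 - y2)) * (x2 - x1)| <= 2 * e * (x2 - x1).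
  apply: sint_near => //; first by apply: scontB; apply: rcont_Im_x.
  move=> x ? ?.
  have /= := hI (x +i* y1)%C; have /= := hI (x +i* y2)%C.
  have r1 : inrect x1 x2 y1 y2 (x +i* y1)%C by split.
  have r2 : inrect x1 x2 y1 y2 (x +i* y2)%C by split.
  by move=> /(_ r2) + /(_ r1); rewrite !ler_norml; lra.
have B : `|sint y1 y2 (fun y => Re (k (x2 +i* y)%C) - Re (k (x1 +i* y)%C)) -
    (Re d * (x2 - x1)) * (y2 - y1)| <= 2 * e * (y2 - y1).
  apply: sint_near => //; first by apply: scontB; apply: rcont_Re_y.
  move=> y ? ?.
  have /= := hR (x1 +i* y)%C; have /= := hR (x2 +i* y)%C.
  have r1 : inrect x1 x2 y1 y2 (x1 +i* y)%C by split.
  have r2 : inrect x1 x2 y1 y2 (x2 +i* y)%C by split.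
  by move=> /(_ r2) + /(_ r1); rewrite !ler_norml; lra.
rewrite /circ; move: A B; set I1 := sint _ _ _; set I2 := sint _ _ _.
by rewrite !ler_norml; lra.
Qed.

Lemma circ_bounded M : x1 <= x2 -> y1 <= y2 ->
  (forall z, inrect x1 x2 y1 y2 z -> normc (k z) <= M) ->
  `|circ k x1 x2 y1 y2| <= 2 * M * ((x2 - x1) + (y2 - y1)).
Proof.
move=> xx yy h; apply: (@circ_near_affine 0 0) => // z /h.
by rewrite mul0r !subr0.
Qed.

End Slices.

Let quarter (q q' : R * R * R * R) : Prop :=
  let: (x1, x2, y1, y2) := q in let: (a1, a2, b1, b2) := q' in
  [/\ x1 <= a1, a2 <= x2, y1 <= b1 & b2 <= y2] /\
  (a2 - a1 = (x2 - x1) / 2 /\ b2 - b1 = (y2 - y1) / 2).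

Let circ4 k (q : R * R * R * R) :=
  let: (x1, x2, y1, y2) := q in circ k x1 x2 y1 y2.

Let rect4 k (q : R * R * R * R) :=
  let: (x1, x2, y1, y2) := q in [/\ x1 <= x2, y1 <= y2 & rcont k x1 x2 y1 y2].

Let bisect k q : rect4 k q ->
  exists q', [/\ quarter q q', rect4 k q' & `|circ4 k q| <= 4 * `|circ4 k q'|].
Proof.
case: q => [[[x1 x2] y1] y2] [xx yy kc].
set mx := (x1 + x2) / 2; set my := (y1 + y2) / 2.
have [h1 h2] : x1 <= mx /\ mx <= x2 by rewrite /mx; split; lra.
have [h3 h4] : y1 <= my /\ my <= y2 by rewrite /my; split; lra.
have ex : mx - x1 = (x2 - x1) / 2 by rewrite /mx; field.
have ex' : x2 - mx = (x2 - x1) / 2 by rewrite /mx; field.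
have ey : my - y1 = (y2 - y1) / 2 by rewrite /my; field.
have ey' : y2 - my = (y2 - y1) / 2 by rewrite /my; field.
have xl : x1 <= x1 by []. have xr : x2 <= x2 by [].
have yl : y1 <= y1 by []. have yr : y2 <= y2 by [].
have E : circ k x1 x2 y1 y2 =
    (circ k x1 mx y1 my + circ k x1 mx my y2) +
    (circ k mx x2 y1 my + circ k mx x2 my y2).
  rewrite (circ_splitx kc h1 h2 yy)
    (circ_splity (rcontS xl h2 yl yr kc) h3 h4 h1).
  by rewrite (circ_splity (rcontS h1 xr yl yr kc) h3 h4 h2).
have T : `|circ k x1 x2 y1 y2| <=
  (`|circ k x1 mx y1 my| + `|circ k x1 mx my y2|) +
    (`|circ k mx x2 y1 my| + `|circ k mx x2 my y2|).
  rewrite E; apply: le_trans (ler_normD _ _) _; apply: lerD; exact: ler_normD.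
have [c1|c1] := leP `|circ k x1 x2 y1 y2| (4 * `|circ k x1 mx y1 my|).
  exists (x1, mx, y1, my); split => //=; last by split=> //; exact: rcontS kc.
have [c2|c2] := leP `|circ k x1 x2 y1 y2| (4 * `|circ k x1 mx my y2|).
  exists (x1, mx, my, y2); split => //=; last by split=> //; exact: rcontS kc.
have [c3|c3] := leP `|circ k x1 x2 y1 y2| (4 * `|circ k mx x2 y1 my|).
  exists (mx, x2, y1, my); split => //=; last by split=> //; exact: rcontS kc.
exists (mx, x2, my, y2); split => //=; last by move: T c1 c2 c3; clear; lra.
by split=> //; exact: rcontS kc.
Qed.

(** Goursat's bisection argument. Nested quarters whose circulation decreases at
    most by the factor [4] shrink to a point [z]; differentiability at [z] makes
    the circulation of a quarter of size [s] of order [e * s ^ 2], for every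
    [e], while the size is halved at each step. *)
Lemma goursat k x1 x2 y1 y2 : x1 <= x2 -> y1 <= y2 ->
  rcont k x1 x2 y1 y2 ->
  (forall z, inrect x1 x2 y1 y2 z -> exists d, cdiff k z d) ->
  circ k x1 x2 y1 y2 = 0.
Proof.
move=> xx yy kc kd; pose q0 : R * R * R * R := (x1, x2, y1, y2).
have /choice[F hF] : forall q, exists q', rect4 k q ->
    [/\ quarter q q', rect4 k q' & `|circ4 k q| <= 4 * `|circ4 k q'|].
  move=> q; have [hq|hq] := pselect (rect4 k q); last by exists q => /hq.
  by have [q' h] := bisect hq; exists q'.
pose Q n := iter n F q0.
have Qr n : rect4 k (Q n) by elim: n => [|n IH] //=; have [] := hF _ IH.
have Qq n : quarter (Q n) (Q n.+1) by have [] := hF _ (Qr n).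
have Qc n : `|circ4 k q0| <= 4 ^+ n * `|circ4 k (Q n)|.
  elim: n => [|n IH]; first by rewrite expr0 mul1r.
  apply: le_trans IH _; rewrite exprSr -mulrA ler_wpM2l ?exprn_ge0 //.
  by have [] := hF _ (Qr n).
pose a n := (Q n).1.1.1; pose b n := (Q n).1.1.2.
pose c n := (Q n).1.2; pose d n := (Q n).2.
have QE n : Q n = (a n, b n, c n, d n).
  by rewrite /a /b /c /d; case: (Q n) => [[[? ?] ?] ?].
have step n : [/\ a n <= a n.+1, b n.+1 <= b n, c n <= c n.+1 & d n.+1 <= d n]
  /\
    (b n.+1 - a n.+1 = (b n - a n) / 2 /\ d n.+1 - c n.+1 = (d n - c n) / 2).
  by have := Qq n; rewrite (QE n) (QE n.+1).
have rect n : [/\ a n <= b n, c n <= d n & rcont k (a n) (b n) (c n) (d n)].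
  by have := Qr n; rewrite (QE n).
have size n : b n - a n = (x2 - x1) / 2 ^+ n /\ d n - c n = (y2 - y1) / 2 ^+ n.
  elim: n => [|n [IH1 IH2]]; first by rewrite expr0 !divr1.
  have [_ [-> ->]] := step n; rewrite IH1 IH2 exprSr.
  by split; field; rewrite expf_neq0.
have am : {homo a : n m / (n <= m)%N >-> n <= m}.
  by apply: homo_leq => // [? ? ?|n]; [exact: le_trans|have [[]] := step n].
have bm : {homo b : n m / (n <= m)%N >-> m <= n}.
  apply: (@homo_leq _ b (fun x y => y <= x)) => // [? ? ? h1 h2|n].
    exact: le_trans h1.
  by have [[]] := step n.
have cm : {homo c : n m / (n <= m)%N >-> n <= m}.
  by apply: homo_leq => // [? ? ?|n]; [exact: le_trans|have [[]] := step n].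
have dm : {homo d : n m / (n <= m)%N >-> m <= n}.
  apply: (@homo_leq _ d (fun x y => y <= x)) => // [? ? ? h1 h2|n].
    exact: le_trans h1.
  by have [[]] := step n.
have nest (u v : nat -> R) : {homo u : n m / (n <= m)%N >-> n <= m} ->
    {homo v : n m / (n <= m)%N >-> m <= n} -> (forall n, u n <= v n) ->
    forall n, u n <= sup (range u) /\ sup (range u) <= v n.
  move=> um vm uv n.
  have ub m : ubound (range u) (v m).
    move=> _ [l _ <-]; have [lm|/ltnW ml] := leqP l m.
      by apply: le_trans (um _ _ lm) (uv m).
    by apply: le_trans (uv l) (vm _ _ ml).
  split; last by apply: ge_sup; [exists (u 0%N); exists 0%N|exact: ub].
  by apply: ub_le_sup; [exists (v 0%N); exact: ub|exists n].
pose z : C := (sup (range a) +i* sup (range c))%C.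
have zin n : inrect (a n) (b n) (c n) (d n) z.
  have ab m : a m <= b m by case: (rect m).
  have cd m : c m <= d m by case: (rect m).
  by have [? ?] := nest _ _ am bm ab n; have [? ?] := nest _ _ cm dm cd n;
    split.
have [D hD] := kd z (zin 0%N).
set L := (x2 - x1) + (y2 - y1).
have L0 : 0 <= L by rewrite addr_ge0 // subr_ge0.
have key e : 0 < e -> `|circ4 k q0| <= 2 * e * L ^+ 2.
  move=> e0; have [r r0 hr] := hD _ e0.
  have [n hn] : exists n, L / 2 ^+ n < r.
    exists (Num.bound (L / r)).
    rewrite ltr_pdivrMr ?exprn_gt0 // mulrC -ltr_pdivrMr //.
    apply: lt_le_trans (archi_boundP _) _; first by rewrite divr_ge0 // ltW.
    by rewrite -natrX ler_nat ltnW // ltn_expl.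
  have [s1 s2] := size n; have [ab cd kn] := rect n.
  have sz : (b n - a n) + (d n - c n) = L / 2 ^+ n by rewrite s1 s2 -mulrDl.
  have := circ_near_affine kn (c := k z - D * z) (d := D) ab cd
    (e := e * (L / 2 ^+ n)).
  have h w : inrect (a n) (b n) (c n) (d n) w ->
      normc (k w - (k z - D * z) - D * w) <= e * (L / 2 ^+ n).
    move=> [w1 w2 w3 w4]; have [z1 z2 z3 z4] := zin n.
    have wz : normc (w - z) <= L / 2 ^+ n.
      apply: le_trans (normc_le_ReIm _) _; rewrite -sz ReB ImB.
      by apply: lerD; exact: dist_between.
    have := hr w (le_lt_trans wz hn).
    rewrite (_ : k w - (k z - D * z) - D * w = k w - k z - D * (w - z));
      last ring.
    move=> /le_trans; apply; rewrite ler_wpM2l //; exact: ltW.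
  move=> /(_ h); rewrite sz => hc.
  apply: le_trans (Qc n) _; rewrite QE /=.
  apply: le_trans (ler_wpM2l _ hc) _; first by rewrite exprn_ge0.
  have -> : (4 : R) ^+ n = 2 ^+ n * 2 ^+ n by rewrite -exprMn; congr (_ ^+ _);
    ring.
  apply: le_of_eq; field.
  by rewrite expf_neq0.
apply/eqP; rewrite -normr_le0; apply/ler_addgt0Pl => /= e e0; rewrite addr0.
have M0 : 0 < 2 * L ^+ 2 + 1 by rewrite ltr_wpDl // mulr_ge0 // sqr_ge0.
have := key (e / (2 * L ^+ 2 + 1)) (divr_gt0 e0 M0) => /le_trans; apply.
have -> : 2 * (e / (2 * L ^+ 2 + 1)) * L ^+ 2 = e *
  ((2 * L ^+ 2) / (2 * L ^+ 2 + 1)).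
  by field; rewrite gt_eqF.
apply: ler_piMr; first exact: ltW.
by rewrite ler_pdivrMr // mul1r lerDl.
Qed.

End Goursat.

(** * Exceptional points and divided differences *)

Section ExceptionalPoints.
Variable R : realType.
Local Notation C := R[i].
Implicit Types (k f g : C -> C) (U : set C) (E : seq C).

(** Continuity on [U], and complex differentiability off the exceptional points
    [E]. Divided differences of a holomorphic function have this property by
    construction, and it is stable under taking further divided differences. *)
Definition holo_off U E k :=
  forall z, U z -> ccont k z /\ (z \notin E -> exists d, cdiff k z d).

Lemma holo_offS U U' E k : U' `<=` U -> holo_off U E k -> holo_off U' E k.
Proof. by move=> UU kU z /UU; exact: kU. Qed.

Lemma circ_pointx k x y1 y2 : circ k x x y1 y2 = 0.
Proof.
rewrite /circ sint_point add0r.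
under [X in sint _ _ X]eq_fun do rewrite subrr.
by rewrite /sint /Rintegral integral0.
Qed.

Lemma circ_pointy k x1 x2 y : circ k x1 x2 y y = 0.
Proof.
rewrite /circ sint_point addr0.
under [X in sint _ _ X]eq_fun do rewrite subrr.
by rewrite /sint /Rintegral integral0.
Qed.

(** An exceptional point [p] is enclosed in a rectangle of size [e]; the four
    rectangles around it avoid [p], and the circulation around the small one is
    of order [e] because [k] is bounded near [p]. *)
Lemma goursat_off E k x1 x2 y1 y2 : x1 <= x2 -> y1 <= y2 ->
  holo_off (inrect x1 x2 y1 y2) E k -> circ k x1 x2 y1 y2 = 0.
Proof.
elim: E x1 x2 y1 y2 => [|p E IH] x1 x2 y1 y2 xx yy kh.
  by apply: goursat => // z /kh[]// _; exact.
have kc : rcont k x1 x2 y1 y2 by move=> z /kh[].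
have avoid a1 a2 b1 b2 : a1 <= a2 -> b1 <= b2 ->
    x1 <= a1 -> a2 <= x2 -> y1 <= b1 -> b2 <= y2 ->
    ~ inrect a1 a2 b1 b2 p -> circ k a1 a2 b1 b2 = 0.
  move=> aa bb h1 h2 h3 h4 np; apply: IH => // z zr.
  have [kcz kdz] := kh z (inrectS h1 h2 h3 h4 zr).
  split=> // zE; apply: kdz; rewrite inE negb_or zE andbT.
  by apply/eqP => zp; apply: np; rewrite -zp.
have [pr|] := pselect (inrect x1 x2 y1 y2 p); last by apply: avoid.
case: (pr) => p1 p2 p3 p4.
have [r r0 hr] := kc p pr 1 ltr01.
set M := normc (k p) + 1.
have M0 : 0 < M by rewrite ltr_wpDl // normc_ge0.
have key e : 0 < e -> 4 * e < r -> `|circ k x1 x2 y1 y2| <= 8 * M * e.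
  move=> e0 er.
  set a1 := Num.max x1 (Re p - e); set a2 := Num.min x2 (Re p + e).
  set b1 := Num.max y1 (Im p - e); set b2 := Num.min y2 (Im p + e).
  have [ha1 ha1' ha1''] : [/\ x1 <= a1, a1 <= Re p & Re p - e <= a1].
    by rewrite /a1 !ge_max !le_max !lexx p1 gerBl (ltW e0) orbT.
  have [ha2 ha2' ha2''] : [/\ a2 <= x2, Re p <= a2 & a2 <= Re p + e].
    by rewrite /a2 !le_min !ge_min !lexx p2 lerDl (ltW e0) orbT.
  have [hb1 hb1' hb1''] : [/\ y1 <= b1, b1 <= Im p & Im p - e <= b1].
    by rewrite /b1 !ge_max !le_max !lexx p3 gerBl (ltW e0) orbT.
  have [hb2 hb2' hb2''] : [/\ b2 <= y2, Im p <= b2 & b2 <= Im p + e].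
    by rewrite /b2 !le_min !ge_min !lexx p4 lerDl (ltW e0) orbT.
  have aa : a1 <= a2 by exact: le_trans ha2'.
  have bb : b1 <= b2 by exact: le_trans hb2'.
  have a1x : a1 <= x2 by exact: le_trans p2.
  have b1y : b1 <= y2 by exact: le_trans p4.
  have left0 : circ k x1 a1 y1 y2 = 0.
    have [h|h] := leP (Re p - e) x1.
      have -> : a1 = x1 by apply/max_idPl.
      exact: circ_pointx.
    have a1E : a1 = Re p - e by apply/max_idPr/ltW.
    by apply: avoid => //; case => _; rewrite a1E lerBrDr gerDl leNgt e0.
  have right0 : circ k a2 x2 y1 y2 = 0.
    have [h|h] := leP x2 (Re p + e).
      have -> : a2 = x2 by apply/min_idPl.
      exact: circ_pointx.
    have a2E : a2 = Re p + e by apply/min_idPr/ltW.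
    apply: avoid => //; first exact: le_trans ha2'.
    by case; rewrite a2E gerDl leNgt e0.
  have bot0 : circ k a1 a2 y1 b1 = 0.
    have [h|h] := leP (Im p - e) y1.
      have -> : b1 = y1 by apply/max_idPl.
      exact: circ_pointy.
    have b1E : b1 = Im p - e by apply/max_idPr/ltW.
    by apply: avoid => //; case => _ _ _; rewrite b1E lerBrDr gerDl leNgt e0.
  have top0 : circ k a1 a2 b2 y2 = 0.
    have [h|h] := leP y2 (Im p + e).
      have -> : b2 = y2 by apply/min_idPl.
      exact: circ_pointy.
    have b2E : b2 = Im p + e by apply/min_idPr/ltW.
    apply: avoid => //; first exact: le_trans hb2'.
    by case=> _ _; rewrite b2E gerDl leNgt e0.
  have l x : x <= x :> R by [].
  rewrite (circ_splitx kc ha1 a1x yy) left0 add0r.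
  have kc1 := rcontS ha1 (l _) (l _) (l _) kc.
  rewrite (circ_splitx kc1 aa ha2 yy) right0 addr0.
  have kc2 := rcontS (l _) ha2 (l _) (l _) kc1.
  rewrite (circ_splity kc2 hb1 b1y aa) bot0 add0r.
  have kc3 := rcontS (l _) (l _) hb1 (l _) kc2.
  rewrite (circ_splity kc3 bb hb2 aa) top0 addr0.
  have kc4 := rcontS (l _) (l _) (l _) hb2 kc3.
  apply: le_trans (circ_bounded kc4 aa bb (M := M) _) _.
    move=> z [z1 z2 z3 z4].
    have zp : normc (z - p) < r.
      apply: le_lt_trans er; apply: le_trans (normc_le_ReIm _) _.
      have : `|Re (z - p)| <= e by rewrite ReB ler_norml;
        clear -z1 z2 ha1'' ha2''; lra.
      have : `|Im (z - p)| <= e by rewrite ImB ler_norml;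
        clear -z3 z4 hb1'' hb2''; lra.
      by clear -e0; lra.
    have -> : k z = k p + (k z - k p) by ring.
    apply: le_trans (normc_triangle _ _) _; rewrite /M lerD2l; exact: hr.
  have -> : 8 * M * e = 2 * M * (4 * e) by ring.
  apply: ler_wpM2l; first by rewrite mulr_ge0 // ltW.
  by clear -ha1'' ha2'' hb1'' hb2''; lra.
apply/eqP; rewrite -normr_le0; apply/ler_addgt0Pl => /= e e0; rewrite addr0.
set t := Num.min (r / 8) (e / (8 * M)).
have M8 : 0 < 8 * M by rewrite mulr_gt0.
have t0 : 0 < t by rewrite lt_min !divr_gt0.
have t1 : t <= r / 8 by rewrite ge_min lexx.
apply: le_trans (key t t0 _) _; first lra.
by rewrite mulrC -ler_pdivlMr // ge_min lexx orbT.
Qed.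

(** Continuous at [p] when [d] is the derivative of [g] there. *)
Definition divdiff g p d : C -> C :=
  fun w => if w == p then d else (g w - g p) / (w - p).

Lemma divdiffE g p d w : w != p -> divdiff g p d w = (g w - g p) / (w - p).
Proof. by rewrite /divdiff => /negbTE ->. Qed.

Lemma ccont_local f g z r : 0 < r ->
  (forall w, normc (w - z) < r -> f w = g w) ->
  ccont f z -> ccont g z.
Proof.
move=> r0 fg fc e /fc[s s0 hs]; exists (Num.min r s);
  first by rewrite lt_min r0.
move=> w; rewrite lt_min => /andP[wr ws]; rewrite -!fg //; first exact: hs.
by rewrite subrr normc0.
Qed.

Lemma ccontP f z : ccont f z <-> f x @[x --> (z : C^o)] --> (f z : C^o).
Proof.
have F : Filter (nbhs (z : C^o)) by exact: nbhs_filter.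
have L := @cvgrPdist_le C C^o _ _ F f (f z).
split=> [fc|/L fc e e0].
  apply/L => e e0.
  have [eI eR] : Im e = 0 /\ 0 < Re e.
    by move: e0; rewrite ltcE => /andP[/eqP ? ?].
  have -> : e = (Re e)%:C%C by case: (e) eI => a b /= ->.
  have [r r0 hr] := fc _ eR.
  apply/nbhs_ballP; exists r%:C%C => /=; first by rewrite ltcR.
  move=> w; rewrite -ball_normE /= !normrE ltcR lecR normc_dist => /hr.
  by rewrite normc_dist.
have e0' : (0 : C) < e%:C%C by rewrite ltcR.
have /nbhs_ballP[r /= r0 hr] := fc _ e0'.
have [rI rR] : Im r = 0 /\ 0 < Re r.
  by move: r0; rewrite ltcE => /andP[/eqP ? ?].
exists (Re r) => // w wz.
have := hr w; rewrite -ball_normE /= !normrE lecR [normc (f w - _)]normc_dist;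
  apply.
have -> : r = (Re r)%:C%C by case: (r) rI => a b /= ->.
by rewrite ltcR normc_dist.
Qed.

Lemma ccont_divided g z c p : z != p -> ccont g z ->
  ccont (fun w => (g w - c) / (w - p)) z.
Proof.
move=> zp /ccontP gz; apply/ccontP.
have F : Filter (nbhs (z : C^o)) by exact: nbhs_filter.
have zp0 : z - p != 0 by rewrite subr_eq0.
have h1 : g x - c @[x --> (z : C^o)] --> (g z - c : C^o).
  by apply: (@cvgB C C^o _ _ F) gz _; exact: cvg_cst.
have h2 : x - p @[x --> (z : C^o)] --> (z - p : C^o).
  by apply: (@cvgB C C^o _ _ F); [exact: cvg_id|exact: cvg_cst].
exact: (@cvgM C _ _ F _ _ _ _ h1 (@cvgV C _ _ F _ _ zp0 h2)).
Qed.

Lemma holo_off_divdiff U E g p d : cdiff g p d ->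
  holo_off U E g -> holo_off U (p :: E) (divdiff g p d).
Proof.
move=> gd gU z Uz; have [gc gdz] := gU z Uz.
have [->|zp] := eqVneq z p.
  split; last by rewrite inE eqxx.
  move=> e e0; have [r r0 hr] := gd e e0; exists r => // w wp.
  rewrite {2}/divdiff eqxx; have [->|wp0] := eqVneq w p.
    by rewrite /divdiff eqxx subrr normc0 ltW.
  have wp1 : 0 < normc (w - p) by rewrite normc_gt0 subr_eq0.
  rewrite divdiffE // -(ler_pM2r wp1) -normcM.
  have -> : ((g w - g p) / (w - p) - d) * (w - p) = g w - g p - d * (w - p).
    by field; rewrite subr_eq0.
  exact: hr.
have zp1 : 0 < normc (z - p) by rewrite normc_gt0 subr_eq0.
have loc w : normc (w - z) < normc (z - p) ->
    (g w - g p) / (w - p) = divdiff g p d w.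
  move=> wz; rewrite divdiffE //; apply/eqP => wp.
  by move: wz; rewrite wp normc_dist ltxx.
split; first by apply: (ccont_local zp1 loc); exact: ccont_divided.
rewrite inE negb_or => /andP[_ /gdz[d' /(cdiff_divided (g p) zp)[d'' h]]].
by exists d''; exact: (cdiff_local zp1 loc h).
Qed.

End ExceptionalPoints.

(** * Mean value and maximum inequalities on rectangles *)

Section MeanInequality.
Variable R : realType.
Local Notation C := R[i].
Implicit Types (k f g : C -> C) (U : set C) (E : seq C).

Lemma normc_sub_ge (z w : C) : `|normc z - normc w| <= normc (z - w).
Proof.
have h1 := normc_triangle (z - w) w; have h2 := normc_triangle (w - z) z.
by move: h1 h2; rewrite !subrK normc_dist ler_norml; lra.
Qed.

Lemma scont_normc_x k x1 x2 y1 y2 y : rcont k x1 x2 y1 y2 -> y1 <= y ->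
  y <= y2 ->
  scont x1 x2 (fun x => normc (k (x +i* y)%C)).
Proof.
move=> kc ? ? x ? ?; apply: (ccont_slice normc_sub_ge (dist_horizontal y)).
by apply: kc; split.
Qed.

Lemma scont_normc_y k x1 x2 y1 y2 x : rcont k x1 x2 y1 y2 -> x1 <= x ->
  x <= x2 ->
  scont y1 y2 (fun y => normc (k (x +i* y)%C)).
Proof.
move=> kc ? ? y ? ?; apply: (ccont_slice normc_sub_ge (dist_vertical x)).
by apply: kc; split.
Qed.

Lemma ReV (w : C) : Re w^-1 = Re w / (Re w ^+ 2 + Im w ^+ 2).
Proof. by case: w. Qed.

Lemma ImV (w : C) : Im w^-1 = - Im w / (Re w ^+ 2 + Im w ^+ 2).
Proof. by case: w => a b; rewrite mulNr. Qed.

Lemma Im_rotate (X w : C) : Im (X / w) = Re (X / ((0 +i* 1)%C * w)).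
Proof.
rewrite invfM mulrCA mulrC [RHS]ReM ReV ImV /= expr0n expr1n /= add0r !divr1.
ring.
Qed.

Lemma ImN_rotate (X w : C) : - Im (X / w) = Re (X / ((0 +i* (-1))%C * w)).
Proof.
rewrite invfM mulrCA mulrC [RHS]ReM ReV ImV /= expr0n sqrrN expr1n /= add0r
  !divr1.
ring.
Qed.

Lemma ReN_rotate (X w : C) : - Re (X / w) = Re (X / - w).
Proof. by rewrite invrN mulrN; case: (X / w). Qed.

(** [Re (1 / w)] is at least [1 / (4 rho)] on the right-hand side of a rectangle
    around the origin of half-size between [rho / 2] and [rho]; the other sides
    are reduced to this one by a rotation. *)
Lemma kernel_bound rho m (G w : C) : 0 < rho -> 0 <= m ->
  rho / 2 <= Re w -> Re w <= rho -> `|Im w| <= rho ->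
  Re ((G - m%:C%C) / w) <= 2 / rho * normc G - m / (4 * rho).
Proof.
move=> r0 m0 h1 h2; rewrite ler_norml => /andP[h3 h4].
have w0 : 0 < Re w by apply: lt_le_trans h1; rewrite divr_gt0.
have D0 : 0 < Re w ^+ 2 + Im w ^+ 2 by rewrite ltr_wpDr ?sqr_ge0 // exprn_gt0.
rewrite mulrBl ReB [Re (m%:C%C * _)]ReM /= mul0r subr0; apply: lerB.
  apply: le_trans (ler_norm _) _; apply: le_trans (normc_Re _) _.
  rewrite normcM normcV mulrC ler_wpM2r ?normc_ge0 //.
  have rw : Re w <= normc w by apply: le_trans (ler_norm _) (normc_Re _).
  rewrite -[2 / rho]invrK lef_pV2 ?posrE; last 2 first.
  - exact: lt_le_trans rw.
  - by rewrite invr_gt0 divr_gt0.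
  by rewrite invf_div; exact: le_trans rw.
rewrite ler_wpM2l // ReV ler_pdivlMr // mulrC ler_pdivrMr ?mulr_gt0 //.
have : Im w ^+ 2 <= rho ^+ 2 by nra.
have : Re w ^+ 2 <= rho ^+ 2 by nra.
nra.
Qed.

Lemma offset_low (c t rho : R) : c - rho <= t -> t <= c - rho / 2 ->
  rho / 2 <= c - t <= rho.
Proof. by move=> *; apply/andP; split; lra. Qed.

Lemma offset_high (c t rho : R) : c + rho / 2 <= t -> t <= c + rho ->
  rho / 2 <= t - c <= rho.
Proof. by move=> *; apply/andP; split; lra. Qed.

Lemma offset_within (c t rho : R) : c - rho <= t -> t <= c + rho ->
  `|t - c| <= rho.
Proof. by rewrite ler_norml; lra. Qed.

Definition side_integrals g x1 x2 y1 y2 : R :=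
  sint x1 x2 (fun x => normc (g (x +i* y1)%C)) +
  sint x1 x2 (fun x => normc (g (x +i* y2)%C)) +
  (sint y1 y2 (fun y => normc (g (x1 +i* y)%C)) +
   sint y1 y2 (fun y => normc (g (x2 +i* y)%C))).

Section Rectangle.
Variables (bR bI rho x1 x2 y1 y2 : R).
Hypotheses (rho0 : 0 < rho).
Hypotheses (x1l : bR - rho <= x1) (x1r : x1 <= bR - rho / 2).
Hypotheses (x2l : bR + rho / 2 <= x2) (x2r : x2 <= bR + rho).
Hypotheses (y1l : bI - rho <= y1) (y1r : y1 <= bI - rho / 2).
Hypotheses (y2l : bI + rho / 2 <= y2) (y2r : y2 <= bI + rho).
Local Notation b := (bR +i* bI)%C.

(* The circulation of the divided difference of [g] at [b] vanishes. On
   each side [kernel_bound] separates the contribution of [g b] from that of the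
   boundary values of [g]. *)
Let mean_rect_nneg g E : b \notin E -> holo_off (inrect x1 x2 y1 y2) E g ->
  Im (g b) = 0 -> 0 <= Re (g b) ->
  Re (g b) <= 2 / rho * side_integrals g x1 x2 y1 y2.
Proof.
move: (rho0) (x1l) (x1r) (x2l) (x2r) (y1l) (y1r) (y2l) (y2r) =>
  r0 ? ? ? ? ? ? ? ?.
move=> bE gh gI gR; set m := Re (g b).
have gbE : g b = m%:C%C by rewrite /m; case: (g b) gI => a c /= ->.
have br : inrect x1 x2 y1 y2 b by split => /=; lra.
have xx : x1 <= x2 by lra. have yy : y1 <= y2 by lra.
have [_ /(_ bE)[d gd]] := gh b br.
set k := divdiff g b d.
have kh : holo_off (inrect x1 x2 y1 y2) (b :: E) k by apply: holo_off_divdiff.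
have k0 := goursat_off xx yy kh.
have gc : rcont g x1 x2 y1 y2 by move=> z /gh[].
have kc : rcont k x1 x2 y1 y2 by move=> z /kh[].
set c := 2 / rho; set e := m / (4 * rho).
have /andP[n1 n2] := offset_low x1l x1r;
  have /andP[n3 n4] := offset_high x2l x2r.
have /andP[n5 n6] := offset_low y1l y1r;
  have /andP[n7 n8] := offset_high y2l y2r.
have kE z : z != b -> k z = (g z - m%:C%C) / (z - b).
  by move=> zb; rewrite /k divdiffE // gbE.
have bot x : x1 <= x -> x <= x2 ->
    Im (k (x +i* y1)%C) <= c * normc (g (x +i* y1)%C) - e.
  move=> hl hr; have nx := offset_within (le_trans x1l hl) (le_trans hr x2r).
  have zb : (x +i* y1)%C != b.
    by apply/eqP => h; move: (congr1 (@complex.Im R) h) => /= ?; lra.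
  rewrite kE //; set G := g _; set w := _ - b.
  rewrite Im_rotate.
  have wR : Re w = x - bR by rewrite /w ReB.
  have wI : Im w = y1 - bI by rewrite /w ImB.
  by apply: kernel_bound => //;
    rewrite ?ReM ?ImM /= ?wR ?wI ?mulN1r ?mul0r ?mul1r ?sub0r ?add0r ?opprK
    ?normrN ?opprB.
have top x : x1 <= x -> x <= x2 ->
    - Im (k (x +i* y2)%C) <= c * normc (g (x +i* y2)%C) - e.
  move=> hl hr; have nx := offset_within (le_trans x1l hl) (le_trans hr x2r).
  have zb : (x +i* y2)%C != b.
    by apply/eqP => h; move: (congr1 (@complex.Im R) h) => /= ?; lra.
  rewrite kE //; set G := g _; set w := _ - b.
  rewrite ImN_rotate.
  have wR : Re w = x - bR by rewrite /w ReB.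
  have wI : Im w = y2 - bI by rewrite /w ImB.
  by apply: kernel_bound => //;
    rewrite ?ReM ?ImM /= ?wR ?wI ?mulN1r ?mul0r ?mul1r ?sub0r ?add0r ?opprK
    ?normrN ?opprB.
have rig y : y1 <= y -> y <= y2 ->
    Re (k (x2 +i* y)%C) <= c * normc (g (x2 +i* y)%C) - e.
  move=> hl hr; have ny := offset_within (le_trans y1l hl) (le_trans hr y2r).
  have zb : (x2 +i* y)%C != b.
    by apply/eqP => h; move: (congr1 (@complex.Re R) h) => /= ?; lra.
  rewrite kE //; set G := g _; set w := _ - b.
  have wR : Re w = x2 - bR by rewrite /w ReB.
  have wI : Im w = y - bI by rewrite /w ImB.
  by apply: kernel_bound => //; rewrite ?wR ?wI.
have lef y : y1 <= y -> y <= y2 ->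
    - Re (k (x1 +i* y)%C) <= c * normc (g (x1 +i* y)%C) - e.
  move=> hl hr; have ny := offset_within (le_trans y1l hl) (le_trans hr y2r).
  have zb : (x1 +i* y)%C != b.
    by apply/eqP => h; move: (congr1 (@complex.Re R) h) => /= ?; lra.
  rewrite kE //; set G := g _; set w := _ - b.
  rewrite ReN_rotate.
  have wR : Re (- w) = bR - x1 by rewrite /w opprB ReB.
  have wI : Im (- w) = bI - y by rewrite /w opprB ImB.
  by apply: kernel_bound => //; rewrite ?wR ?wI // distrC.
have cx1 := scont_normc_x gc (lexx y1) yy;
  have cx2 := scont_normc_x gc yy (lexx y2).
have cy1 := scont_normc_y gc (lexx x1) xx;
  have cy2 := scont_normc_y gc xx (lexx x2).
have kx1 := rcont_Im_x kc (lexx y1) yy; have kx2 := rcont_Im_x kc yy (lexx y2).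
have ky1 := rcont_Re_y kc (lexx x1) xx; have ky2 := rcont_Re_y kc xx (lexx x2).
have I1 : sint x1 x2 (fun x => Im (k (x +i* y1)%C) - Im (k (x +i* y2)%C)) <=
    c * (sint x1 x2 (fun x => normc (g (x +i* y1)%C)) +
         sint x1 x2 (fun x => normc (g (x +i* y2)%C))) - 2 * e * (x2 - x1).
  rewrite -sintD // -sintZ; last exact: scontD.
  rewrite -[2 * e * _]sint_cst // -sintB; last exact: scont_cst.
    apply: le_sint; first exact: scontB.
      by apply: scontB; [apply: scontZ; apply: scontD|exact: scont_cst].
    by move=> x h1 h2; have := bot x h1 h2; have := top x h1 h2; lra.
  by apply: scontZ; apply: scontD.
have I2 : sint y1 y2 (fun y => Re (k (x2 +i* y)%C) - Re (k (x1 +i* y)%C)) <=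
    c * (sint y1 y2 (fun y => normc (g (x1 +i* y)%C)) +
         sint y1 y2 (fun y => normc (g (x2 +i* y)%C))) - 2 * e * (y2 - y1).
  rewrite -sintD // -sintZ; last exact: scontD.
  rewrite -[2 * e * _]sint_cst // -sintB; last exact: scont_cst.
    apply: le_sint; first exact: scontB.
      by apply: scontB; [apply: scontZ; apply: scontD|exact: scont_cst].
    by move=> y h1 h2; have := rig y h1 h2; have := lef y h1 h2; lra.
  by apply: scontZ; apply: scontD.
have e0 : 0 <= e by rewrite divr_ge0 // mulr_ge0 // ltW.
have em : e * (4 * rho) = m by rewrite /e divfK // mulf_neq0 // gt_eqF.
have hx : e * rho <= e * (x2 - x1) by rewrite ler_wpM2l //; lra.
have hy : e * rho <= e * (y2 - y1) by rewrite ler_wpM2l //; lra.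
rewrite /side_integrals mulrDr -/c; move: k0 I1 I2; rewrite /circ.
move: (sint _ _ _) (sint _ _ _) => I1 I2;
  move: (c * _) (c * _) => J1 J2 h0 h1 h2.
by move: h0 h1 h2 hx hy em; lra.
Qed.

(** Cauchy's formula with an inexact constant. The sides may move between
    distances [rho / 2] and [rho] from the centre, which leaves room for an
    average over their positions in [area_mean]. *)
Lemma mean_rect g E : b \notin E -> holo_off (inrect x1 x2 y1 y2) E g ->
  normc (g b) <= 2 / rho * side_integrals g x1 x2 y1 y2.
Proof.
move=> bE gh; have [gb0|gb0] := eqVneq (g b) 0.
  rewrite gb0 normc0 mulr_ge0 ?divr_ge0 ?(ltW rho0) //.
  by rewrite /side_integrals !addr_ge0 //; apply: sint_ge0 => *;
    exact: normc_ge0.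
have n0 : 0 < normc (g b) by rewrite normc_gt0.
(* The unimodular [u] rotates [g b] onto the positive half-line. *)
pose u : C := conjc (g b) / (normc (g b))%:C%C.
have cu : normc (conjc (g b)) = normc (g b).
  by apply: (@complexI R); rewrite -!normrE normcJ.
have u1 : normc u = 1.
  rewrite /u normcM normcV cu normc_real ger0_norm ?divff ?gt_eqF // ltW //.
have ub : u * g b = (normc (g b))%:C%C.
  have nz : (normc (g b))%:C%C != 0 :> C by rewrite -normrE normr_eq0.
  apply: (mulIf nz); rewrite /u mulrAC divfK // mulrC -normrE.
  by rewrite -sqr_normc expr2.
have nu z : normc (u * g z) = normc (g z) by rewrite normcM u1 mul1r.
have ugh : holo_off (inrect x1 x2 y1 y2) E (fun z => u * g z).
  move=> z /gh[gc gd]; split.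
    move=> e e0; have [r r0 hr] := gc e e0; exists r => // w /hr.
    by rewrite -mulrBr normcM u1 mul1r.
  move=> /gd[d hd]; exists (u * d) => e e0; have [r r0 hr] := hd e e0.
  exists r => // w /hr.
  by rewrite -mulrBr -mulrA -mulrBr normcM u1 mul1r.
have := @mean_rect_nneg (fun z => u * g z) E bE ugh.
rewrite ub /= => /(_ erefl (normc_ge0 _)) h; apply: le_trans h _.
rewrite ler_wpM2l ?divr_ge0 // ?(ltW rho0) //.
apply: le_of_eq; rewrite /side_integrals.
by congr (_ + _ + (_ + _)); apply: eq_sint => t _ _; exact: nu.
Qed.

End Rectangle.

(** A weak maximum principle, with the constant [16] in place of [1]. It is used
    for divided differences, hence the exceptional points. *)
Lemma max_square g E b rho M : 0 < rho -> b \notin E ->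
  holo_off (inrect (Re b - rho) (Re b + rho) (Im b - rho) (Im b + rho)) E g ->
  (forall z, inrect (Re b - rho) (Re b + rho) (Im b - rho) (Im b + rho) z ->
     rho <= normc (z - b) -> normc (g z) <= M) ->
  normc (g b) <= 16 * M.
Proof.
case: b => bR bI /= r0 bE gh gM.
have h1 : bR - rho <= bR - rho / 2 by lra.
have h2 : bR + rho / 2 <= bR + rho by lra.
have h3 : bI - rho <= bI - rho / 2 by lra.
have h4 : bI + rho / 2 <= bI + rho by lra.
apply: le_trans (mean_rect r0 (lexx _) h1 h2 (lexx _) (lexx _) h3 h4 (lexx _)
  bE gh) _.
have gc : rcont g (bR - rho) (bR + rho) (bI - rho) (bI + rho) by move=> z /gh[].
have xx : bR - rho <= bR + rho by lra.
have yy : bI - rho <= bI + rho by lra.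
have H y : bI - rho <= y -> y <= bI + rho -> rho <= `|y - bI| ->
    sint (bR - rho) (bR + rho) (fun x => normc (g (x +i* y)%C)) <=
      M * (2 * rho).
  move=> ? ? yb; rewrite [2 * rho](_ : _ = bR + rho - (bR - rho)); last ring.
  rewrite -sint_cst //; apply: le_sint; first exact: scont_normc_x gc _ _.
    exact: scont_cst.
  move=> x ? ?; apply: gM; first by split.
  by apply: le_trans yb _; apply: le_trans (normc_Im _); rewrite ImB.
have V x : bR - rho <= x -> x <= bR + rho -> rho <= `|x - bR| ->
    sint (bI - rho) (bI + rho) (fun y => normc (g (x +i* y)%C)) <=
      M * (2 * rho).
  move=> ? ? xb; rewrite [2 * rho](_ : _ = bI + rho - (bI - rho)); last ring.
  rewrite -sint_cst //; apply: le_sint; first exact: scont_normc_y gc _ _.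
    exact: scont_cst.
  move=> y ? ?; apply: gM; first by split.
  by apply: le_trans xb _; apply: le_trans (normc_Re _); rewrite ReB.
have n1 a : rho <= `|a - rho - a|.
  by rewrite addrAC subrr sub0r normrN ger0_norm // ltW.
have n2 a : rho <= `|a + rho - a|.
  by rewrite addrAC subrr add0r ger0_norm // ltW.
have := H _ (lexx _) yy (n1 _); have := H _ yy (lexx _) (n2 _).
have := V _ (lexx _) xx (n1 _); have := V _ xx (lexx _) (n2 _).
rewrite /side_integrals => a1 a2 a3 a4.
rewrite mulrAC ler_pdivrMr //.
by nra.
Qed.

End MeanInequality.

(** * Cauchy estimates *)

Section CauchyEstimates.
Variable R : realType.
Local Notation C := R[i].
Implicit Types (k f g : C -> C) (U : set C) (E : seq C).

Lemma square_normc (b z : C) rho :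
  inrect (Re b - rho) (Re b + rho) (Im b - rho) (Im b + rho) z ->
  normc (z - b) <= 2 * rho.
Proof.
move=> [? ? ? ?]; apply: le_trans (normc_le_ReIm _) _; rewrite ReB ImB.
have : `|Re z - Re b| <= rho by rewrite ler_norml; lra.
have : `|Im z - Im b| <= rho by rewrite ler_norml; lra.
lra.
Qed.

Lemma normc_near_shift (a b c : C) (s t : R) :
  normc (a - b) <= s -> normc (b - c) <= t -> normc (a - c) <= s + t.
Proof.
move=> h1 h2; have -> : a - c = (a - b) + (b - c) by ring.
by apply: le_trans (normc_triangle _ _) (lerD h1 h2).
Qed.

Lemma normc_far_shift (a b c : C) (s t : R) :
  s <= normc (a - b) -> normc (b - c) <= t -> s - t <= normc (a - c).
Proof.
move=> h1 h2; have : normc (a - b) <= normc (a - c) + normc (c - b).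
  by have := normc_triangle (a - c) (c - b); rewrite addrA subrK.
by rewrite [normc (c - b)]normc_dist; lra.
Qed.

Lemma normc_sub_le (a b : C) s t : normc a <= s -> normc b <= t ->
  normc (a - b) <= s + t.
Proof.
by move=> h1 h2; apply: le_trans (normc_triangle _ _) _; rewrite normc_opp lerD.
Qed.

Lemma divdiff_bound f p d w M r : 0 < r -> normc (f w - f p) <= M ->
  r <= normc (w - p) ->
  normc (divdiff f p d w) <= M / r.
Proof.
move=> r0 h1 h2; have wp : w != p.
  by apply/eqP => e; move: h2; rewrite e subrr normc0; lra.
rewrite divdiffE // normcM normcV; apply: ler_pM => //;
  rewrite ?invr_ge0 ?normc_ge0 //.
by rewrite lef_pV2 // posrE //; exact: lt_le_trans h2.
Qed.

Variables (f : C -> C) (p d : C) (rho M : R).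
Hypothesis (rho0 : 0 < rho).
Hypothesis fM : forall z, normc (z - p) <= 3 * rho -> normc (f z) <= M.
Hypothesis fd : forall z, normc (z - p) <= 3 * rho -> exists d, cdiff f z d.
Hypothesis fp : cdiff f p d.

Let near_square b z : normc (b - p) <= rho / 2 ->
  inrect (Re b - rho) (Re b + rho) (Im b - rho) (Im b + rho) z ->
  normc (z - p) <= 3 * rho.
Proof.
move: rho0 => r0 bp /square_normc zb; have := normc_near_shift zb bp; lra.
Qed.

Let f_holo : holo_off [set z | normc (z - p) <= 3 * rho] [::] f.
Proof.
by move=> z /fd[e h]; split => [|_]; [exact: cdiff_ccont h|exists e].
Qed.

Let g := divdiff f p d.

Let g_holo : holo_off [set z | normc (z - p) <= 3 * rho] [:: p] g.
Proof. exact: holo_off_divdiff. Qed.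

Let g_far z r : 0 < r -> normc (z - p) <= 3 * rho -> r <= normc (z - p) ->
  normc (g z) <= (M + M) / r.
Proof.
move=> r0 z3 zr; apply: divdiff_bound => //; apply: normc_sub_le;
  apply: fM => //.
by rewrite subrr normc0; move: (rho0); lra.
Qed.

Let M0 : 0 <= M.
Proof.
by apply: le_trans (normc_ge0 (f p)) _; apply: fM; rewrite subrr normc0;
  move: (rho0); lra.
Qed.

(* On the boundary of the square around [b] the point [p] is at distance at
   least [rho / 2], so the quotient defining [g] is controlled there, and
   the maximum inequality carries the bound inside, up to [p]. *)
Let g_bound b : b != p -> normc (b - p) <= rho / 2 ->
  normc (g b) <= 64 * M / rho.
Proof.
move: rho0 => r0 bp bn; have -> : 64 * M / rho = 16 * ((M + M) / (rho / 2)).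
  by field; rewrite gt_eqF.
have bE : b \notin [:: p] by rewrite inE.
apply: (max_square r0 bE).
  by apply: holo_offS g_holo => z; exact: near_square.
move=> z zs zb; apply: g_far; [lra|exact: near_square zs|].
by have := normc_far_shift zb bn; lra.
Qed.

Lemma holo_lipschitz b : normc (b - p) <= rho / 2 ->
  normc (f b - f p) <= 64 * M / rho * normc (b - p).
Proof.
move=> bn; have [->|bp] := eqVneq b p; first by rewrite !subrr normc0 mulr0.
have -> : f b - f p = g b * (b - p) by rewrite /g divdiffE // divfK // subr_eq0.
by rewrite normcM ler_wpM2r ?normc_ge0 // g_bound.
Qed.

(* The same argument for the divided difference of [g] at [b']. *)
Let g_lipschitz b b' : b != p -> b' != p -> normc (b - p) <= rho / 4 ->
  normc (b' - p) <= rho / 4 ->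
  normc (g b - g b') <= 2176 * M / rho ^+ 2 * normc (b - b').
Proof.
move: rho0 => r0 bp b'p bn b'n.
have [->|bb'] := eqVneq b b'; first by rewrite !subrr normc0 mulr0.
have b'3 : normc (b' - p) <= 3 * rho by lra.
have [_ /(_ _)[|d' gd']] := g_holo b'3; first by rewrite inE.
have kh := holo_off_divdiff gd' g_holo.
have bE : b \notin [:: b'; p] by rewrite !inE negb_or bb' bp.
have bb2 : normc (b - b') <= rho / 2.
  by rewrite normc_dist in b'n; have := normc_near_shift bn b'n; lra.
have h : normc (divdiff g b' d' b) <= 16 * (136 * M / rho ^+ 2).
  apply: (max_square r0 bE).
    by apply: holo_offS kh => z; apply: near_square; lra.
  move=> z zs zb.
  have -> : 136 * M / rho ^+ 2 = ((M + M) / (rho / 2) + 64 * M / rho) /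
    (rho / 2).
    by field; rewrite gt_eqF.
  apply: divdiff_bound; [lra| |by have := normc_far_shift zb bb2; lra].
  apply: normc_sub_le; last by apply: g_bound => //; lra.
  apply: g_far; [lra|by apply: (@near_square b) => //; lra|].
  have bn' : normc (b - p) <= rho / 2 by lra.
  by have := normc_far_shift zb bn'; lra.
move: h; rewrite divdiffE // => h.
have -> : g b - g b' = (g b - g b') / (b - b') * (b - b').
  by rewrite divfK // subr_eq0.
rewrite normcM ler_wpM2r ?normc_ge0 //; apply: le_trans h _.
by apply: le_of_eq; field; rewrite gt_eqF.
Qed.

Let g_limit e : 0 < e ->
  exists b', [/\ b' != p, normc (b' - p) <= rho / 4, normc (b' - p) <= e &
    normc (g b' - d) <= e].
Proof.
move=> e0; have [|r r0 hr] := (g_holo (z := p) _).1 e e0.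
  by rewrite /= subrr normc0; move: rho0; lra.
have gp : g p = d by rewrite /g /divdiff eqxx.
move: rho0 => rho0'.
set t := Num.min (Num.min (r / 2) e) (rho / 4).
have t0 : 0 < t by rewrite !lt_min e0 !divr_gt0.
have [t1 t2 t3] : [/\ t <= r / 2, t <= e & t <= rho / 4].
  by rewrite /t !ge_min !lexx !orbT.
have tn : normc (p + t%:C%C - p) = t by rewrite addrAC subrr add0r normc_real
  gtr0_norm.
exists (p + t%:C%C); split; rewrite ?tn //.
  by apply/eqP => h; move: tn; rewrite h subrr normc0; lra.
by rewrite -gp; apply: hr; rewrite tn; lra.
Qed.

Lemma holo_derivative_bound : normc d <= 64 * M / rho.
Proof.
move: (rho0) => r0; apply/ler_addgt0Pr => e /g_limit[b' [b'p h1 h2 h3]].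
have -> : d = g b' - (g b' - d) by ring.
by apply: normc_sub_le => //; apply: g_bound => //; lra.
Qed.

(** First order Taylor estimate, uniform in all functions bounded by [M]: the
    divided difference at [p] is itself Lipschitz, by the maximum inequality
    for a second divided difference. *)
Lemma holo_taylor b : normc (b - p) <= rho / 4 ->
  normc (f b - f p - d * (b - p)) <= 2176 * M / rho ^+ 2 * normc (b - p) ^+ 2.
Proof.
move: (rho0) => r0 bn; have [->|bp] := eqVneq b p.
  by rewrite !subrr mulr0 subr0 normc0 expr0n mulr0.
have -> : f b - f p - d * (b - p) = (g b - d) * (b - p).
  by rewrite /g divdiffE //; field; rewrite subr_eq0.
rewrite normcM expr2 mulrA ler_wpM2r ?normc_ge0 //.
set K := 2176 * M / rho ^+ 2.
have K0 : 0 <= K.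
  by apply: divr_ge0; [apply: mulr_ge0;
    [exact: ler0n|exact: M0]|exact: sqr_ge0].
apply/ler_addgt0Pr => e e0.
have e1 : 0 < e / (K + 1) by rewrite divr_gt0 // ltr_wpDl.
have [b' [b'p h1 h2 h3]] := g_limit e1.
have -> : g b - d = (g b - g b') + (g b' - d) by ring.
apply: le_trans (normc_triangle _ _) _.
have := g_lipschitz bp b'p bn h1; rewrite -/K => h4.
have h5 : normc (b - b') <= normc (b - p) + e / (K + 1).
  by apply: normc_near_shift (lexx _) _; rewrite normc_dist.
have h6 : K * normc (b - b') <=
  K * (normc (b - p) + e / (K + 1)) by rewrite ler_wpM2l.
have h7 : (K + 1) * (e / (K + 1)) = e by rewrite mulrC divfK // gt_eqF //
  ltr_wpDl.
by lra.
Qed.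

End CauchyEstimates.

(** * Integrals of powers at the ends of an interval *)

Section ImproperIntegral.
Variable R : realType.
Local Notation mu := (@lebesgue_measure R).

(** The fundamental theorem of calculus holds on the closed subintervals, and
    monotone convergence exhausts the open one; [f] may be singular at both
    ends. *)
Lemma integral_primitive_le (a b K : R) (f F : R -> R) : a < b ->
  (forall x, a < x -> x < b -> 0 <= f x) ->
  (forall x, a < x -> x < b -> {for x, continuous f}) ->
  (forall x, a < x -> x < b -> is_derive x 1 F (f x)) ->
  (forall x, a < x -> x < b -> 0 <= F x <= K) ->
  (\int[mu]_(x in `]a, b[) (f x)%:E <= K%:E)%E.
Proof.
move=> ab f0 fc Fd FK.
pose e (n : nat) : R := (b - a) / 3 / n.+1%:R.
have e0 n : 0 < e n by rewrite /e !divr_gt0 // subr_gt0.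
have e3 n : e n <= (b - a) / 3.
  rewrite /e ler_pdivrMr ?ltr0n // ler_peMr ?ler1n //.
  by rewrite divr_ge0 // subr_ge0 ltW.
pose A n : set R := [set` `[a + e n, b - e n]].
have eS m n : (m <= n)%N -> e n <= e m.
  move=> mn; rewrite /e ler_wpM2l //; first by rewrite divr_ge0 // subr_ge0 ltW.
  by rewrite lef_pV2 ?posrE ?ltr0n // ler_nat ltnS.
have cin n x : A n x -> a < x /\ x < b.
  by rewrite /A /= in_itv /= => /andP[h1 h2]; have := e0 n; split; lra.
have mA n : measurable (A n) by exact: measurable_itv.
have UA : \bigcup_n A n = [set` `]a, b[].
  apply/seteqP; split=> x.
    by move=> [n _ /cin[h1 h2]]; rewrite /= in_itv /= h1.
  rewrite /= in_itv /= => /andP[ax xb].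
  set t := Num.min (x - a) (b - x).
  have t0 : 0 < t by rewrite lt_min !subr_gt0 ax.
  have [t1 t2] : t <= x - a /\ t <= b - x by rewrite /t !ge_min !lexx orbT.
  exists (Num.bound ((b - a) / 3 / t)) => //.
  set N := Num.bound _.
  have eN : e N <= t.
    rewrite /e ler_pdivrMr ?ltr0n // [t * _]mulrC -ler_pdivrMr //.
    have q0 : 0 <= (b - a) / 3 / t by rewrite !divr_ge0 // ?subr_ge0;
      apply: ltW.
    apply: le_trans (_ : N%:R <= _); last by rewrite ler_nat.
    exact/ltW/archi_boundP.
  by rewrite /A /= in_itv /=; lra.
have mf : measurable_fun (`]a, b[%classic : set R) f.
  apply: open_continuous_measurable_fun => // x.
  by rewrite inE /= in_itv /= => /andP[]; exact: fc.
have ndA : nondecreasing_seq A.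
  move=> m n mn; apply/subsetPset => x;
    rewrite /A /= !in_itv /= => /andP[h1 h2].
  by have := eS _ _ mn; lra.
have Asub n : A n `<=` [set` `]a, b[].
  by move=> x /cin[h1 h2]; rewrite /= in_itv /= h1.
have mA1 i : measurable_fun (A i) (EFin \o f).
  by apply/measurable_EFinP; exact: measurable_funS mf.
have p0 i x : A i x -> (0 <= (EFin \o f) x)%E.
  by move=> /cin[h1 h2]; rewrite lee_fin f0.
have cv := @ge0_nondecreasing_set_cvg_integral _ (measurableTypeR R) R A
  (EFin \o f) mu ndA mA mA1 p0.
rewrite -UA -(cvg_lim _ cv) //; apply: lime_le; first by apply/cvg_ex; eexists;
  exact: cv.
near=> n.
have aben : a + e n < b - e n.
  by have := e3 n; have : 0 < b - a; [rewrite subr_gt0|lra].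
have Fc x : a < x -> x < b -> {for x, continuous F}.
  move=> ax xb; have Fx := Fd x ax xb.
  by apply: differentiable_continuous; apply/derivable1_diffP; exact: ex_derive.
have en := e0 n.
rewrite (@continuous_FTC2 _ f F) //.
- rewrite -EFinB lee_fin.
  have /andP[_ h1] := FK (b - e n) ltac:(lra) ltac:(lra).
  have /andP[h2 _] := FK (a + e n) ltac:(lra) ltac:(lra).
  by lra.
- apply: continuous_in_subspaceT => x; rewrite inE /= in_itv /= => /andP[h1 h2].
  by apply: fc; lra.
- split.
  + move=> x; rewrite in_itv /= => /andP[h1 h2].
    have Fx := Fd x ltac:(lra) ltac:(lra); exact: ex_derive.
  + by apply: cvg_at_right_filter; apply: Fc; lra.
  + by apply: cvg_at_left_filter; apply: Fc; lra.
- move=> x; rewrite in_itv /= => /andP[h1 h2].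
  have Fx := Fd x ltac:(lra) ltac:(lra).
  by rewrite derive1E derive_val.
Unshelve. all: by end_near. Qed.

(** The sign [sg] decides at which end of the interval the power is singular. *)
Lemma integral_powR_le (s sg beta : R) : 0 < s -> -1 < beta -> sg ^+ 2 = 1 ->
  (\int[mu]_(x in `](- s)%R, s[) ((s + sg * x) `^ beta)%R%:E <=
    ((2 * s) `^ (beta + 1) / (beta + 1))%R%:E)%E.
Proof.
move=> s0 b1 sg2; have b0 : 0 < beta + 1 by lra.
have sgE : sg = 1 \/ sg = - 1.
  by move/eqP: sg2; rewrite sqrf_eq1 => /orP[/eqP|/eqP]; [left|right].
set K := (2 * s) `^ (beta + 1) / (beta + 1).
(* For [sg = -1] the primitive is nonpositive; the constant [c] makes it
   take its values between [0] and [K] in both cases. *)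
pose c : R := (1 - sg) / 2 * K.
apply: (@integral_primitive_le _ _ K _
  (fun x => sg * ((s + sg * x) `^ (beta + 1) / (beta + 1)) + c)); first lra.
- by move=> x _ _; exact: powR_ge0.
- move=> x h1 h2; have p0 : 0 < s + sg * x by case: sgE => ->; lra.
  have d := @is_derive1_powR R beta _ p0.
  have c1 : {for s + sg * x, continuous (fun y : R => y `^ beta)}.
    by apply: differentiable_continuous; apply/derivable1_diffP;
      exact: ex_derive.
  apply: (@continuous_comp _ _ _ (fun x => s + sg * x)
    (fun y : R => y `^ beta)) => //.
  by apply: cvgD; [exact: cvg_cst|apply: cvgM; [exact: cvg_cst|exact: cvg_id]].
- move=> x h1 h2; have p0 : 0 < s + sg * x by case: sgE => ->; lra.
  have d := @is_derive1_powR R (beta + 1) _ p0.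
  have d1 : is_derive x 1 (fun x => s + sg * x) sg.
    have h : is_derive x 1 (cst s + sg \*: (id : R -> R)) (0 + sg *: (1 : R)).
      by apply: is_deriveD; apply: is_deriveZ.
    by move: h; rewrite add0r [_ *: _]mulr1.
  have d2 := @is_derive1_comp R (fun y => y `^ (beta + 1))
    (fun x => s + sg * x) x _ _ d d1.
  have -> : (s + sg * x) `^ beta =
     (sg / (beta + 1)) * ((beta + 1) * (s + sg * x) `^ (beta + 1 - 1) * sg).
    rewrite addrK; set P := _ `^ _.
    have -> : sg / (beta + 1) * ((beta + 1) * P * sg) = sg ^+ 2 * P.
      by field; rewrite gt_eqF.
    by rewrite sg2 mul1r.
  have -> : (fun x => sg * ((s + sg * x) `^ (beta + 1) / (beta + 1)) + c) =
    (fun x => (sg / (beta + 1)) * (s + sg * x) `^ (beta + 1)) \+ cst c.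
    by apply/funext => y /=; congr (_ + _); ring.
  rewrite -[X in is_derive _ _ _ X]addr0; apply: is_deriveD.
- move=> x h1 h2; have p0 : 0 < s + sg * x by case: sgE => ->; lra.
  have p1 : 0 <= (s + sg * x) `^ (beta + 1) / (beta + 1).
    by rewrite divr_ge0 ?powR_ge0 // ltW.
  have p2 : (s + sg * x) `^ (beta + 1) / (beta + 1) <= K.
    rewrite /K ler_pM2r ?invr_gt0 //; apply: ge0_ler_powR.
    + exact: ltW.
    + by rewrite nnegrE ltW.
    + by rewrite nnegrE; lra.
    + by case: sgE => ->; lra.
  move: p1 p2; rewrite /c; set T := _ / (beta + 1); case: sgE => ->; lra.
Qed.

End ImproperIntegral.

(** * Measurability in the plane *)

Section PlaneMeasurability.
Variable R : realType.
Local Notation C := R[i].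

(** Such a set is the countable union of the boxes with rational corners that
    it contains. *)
Lemma box_open_measurable (A : set (R * R)) :
  (forall p, A p -> exists2 r : R, 0 < r &
     forall q, `|q.1 - p.1| < r -> `|q.2 - p.2| < r -> A q) ->
  measurable A.
Proof.
move=> hA.
pose box (a b c d : rat) : set (R * R) :=
  ([set` `]ratr a, ratr b[] `*` [set` `]ratr c, ratr d[]).
pose F a b c d : set (R * R) :=
  if `[< box a b c d `<=` A >] then box a b c d else set0.
have -> : A = \bigcup_(a in setT) \bigcup_(b in setT) \bigcup_(c in setT)
    \bigcup_(d in setT) F a b c d.
  apply/seteqP; split=> p; last first.
    move=> [a _ [b _ [c _ [d _]]]]; rewrite /F; case: asboolP => // h; exact: h.
  move=> Ap; have [r r0 hr] := hA p Ap.
  have [a] := @rat_in_itvoo R (p.1 - r) p.1 ltac:(lra).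
  have [b] := @rat_in_itvoo R p.1 (p.1 + r) ltac:(lra).
  have [c] := @rat_in_itvoo R (p.2 - r) p.2 ltac:(lra).
  have [d] := @rat_in_itvoo R p.2 (p.2 + r) ltac:(lra).
  rewrite !in_itv /= => /andP[d1 d2] /andP[c1 c2] /andP[b1 b2] /andP[a1 a2].
  exists a => //; exists b => //; exists c => //; exists d => //.
  rewrite /F; case: asboolP => [_|[]].
    by rewrite /box /= !in_itv /= a2 b1 c2 d1.
  move=> q; rewrite /box /= !in_itv /= => -[/andP[q1 q2] /andP[q3 q4]].
  by apply: hr; rewrite ltr_norml; lra.
do 4 (apply: bigcupT_measurable_rat => ?).
by rewrite /F; case: asboolP => // _; apply: measurableX; exact: measurable_itv.
Qed.

Definition to_plane (A : set C) : set (R * R) := [set p | A (p.1 +i* p.2)%C].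

Lemma normc_dist_le (p q : R * R) :
  normc ((q.1 +i* q.2) - (p.1 +i* p.2))%C <= `|q.1 - p.1| + `|q.2 - p.2|.
Proof. exact: normc_le_ReIm. Qed.

Lemma to_plane_measurable (A : set C) :
  (forall z, A z -> exists2 r : R, 0 < r & forall w, normc (w - z) < r -> A w)
    ->
  measurable (to_plane A).
Proof.
move=> hA; apply: box_open_measurable => p /hA[r r0 hr].
exists (r / 2); first by rewrite divr_gt0.
move=> q h1 h2; apply: hr; apply: le_lt_trans (normc_dist_le p q) _; lra.
Qed.

Lemma disc_nbhs (z : C) : disc z ->
  exists2 r : R, 0 < r & forall w, normc (w - z) < r -> disc w.
Proof.
move=> zD; exists (1 - normc z); first by rewrite subr_gt0; exact: zD.
move=> w wz; rewrite /disc /=; have -> : w = (w - z) + z by ring.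
by apply: le_lt_trans (normc_triangle _ _) _; move: zD; rewrite /disc /=; lra.
Qed.

Lemma measurable_disc : measurable (to_plane disc).
Proof. by apply: to_plane_measurable => z; exact: disc_nbhs. Qed.

Lemma measurable_plane (G : C -> R) :
  (forall z, disc z -> forall e : R, 0 < e ->
     exists2 r : R, 0 < r & forall w, normc (w - z) < r -> `|G w - G z| <= e) ->
  measurable_fun (to_plane disc) (fun p => G (p.1 +i* p.2)%C).
Proof.
move=> hG mD; apply: (measurability _ (RGenOInfty.measurableE R)) => //.
move=> _ [_ [a ->] <-].
have -> : to_plane disc `&` (fun p => G (p.1 +i* p.2)%C) @^-1` [set` `]a,
  +oo[] =
    to_plane [set z | disc z /\ a < G z].
  by apply/seteqP; split=> p /= []; rewrite in_itv /= andbT.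
apply: to_plane_measurable => z [zD az].
have e0 : 0 < (G z - a) / 2 by rewrite divr_gt0 // subr_gt0.
have [r r0 hr] := hG z zD _ e0; have [s s0 hs] := disc_nbhs zD.
exists (Num.min r s); first by rewrite lt_min r0.
move=> w; rewrite lt_min => /andP[/hr h1 /hs h2]; split => //.
move: h1; rewrite ler_norml; lra.
Qed.

End PlaneMeasurability.

(** * Integrability of the weights on the disc *)

Section WeightIntegrals.
Variable R : realType.
Local Notation C := R[i].
Local Notation mu := (@lebesgue_measure R).

Lemma normc_sqr (x y : R) : normc (x +i* y)%C ^+ 2 = x ^+ 2 + y ^+ 2.
Proof. by rewrite /= sqr_sqrtr // addr_ge0 // sqr_ge0. Qed.

Lemma weightE (b x y : R) : weight b (x +i* y)%C = (1 - (x ^+ 2 + y ^+ 2)) `^ b.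
Proof. by rewrite /weight normc_sqr. Qed.

Lemma disc_sqr (x y : R) : disc (x +i* y)%C <-> x ^+ 2 + y ^+ 2 < 1.
Proof.
rewrite -normc_sqr /disc /=; set n := Num.sqrt _.
have n0 : 0 <= n by exact: sqrtr_ge0.
by rewrite expr_lt1.
Qed.

Lemma le_powR_npos (a c b : R) : 0 < a -> a <= c -> b <= 0 -> c `^ b <= a `^ b.
Proof.
move=> a0 ac b0; have c0 : 0 < c by apply: lt_le_trans ac.
have E z : z `^ b = (z `^ (- b))^-1 by rewrite -powRN opprK.
rewrite !E lef_pV2 ?posrE ?powR_gt0 //.
by apply: ge0_ler_powR; rewrite ?nnegrE ?(ltW a0) ?(ltW c0) // oppr_ge0.
Qed.

Lemma measurable_weight b : measurable_fun (to_plane disc)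
  (fun p : R * R => weight b (p.1 +i* p.2)%C).
Proof.
have mn : measurable_fun (to_plane disc)
  (fun p : R * R => normc (p.1 +i* p.2)%C).
  apply: measurable_plane => z _ e e0; exists e => // w /ltW; apply: le_trans.
  exact: normc_sub_ge.
apply: (measurableT_comp (measurable_powR b)).
by apply: measurable_funB => //; exact: measurable_funX.
Qed.

Lemma weight_ge0 b (z : C) : 0 <= weight b z.
Proof. exact: powR_ge0. Qed.

(* With [s ^ 2 = 1 - x ^ 2] the weight on a vertical section is
   [(s + y) ^ b * (s - y) ^ b], where for [b <= 0] one of the factors is at most
   [s ^ b]. The integral over the section is then at most a multiple of
   [s ^ (2 b + 1)], hence of [1 / s], which is integrable in [x]. *)
Let inner_le (b x : R) : -1 < b -> b <= 0 -> `|x| < 1 ->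
  (\int[mu]_y (((fun p : R * R => (weight b (p.1 +i* p.2)%C)%:E) \_
    (to_plane disc)) (x, y))
    <= ((4 / (b + 1)) * ((1 + 1 * x) `^ (- 2^-1) +
      (1 + -1 * x) `^ (- 2^-1)))%R%:E)%E.
Proof.
move=> b1 b0 x1; have b1' : 0 < b + 1 by lra.
have x2 : x ^+ 2 < 1 by rewrite -real_normK ?num_real // expr_lt1.
set s := Num.sqrt (1 - x ^+ 2).
have s2 : s ^+ 2 = 1 - x ^+ 2 by rewrite sqr_sqrtr // subr_ge0 ltW.
have s0 : 0 < s by rewrite sqrtr_gt0 subr_gt0.
have s1 : s <= 1.
  by rewrite -(ler_pXn2r (n := 2)) // ?nnegrE ?(ltW s0) // s2 expr1n gerBl
    sqr_ge0.
have -> : (fun y => ((fun p : R * R => (weight b (p.1 +i* p.2)%C)%:E) \_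
  (to_plane disc)) (x, y))
   = (fun y => ((s ^+ 2 - y ^+ 2) `^ b)%R%:E) \_ [set` `](- s)%R, s[].
  apply/funext => y; rewrite /patch.
  have E : ((x, y) \in to_plane disc) = (y \in [set` `](- s)%R, s[]).
    apply/idP/idP; rewrite !inE /to_plane /= in_itv /= -ltr_norml.
      move=> /disc_sqr h; rewrite -(ltr_pXn2r (n := 2)) ?nnegrE ?(ltW s0) //.
      by rewrite real_normK ?num_real // s2; lra.
    move=> h; apply/disc_sqr.
    have : `|y| ^+ 2 < s ^+ 2 by rewrite ltr_pXn2r ?nnegrE ?(ltW s0).
    by rewrite real_normK ?num_real // s2; lra.
  rewrite E; case: ifP => // _; rewrite weightE s2; congr (_ `^ _)%:E => /=;
    ring.
rewrite -integral_mkcond.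
set f1 := fun y => (s + 1 * y) `^ b; set f2 := fun y => (s + -1 * y) `^ b.
have mf sg : measurable_fun ([set` `](- s)%R, s[] : set R)
  (fun y => (s + sg * y) `^ b).
  apply: (measurableT_comp (measurable_powR b)).
  by apply: measurable_funD => //; exact: measurable_funM.
have m1 : measurable_fun ([set` `](- s)%R, s[] : set R) (EFin \o f1).
  by apply/measurable_EFinP; exact: mf.
have m2 : measurable_fun ([set` `](- s)%R, s[] : set R) (EFin \o f2).
  by apply/measurable_EFinP; exact: mf.
have f1_ge0 y : (0 <= (EFin \o f1) y)%E by rewrite lee_fin powR_ge0.
have f2_ge0 y : (0 <= (EFin \o f2) y)%E by rewrite lee_fin powR_ge0.
have I1 : (\int[mu]_(y in [set` `](- s)%R, s[]) (EFin \o f1) y <=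
     ((2 * s) `^ (b + 1) / (b + 1))%R%:E)%E.
  by apply: (@integral_powR_le R s 1 b) => //; rewrite expr1n.
have I2 : (\int[mu]_(y in [set` `](- s)%R, s[]) (EFin \o f2) y <=
     ((2 * s) `^ (b + 1) / (b + 1))%R%:E)%E.
  by apply: (@integral_powR_le R s (-1) b) => //; rewrite sqrrN expr1n.
apply: (@le_trans _ _ (\int[mu]_(y in [set` `](- s)%R, s[])
    ((s `^ b)%:E * ((EFin \o f1) y + (EFin \o f2) y)))%E).
  apply: ge0_le_integral => //.
  - by move=> y _; rewrite lee_fin powR_ge0.
  - apply/measurable_EFinP; apply: (measurableT_comp (measurable_powR b)).
    by apply: measurable_funB => //; exact: measurable_funX.
  - by apply: measurable_funeM; exact: emeasurable_funD.
  - move=> y /=; rewrite in_itv /= => /andP[y1 y2].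
    rewrite -EFinD -EFinM lee_fin.
    have q1 : 0 < s + 1 * y by lra. have q2 : 0 < s + -1 * y by lra.
    have [y0|/ltW y0] := leP 0 y.
      apply: (@le_trans _ _ (s `^ b * (s + -1 * y) `^ b)).
        rewrite -powRM ?(ltW s0) ?(ltW q2) //; apply: le_powR_npos => //.
          by rewrite mulr_gt0.
        by nra.
      by rewrite ler_wpM2l ?powR_ge0 // /f2 lerDr powR_ge0.
    apply: (@le_trans _ _ (s `^ b * (s + 1 * y) `^ b)).
      rewrite -powRM ?(ltW s0) ?(ltW q1) //; apply: le_powR_npos => //.
        by rewrite mulr_gt0.
      by nra.
    by rewrite ler_wpM2l ?powR_ge0 // /f1 lerDl powR_ge0.
rewrite ge0_integralZl //; last 3 first.
- exact: emeasurable_funD.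
- by move=> y _; rewrite adde_ge0.
- by rewrite lee_fin powR_ge0.
rewrite ge0_integralD //.
apply: (@le_trans _ _ ((s `^ b)%:E * (((2 * s) `^ (b + 1) / (b + 1))%R%:E +
   ((2 * s) `^ (b + 1) / (b + 1))%R%:E))%E).
  by apply: lee_wpmul2l; [rewrite lee_fin powR_ge0|exact: (leeD I1 I2)].
rewrite -EFinD -EFinM lee_fin.
have P2 : (2 : R) `^ (b + 1) <= 2.
  rewrite -[leRHS]powRr1 //; apply: ler_powR; clear -b0 b1; lra.
have Ps : s `^ b * s `^ (b + 1) <= s^-1.
  rewrite -powRD; last by rewrite (gt_eqF s0) implybT.
  rewrite -powR_inv1 ?(ltW s0) //; apply: ger_powR; first by rewrite s0.
  lra.
have Ps0 : 0 <= s `^ b * s `^ (b + 1) by rewrite mulr_ge0 // powR_ge0.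
have A : s `^ b * ((2 * s) `^ (b + 1) / (b + 1) + (2 * s) `^ (b + 1) / (b + 1))
  <=
    4 / (b + 1) * s^-1.
  rewrite powRM ?(ltW s0) //.
  have -> : s `^ b * (2 `^ (b + 1) * s `^ (b + 1) / (b + 1) +
     2 `^ (b + 1) * s `^ (b + 1) / (b + 1)) =
     (2 * 2 `^ (b + 1) * (s `^ b * s `^ (b + 1))) / (b + 1).
    by field; rewrite gt_eqF.
  rewrite [leRHS]mulrAC ler_pM2r ?invr_gt0 //; apply: ler_pM => //.
  by have -> : (4 : R) = 2 * 2 by [ring]; rewrite ler_pM2l.
apply: le_trans A _; apply: ler_wpM2l; first by rewrite divr_ge0 // ltW.
have x1' := x1; move: x1'; rewrite ltr_norml => /andP[x3 x4].
have sI : s^-1 = (1 - x ^+ 2) `^ (- 2^-1).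
  by rewrite powRN powR12_sqrt // subr_ge0 ltW.
have h0 : - (2^-1 : R) <= 0 by rewrite oppr_le0 invr_ge0.
rewrite sI; have [x0|/ltW x0] := leP 0 x.
  apply: (@le_trans _ _ ((1 + -1 * x) `^ (- 2^-1))).
    by apply: le_powR_npos => //; clear -x0 x3 x4; [lra|nra].
  by rewrite lerDr powR_ge0.
apply: (@le_trans _ _ ((1 + 1 * x) `^ (- 2^-1))).
  by apply: le_powR_npos => //; clear -x0 x3 x4; [lra|nra].
by rewrite lerDl powR_ge0.
Qed.

(** Only exponents in the interval from [-1] to [0] are at stake, since the
    weight decreases in the exponent. Fubini's theorem reduces the claim to
    the one-dimensional power integrals. *)
Lemma weight_integral_lty (alpha : R) : -1 < alpha ->
  (disc_integral (fun z : C => (weight alpha z)%:E) < +oo)%E.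
Proof.
move=> a1; set b := Num.min alpha 0.
have b1 : -1 < b by rewrite lt_min a1 /=; lra.
have b0 : b <= 0 by rewrite ge_min lexx orbT.
have ba : b <= alpha by rewrite ge_min lexx.
apply: (@le_lt_trans _ _ (disc_integral (fun z : C => (weight b z)%:E))).
  apply: ge0_le_integral => //.
  - exact: measurable_disc.
  - by move=> p _; rewrite lee_fin weight_ge0.
  - by apply/measurable_EFinP; exact: measurable_weight.
  - by apply/measurable_EFinP; exact: measurable_weight.
  - move=> [x y] /= /disc_sqr h; rewrite lee_fin !weightE.
    apply: ger_powR => //; have := sqr_ge0 x; have := sqr_ge0 y; lra.
rewrite /disc_integral integral_mkcond; set f := _ \_ _.
have mf : measurable_fun setT f.
  apply/(measurable_restrictT _ _).1; first exact: measurable_disc.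
  by apply/measurable_EFinP; exact: measurable_weight.
have f0 p : (0 <= f p)%E.
  by apply: erestrict_ge0 => q _; rewrite lee_fin weight_ge0.
rewrite fubini_tonelli1 //.
set K := 4 / (b + 1).
set g1 := fun x : R => (1 + 1 * x) `^ (- 2^-1).
set g2 := fun x : R => (1 + -1 * x) `^ (- 2^-1).
have K0 : 0 <= K by rewrite divr_ge0 //; lra.
have mg sg : measurable_fun ([set` `](- 1)%R, 1[] : set R)
    (fun y => (1 + sg * y) `^ (- 2^-1)).
  apply: (measurableT_comp (measurable_powR _)).
  by apply: measurable_funD => //; exact: measurable_funM.
have m1 : measurable_fun ([set` `](- 1)%R, 1[] : set R) (EFin \o g1).
  by apply/measurable_EFinP; exact: mg.
have m2 : measurable_fun ([set` `](- 1)%R, 1[] : set R) (EFin \o g2).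
  by apply/measurable_EFinP; exact: mg.
have g1_ge0 y : (0 <= (EFin \o g1) y)%E by rewrite lee_fin powR_ge0.
have g2_ge0 y : (0 <= (EFin \o g2) y)%E by rewrite lee_fin powR_ge0.
have half : -1 < - (2^-1 : R) by rewrite ltrN2 invf_lt1 // ltr1n.
have I1 := @integral_powR_le R 1 1 (- 2^-1) ltr01 half (expr1n _ _).
have N1 : (-1 : R) ^+ 2 = 1 by rewrite sqrrN expr1n.
have I2 := @integral_powR_le R 1 (-1) (- 2^-1) ltr01 half N1.
apply: (@le_lt_trans _ _ (\int[mu]_(x in [set` `](- 1)%R, 1%R[])
    (K%:E * ((EFin \o g1) x + (EFin \o g2) x)))%E).
  rewrite [leRHS]integral_mkcond; apply: ge0_le_integral => //.
  - by move=> x _; apply: integral_ge0.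
  - exact: measurable_fun_fubini_tonelli_F.
  - apply/(measurable_restrictT _ _).1 => //.
    by apply: measurable_funeM; exact: emeasurable_funD.
  - move=> x _; rewrite /fubini_F [leRHS]/patch; case: ifP => [|/negP xn].
      rewrite inE /= in_itv /= -ltr_norml => x1.
      by rewrite -EFinD -EFinM; exact: inner_le.
    rewrite integral0_eq // => y _; rewrite /f /patch; case: ifP => // h;
      exfalso.
    apply: xn; move: h; rewrite !inE /to_plane /= in_itv /= -ltr_norml =>
      /disc_sqr h.
    rewrite -(ltr_pXn2r (n := 2)) ?nnegrE // real_normK ?num_real // expr1n.
    by have := sqr_ge0 y; lra.
rewrite ge0_integralZl //; last 2 first.
- exact: emeasurable_funD.
- by move=> y _; rewrite adde_ge0.
rewrite ge0_integralD //.
apply: (le_lt_trans (lee_wpmul2l _ (leeD I1 I2))); first by rewrite lee_fin.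
by rewrite -EFinD -EFinM ltry.
Qed.

End WeightIntegrals.

(** * The mean value inequality over squares *)

Section AreaMean.
Variable R : realType.
Local Notation C := R[i].
Local Notation mu := (@lebesgue_measure R).

Lemma integral_pigeonhole (p q T e : R) (A : R -> \bar R) : p < q -> 0 < e ->
  0 <= T ->
  measurable_fun setT A -> (forall t, 0 <= A t)%E ->
  (\int[mu]_t A t <= T%:E)%E ->
  exists t, [/\ p <= t, t <= q & (A t <= ((T + e) / (q - p))%:E)%E].
Proof.
move=> pq e0 T0 mA A0 IA; apply: contrapT => no.
have qp : 0 < q - p by rewrite subr_gt0.
have lb t : p <= t -> t <= q -> (((T + e) / (q - p))%:E <= A t)%E.
  move=> pt tq; have [//|/ltW h] := leP (((T + e) / (q - p))%:E) (A t).
  by exfalso; apply: no; exists t.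
have : ((T + e)%:E <= \int[mu]_t A t)%E.
  apply: (@le_trans _ _ (\int[mu]_(t in [set` `[p, q]]) A t)%E); last first.
    apply: ge0_subset_integral => //; exact: measurable_itv.
  have -> : (T + e)%:E = (\int[mu]_(t in [set` `[p, q]])
    (((T + e) / (q - p))%:E))%E.
    rewrite integral_cst; last exact: measurable_itv.
    transitivity (((T + e) / (q - p))%:E * (q - p)%:E)%E.
      by rewrite -EFinM divfK // gt_eqF.
    congr (_ * _)%E; have := @lebesgue_measure_itv R `[p, q] => /= ->.
    by rewrite lte_fin pq EFinB.
  apply: ge0_le_integral => //.
  - by move=> t _; rewrite lee_fin divr_ge0 // ?(ltW qp) // addr_ge0 // ltW.
  - exact: measurable_funS mA.
  - by move=> t /=; rewrite in_itv /= => /andP[]; exact: lb.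
move=> /le_trans /(_ IA); rewrite lee_fin; lra.
Qed.

Definition square (b : C) (rho : R) : set C :=
  inrect (Re b - rho) (Re b + rho) (Im b - rho) (Im b + rho).

Lemma to_plane_square (b : C) rho : to_plane (square b rho) =
  [set` `[Re b - rho, Re b + rho]] `*` [set` `[Im b - rho, Im b + rho]].
Proof.
apply/seteqP; split => -[x y]; rewrite /to_plane /square /= !in_itv /=.
  by case=> /= -> -> -> ->.
by move=> [/andP[? ?] /andP[? ?]]; split.
Qed.

Lemma measurable_normc (f : C -> C) : holo_off disc [::] f ->
  measurable_fun (to_plane disc) (fun p : R * R => normc (f (p.1 +i* p.2)%C)).
Proof.
move=> fh; apply: (@measurable_plane R (fun z => normc (f z))) => z zD e e0.
have [r r00 hr] := (fh z zD).1 e e0.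
by exists r => // w /hr; apply: le_trans; exact: normc_sub_ge.
Qed.

(** By the pigeonhole principle and Fubini's theorem, each of the four sides
    has a position at which the integral of [|f|] along it is at most
    [2 / rho] times the integral over the square, up to an arbitrarily small
    error; [mean_rect] is applied to the rectangle with these sides. *)
Lemma area_mean (f : C -> C) (b : C) (rho : R) : 0 < rho ->
  square b rho `<=` disc ->
  holo_off disc [::] f ->
  ((normc (f b))%:E <= (16 / rho ^+ 2)%:E *
     \int[@plane_measure R]_(p in to_plane (square b rho))
       (normc (f (p.1 +i* p.2)%C))%:E)%E.
Proof.
case: b => b1 b2 r0 QD fh.
have lt1 c : c - rho < c - rho / 2 by lra.
have lt2 c : c + rho / 2 < c + rho by lra.
have low c t : t <= c - rho / 2 -> t <= c + rho by lra.
have high c t : c + rho / 2 <= t -> c - rho <= t by lra.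
set Q := square _ _.
pose N (p : R * R) := normc (f (p.1 +i* p.2)%C).
have QE : to_plane Q = [set` `[b1 - rho, b1 + rho]] `*`
  [set` `[b2 - rho, b2 + rho]].
  exact: to_plane_square.
have mQ : measurable (to_plane Q).
  by rewrite QE; apply: measurableX; exact: measurable_itv.
have QD' : to_plane Q `<=` to_plane disc by move=> p; exact: QD.
have mN : measurable_fun (to_plane disc) N by exact: measurable_normc.
have mNQ : measurable_fun (to_plane Q) N by apply: measurable_funS mN => //;
  exact: measurable_disc.
set T := (\int[_]_(p in _) _)%E.
have T0 : (0 <= T)%E by apply: integral_ge0 => p _; rewrite lee_fin normc_ge0.
have [Ty|Tfin] := eqVneq T +oo%E.
  by rewrite Ty gt0_muley ?leey // lte_fin divr_gt0 // exprn_gt0.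
have TE : T = (fine T)%:E by rewrite fineK // ge0_fin_numE // ltey.
have fT0 : 0 <= fine T by exact: fine_ge0.
pose g := (fun p : R * R => (N p)%:E) \_ (to_plane Q).
have mg : measurable_fun setT g.
  apply/(measurable_restrictT _ _).1 => //; exact/measurable_EFinP.
have g0 p : (0 <= g p)%E.
  by apply: erestrict_ge0 => q _; rewrite lee_fin normc_ge0.
pose G1 x := (\int[mu]_y g (x, y))%E.
pose G2 y := (\int[mu]_x g (x, y))%E.
have TG1 : (\int[mu]_x G1 x = T)%E.
  by rewrite /T [RHS]integral_mkcond fubini_tonelli1.
have TG2 : (\int[mu]_y G2 y = T)%E.
  by rewrite /T [RHS]integral_mkcond fubini_tonelli2.
have G1_0 x : (0 <= G1 x)%E by exact: integral_ge0.
have G2_0 x : (0 <= G2 x)%E by exact: integral_ge0.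
have mG1 : measurable_fun setT G1 by exact: measurable_fun_fubini_tonelli_F.
have mG2 : measurable_fun setT G2 by exact: measurable_fun_fubini_tonelli_G.
have fc : rcont f (b1 - rho) (b1 + rho) (b2 - rho) (b2 + rho).
  by move=> z /QD /fh[].
have side1 x y1 y2 : b1 - rho <= x -> x <= b1 + rho -> b2 - rho <= y1 ->
  y2 <= b2 + rho ->
    ((sint y1 y2 (fun y => normc (f (x +i* y)%C)))%:E <= G1 x)%E.
  move=> h1 h2 h3 h4.
  have c := scontS h3 h4 (scont_normc_y fc h1 h2).
  have i := scont_integrable c.
  rewrite /sint /Rintegral fineK; last exact: (integrable_fin_num _ i).
  rewrite integral_mkcond; apply: ge0_le_integral => //.
  - by move=> y _; apply: erestrict_ge0 => t _; rewrite lee_fin normc_ge0.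
  - apply/(measurable_restrictT _ _).1; first exact: measurable_itv.
    exact: (measurable_int mu i).
  - exact: (measurableT_comp mg).
  - move=> y _; rewrite /g /patch; case: ifP => [|_]; last first.
      by case: ifP => // _; rewrite lee_fin normc_ge0.
    rewrite inE /= in_itv /= => /andP[h5 h6]; rewrite mem_set //.
    by rewrite QE /= !in_itv /= h1 h2 (le_trans h3 h5) (le_trans h6 h4).
have side2 y x1 x2 : b2 - rho <= y -> y <= b2 + rho -> b1 - rho <= x1 ->
  x2 <= b1 + rho ->
    ((sint x1 x2 (fun x => normc (f (x +i* y)%C)))%:E <= G2 y)%E.
  move=> h1 h2 h3 h4.
  have c := scontS h3 h4 (scont_normc_x fc h1 h2).
  have i := scont_integrable c.
  rewrite /sint /Rintegral fineK; last exact: (integrable_fin_num _ i).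
  rewrite integral_mkcond; apply: ge0_le_integral => //.
  - by move=> x _; apply: erestrict_ge0 => t _; rewrite lee_fin normc_ge0.
  - apply/(measurable_restrictT _ _).1; first exact: measurable_itv.
    exact: (measurable_int mu i).
  - exact: (measurableT_comp mg).
  - move=> x _; rewrite /g /patch; case: ifP => [|_]; last first.
      by case: ifP => // _; rewrite lee_fin normc_ge0.
    rewrite inE /= in_itv /= => /andP[h5 h6]; rewrite mem_set //.
    by rewrite QE /= !in_itv /= h1 h2 (le_trans h3 h5) (le_trans h6 h4).
rewrite TE -EFinM lee_fin; apply/ler_addgt0Pr => e e0.
have e1 : 0 < e * rho ^+ 2 / 16 by rewrite divr_gt0 // mulr_gt0 // exprn_gt0.
set e' := e * rho ^+ 2 / 16 in e1.
have IG1 : (\int[mu]_x G1 x <= (fine T)%:E)%E by rewrite TG1 -TE.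
have IG2 : (\int[mu]_y G2 y <= (fine T)%:E)%E by rewrite TG2 -TE.
have [x1 [x1l x1r hx1]] := @integral_pigeonhole (b1 - rho) (b1 - rho / 2) _ _ _
  (lt1 _) e1 fT0 mG1 G1_0 IG1.
have [x2 [x2l x2r hx2]] := @integral_pigeonhole (b1 + rho / 2) (b1 + rho) _ _ _
  (lt2 _) e1 fT0 mG1 G1_0 IG1.
have [y1 [y1l y1r hy1]] := @integral_pigeonhole (b2 - rho) (b2 - rho / 2) _ _ _
  (lt1 _) e1 fT0 mG2 G2_0 IG2.
have [y2 [y2l y2r hy2]] := @integral_pigeonhole (b2 + rho / 2) (b2 + rho) _ _ _
  (lt2 _) e1 fT0 mG2 G2_0 IG2.
have fh' : holo_off (inrect x1 x2 y1 y2) [::] f.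
  apply: holo_offS fh => z zr; apply: QD; exact: (inrectS x1l x2r y1l y2r zr).
have bE : (b1 +i* b2)%C \notin [::] by [].
have := mean_rect r0 x1l x1r x2l x2r y1l y1r y2l y2r bE fh'.
rewrite /side_integrals => hm.
have s1 := le_trans (side1 x1 y1 y2 x1l (low _ _ x1r) y1l y2r) hx1.
have s2 := le_trans (side1 x2 y1 y2 (high _ _ x2l) x2r y1l y2r) hx2.
have s3 := le_trans (side2 y1 x1 x2 y1l (low _ _ y1r) x1l x2r) hy1.
have s4 := le_trans (side2 y2 x1 x2 (high _ _ y2l) y2r x1l x2r) hy2.
move: s1 s2 s3 s4; rewrite !lee_fin.
have -> : b1 - rho / 2 - (b1 - rho) = rho / 2 by field.
have -> : b1 + rho - (b1 + rho / 2) = rho / 2 by field.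
have -> : b2 - rho / 2 - (b2 - rho) = rho / 2 by field.
have -> : b2 + rho - (b2 + rho / 2) = rho / 2 by field.
move=> s1 s2 s3 s4; apply: le_trans hm _.
have -> : 16 / rho ^+ 2 * fine T +
  e = 2 / rho * (4 * ((fine T + e') / (rho / 2))).
  by rewrite /e'; field; rewrite gt_eqF.
rewrite ler_wpM2l //; first by rewrite divr_ge0 // ltW.
move: s1 s2 s3 s4; move: (_ / (rho / 2)) (sint _ _ _) (sint _ _ _) (sint _ _ _)
  (sint _ _ _).
by clear=> *; lra.
Qed.

End AreaMean.

(** * Functions of critical growth have finite norm *)

Section NormComparison.
Variables (R : realType) (alpha : R) (psi : R -> R).
Hypotheses (alpha_gt : -1 < alpha) (psi_orlicz : orlicz psi).
Hypothesis psi_Delta2 : Delta2_upper psi.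
Local Notation C := R[i].
Local Notation X := (psi_inv psi).
Local Notation mu := (@lebesgue_measure R).
Implicit Types f F : C -> C.

Definition critical_growth (z : C) : R := X (1 / (1 - normc z)).

Local Notation growth := critical_growth.

Lemma disc_gap (z : C) : disc z -> 0 < 1 - normc z <= 1.
Proof. by move=> zD; rewrite subr_gt0 gerBl normc_ge0 andbT; exact: zD. Qed.

Lemma disc_inv_gap (z : C) : disc z -> 1 <= 1 / (1 - normc z).
Proof. by move=> /disc_gap /andP[h1 h2]; rewrite ler_pdivlMr // mul1r. Qed.

Lemma growth_ge1 (z : C) : disc z -> X 1 <= growth z.
Proof. by move=> /disc_inv_gap h; apply: le_psi_inv. Qed.

Lemma growth_gt0 (z : C) : disc z -> 0 < growth z.
Proof. by move=> /growth_ge1; apply: lt_le_trans; apply: psi_inv_gt0. Qed.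

Lemma holomorphic_holo_off f : holomorphic_disc f -> holo_off disc [::] f.
Proof.
move=> fh z zD; have /derivableP_cdiff[d fd] := fh z zD.
by split; [exact: cdiff_ccont fd|exists d].
Qed.

Lemma disc_sqr_gap (z : C) : disc z ->
  1 - normc z <= 1 - normc z ^+ 2 /\ 1 - normc z ^+ 2 <= 1.
Proof.
move=> /disc_gap /andP[h1 h2]; have n0 := normc_ge0 z.
by split; [nra|rewrite gerBl sqr_ge0].
Qed.

(** A crude polynomial bound, whose exponent [psi_inv_exp] will absorb. *)
Lemma weight_lower : exists m : nat, forall z : C, disc z ->
  (1 - normc z) ^+ m <= weight alpha z.
Proof.
exists (Num.bound `|alpha|) => z zD; set m := Num.bound _.
have am : alpha <= m%:R.
  by apply: le_trans (ler_norm _) _; apply/ltW/archi_boundP.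
have [h1 h2] := disc_sqr_gap zD; have /andP[h3 h4] := disc_gap zD.
apply: (@le_trans _ _ ((1 - normc z ^+ 2) ^+ m)).
  by rewrite lerXn2r // nnegrE; lra.
rewrite -powR_mulrn; last lra.
by apply: ger_powR => //; lra.
Qed.

Lemma plane_measure_square (b : C) rho : 0 < rho ->
  @plane_measure R (to_plane (square b rho)) = (4 * rho ^+ 2)%:E.
Proof.
move=> r0; rewrite to_plane_square.
rewrite /plane_measure product_measure1E; [|exact: measurable_itv..].
have H c : mu [set` `[c - rho, c + rho]] = (2 * rho)%:E.
  have := @lebesgue_measure_itv R `[c - rho, c + rho] => /= ->.
  by rewrite lte_fin ifT; [rewrite -EFinB; congr _%:E; ring|lra].
transitivity ((2 * rho)%:E * (2 * rho)%:E)%E; first by congr (_ * _)%E;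
  exact: H.
by rewrite -EFinM; congr _%:E; ring.
Qed.

Lemma measurable_square (b : C) rho : measurable (to_plane (square b rho)).
Proof.
by rewrite to_plane_square; apply: measurableX; exact: measurable_itv.
Qed.

Lemma square_in_disc (b z : C) : disc b -> square b ((1 - normc b) / 4) z ->
  disc z /\ (1 - normc b) / 2 <= 1 - normc z.
Proof.
move=> bD /square_normc h; have := normc_sub_ge z b; rewrite ler_norml.
by move: bD; rewrite /disc /=; lra.
Qed.

Lemma c_norm_gt0 : 0 < c_norm alpha.
Proof.
rewrite /c_norm invr_gt0; set I := disc_integral _.
have Ify : (I < +oo)%E by exact: weight_integral_lty.
have [m wm] := weight_lower.
have D0 : disc (0 : C) by rewrite /disc /= expr0n /= addr0 sqrtr0.
have n0 : normc (0 : C) = 0 by rewrite normc0.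
pose Q := to_plane (square (0 : C) ((1 - normc (0 : C)) / 4)).
pose e : R := 2^-1 ^+ m.
have mQ : measurable Q by exact: measurable_square.
have lb : ((e * (4 * (1 / 4) ^+ 2))%:E <= I)%E.
  apply: (@le_trans _ _ (\int[@plane_measure R]_(p in Q) e%:E)%E).
    rewrite integral_cst // EFinM; apply: lee_wpmul2l;
      first by rewrite lee_fin exprn_ge0.
    by rewrite /Q n0 subr0 le_eqVlt -(plane_measure_square 0) // eqxx.
  apply: (@le_trans _ _ (\int[@plane_measure R]_(p in Q)
     ((weight alpha (p.1 +i* p.2)%C)%:E))%E).
    apply: ge0_le_integral => //.
    - by move=> p _; rewrite lee_fin exprn_ge0.
    - apply/measurable_EFinP; apply: measurable_funS (measurable_weight alpha).
        exact: measurable_disc.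
      by move=> p /(square_in_disc D0)[].
    - move=> p /(square_in_disc D0)[h1 h2]; rewrite lee_fin.
      apply: le_trans (wm _ h1); rewrite n0 subr0 mul1r in h2.
      by rewrite lerXn2r // nnegrE; have /andP[? ?] := disc_gap h1; exact: ltW.
  apply: ge0_subset_integral => //.
  - exact: measurable_disc.
  - by apply/measurable_EFinP; exact: measurable_weight.
  - by move=> p _; rewrite lee_fin weight_ge0.
  - by move=> p /(square_in_disc D0)[].
have I0 : (0 <= I)%E by apply: integral_ge0 => p _; rewrite lee_fin weight_ge0.
rewrite -lte_fin fineK ?ge0_fin_numE //; apply: lt_le_trans lb.
by rewrite lte_fin mulr_gt0 // ?exprn_gt0 // mulr_gt0 // exprn_gt0.
Qed.

Lemma measurable_modular f c : 0 < c -> holomorphic_disc f ->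
  measurable_fun (to_plane disc) (fun p : R * R =>
    psi (normc (f (p.1 +i* p.2)%C) / c) *
      (c_norm alpha * weight alpha (p.1 +i* p.2)%C)).
Proof.
move=> c0 /holomorphic_holo_off/measurable_normc mN.
apply: measurable_funM; last first.
  by apply: measurable_funM => //; exact: measurable_weight.
have -> : (fun p : R * R => psi (normc (f (p.1 +i* p.2)%C) / c)) =
  (fun x : R => psi (Num.max 0 x)) \o
    (fun p : R * R => normc (f (p.1 +i* p.2)%C) / c).
  apply/funext => p /=; congr psi; apply/esym/max_idPr.
  by rewrite divr_ge0 ?normc_ge0 // ltW.
apply: measurableT_comp; last exact: measurable_funM.
by apply: continuous_measurable_fun; exact: continuous_psi_max.
Qed.

Lemma modular_integrand_ge0 f c (z : C) : 0 < c ->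
  0 <= psi (normc (f z) / c) * (c_norm alpha * weight alpha z).
Proof.
move=> c0; apply: mulr_ge0; last first.
  by apply: mulr_ge0; [exact/ltW/c_norm_gt0|exact: weight_ge0].
by apply: psi_ge0 => //; rewrite divr_ge0 ?normc_ge0 // ltW.
Qed.

(** By the [Delta^2]-condition, [psi] of a small multiple of [growth] is at most
    an arbitrarily small power [eps] of [1 / (1 - |z|)], and the weight with
    exponent [alpha - eps > -1] is integrable. *)
Lemma modular_upper : exists2 K : R, 0 < K &
  forall f b, holomorphic_disc f -> 0 < b ->
  (forall z, disc z -> normc (f z) <= b * growth z) ->
  (modular alpha psi f (K * b) <= 1)%E.
Proof.
have c0 := c_norm_gt0.
have [k hk] : exists k, (2 ^ k)%:R^-1 < alpha + 1.
  have a1 : 0 < alpha + 1 by move: alpha_gt; lra.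
  exists (Num.bound (alpha + 1)^-1).
  rewrite -[ltRHS]invrK ltf_pV2 ?posrE ?invr_gt0 ?ltr0n ?expn_gt0 //.
  have i0 : 0 <= (alpha + 1)^-1 by rewrite invr_ge0 ltW.
  apply: lt_le_trans (archi_boundP i0) _.
  by rewrite ler_nat ltnW // ltn_expl.
set eps : R := (2 ^ k)%:R^-1.
have eps0 : 0 < eps by rewrite invr_gt0 ltr0n expn_gt0.
have eps1 : eps <= 1 by rewrite invf_le1 ?ltr0n ?expn_gt0 // ler1n expn_gt0.
have [K K1 hK] := psi_inv_exp psi_orlicz psi_Delta2 (2 ^ k).
have K0 : 0 < K by apply: lt_le_trans K1.
set I := disc_integral (fun z : C => (weight (alpha - eps) z)%:E).
have Ify : (I < +oo)%E by apply: weight_integral_lty; move: hk; rewrite -/eps;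
  lra.
have I0 : (0 <= I)%E by apply: integral_ge0 => p _; rewrite lee_fin weight_ge0.
have IE : I = (fine I)%:E by rewrite fineK // ge0_fin_numE.
(* Dividing by [L >= 1] divides [psi] by at least [L], which brings the modular
   below [1]. *)
set L := 1 + 2 * c_norm alpha * fine I.
have fI0 : 0 <= fine I by exact: fine_ge0.
have L1 : 1 <= L by rewrite lerDl !mulr_ge0 // ltW.
have L0 : 0 < L by apply: lt_le_trans L1.
exists (K * L) => [|f b fh b0 fb]; first exact: mulr_gt0.
have KLb : 0 < K * L * b by rewrite !mulr_gt0.
have key z : disc z -> psi (normc (f z) / (K * L * b)) <=
  (1 - normc z) `^ (- eps) / L.
  move=> zD; have /andP[g0 g1] := disc_gap zD.
  set x := 1 / (1 - normc z); have x1 : 1 <= x by exact: disc_inv_gap.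
  set y := x `^ eps.
  have y1 : 1 <= y by rewrite -(powRr0 x); apply: ler_powR => //; exact: ltW.
  have yx : y ^+ (2 ^ k) = x.
    have nz : ((2 ^ k)%:R : R) != 0 by rewrite pnatr_eq0 -lt0n expn_gt0.
    rewrite -powR_mulrn ?(le_trans ler01 y1) // /y -powRrM mulVf // powRr1 //.
    exact: le_trans x1.
  have y0 : 0 <= y by apply: le_trans y1.
  have hx : growth z <= K * X y by rewrite /critical_growth -/x -yx; exact: hK.
  have n0 : 0 <= normc (f z) / (K * L * b) by rewrite divr_ge0 ?normc_ge0 //
    ltW.
  have n1 : normc (f z) / (K * L * b) <= X y / L.
    rewrite ler_pdivrMr //; apply: le_trans (fb z zD) _.
    have -> : X y / L * (K * L * b) = b * (K * X y) by field; rewrite gt_eqF.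
    by rewrite ler_wpM2l // ltW.
  apply: le_trans (psi_le psi_orlicz n0 n1) _.
  apply: le_trans (psi_scale psi_orlicz (psi_inv_ge0 psi_orlicz y0) L1) _.
  rewrite psi_invK // ler_pM2r ?invr_gt0 // /y /x div1r -powR_inv1 ?(ltW g0) //.
  by rewrite -powRrM mulN1r.
rewrite /modular /integral_v.
apply: (@le_trans _ _ ((2 * c_norm alpha / L)%:E * I)%E); last first.
  rewrite IE -EFinM lee_fin mulrAC ler_pdivrMr // mul1r /L.
  by rewrite lerDr.
rewrite -[leRHS]ge0_integralZl; last first.
- by rewrite lee_fin divr_ge0 ?mulr_ge0 // ltW.
- by move=> p _; rewrite lee_fin weight_ge0.
- by apply/measurable_EFinP; exact: measurable_weight.
- exact: measurable_disc.
apply: ge0_le_integral.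
- exact: measurable_disc.
- by move=> p _; rewrite lee_fin modular_integrand_ge0.
- by apply/measurable_EFinP; exact: measurable_modular.
- apply: measurable_funeM; apply/measurable_EFinP; exact: measurable_weight.
move=> p pD; rewrite -EFinM lee_fin; set z := (p.1 +i* p.2)%C.
have zD : disc z by [].
have /andP[g0 g1] := disc_gap zD; have [u1 u2] := disc_sqr_gap zD.
have n0 := normc_ge0 z.
set u := 1 - normc z ^+ 2 in u1 u2.
have u0 : 0 < u by apply: lt_le_trans u1.
have gap : (1 - normc z) `^ (- eps) <= 2 * u `^ (- eps).
  have h : (1 - normc z) `^ (- eps) <= (u / 2) `^ (- eps).
    apply: le_powR_npos; [by rewrite divr_gt0| |by rewrite oppr_le0 ltW].
    by rewrite /u; nra.
  apply: le_trans h _; rewrite powRM ?invr_ge0 ?(ltW u0) // mulrC ler_wpM2r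
    ?powR_ge0 //.
  rewrite -powR_inv1 // -powRrM mulN1r opprK.
  by rewrite -[leRHS]powRr1 //; apply: ler_powR; rewrite ?ler1n.
have w : u `^ (- eps) * weight alpha z = weight (alpha - eps) z.
  by rewrite /weight -/u -powRD ?(gt_eqF u0) ?implybT // addrC.
have wa0 := weight_ge0 alpha z.
apply: (@le_trans _ _ (2 * u `^ (- eps) / L * (c_norm alpha * weight alpha z))).
  rewrite ler_wpM2r ?mulr_ge0 ?(ltW c0) //; apply: le_trans (key z zD) _.
  by rewrite ler_pM2r ?invr_gt0.
by rewrite -w; apply: le_of_eq; ring.
Qed.

End NormComparison.

(** * Point evaluations *)

Section PointEvaluation.
Variables (R : realType) (alpha : R) (psi : R -> R).
Hypotheses (alpha_gt : -1 < alpha) (psi_orlicz : orlicz psi).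
Hypothesis psi_Delta2 : Delta2_upper psi.
Local Notation C := R[i].
Local Notation X := (psi_inv psi).
Implicit Types f F : C -> C.

(** Above [u] this says that [psi t / t] increases. Integrated over a set, it
    bounds the mean of a function by its modular. *)
Lemma le_threshold (t u : R) : 0 <= t -> 0 < u -> t <= u + u / psi u * psi t.
Proof.
move=> t0 u0; have pu := psi_gt0 psi_orlicz u0;
  have pt := psi_ge0 psi_orlicz t0.
have [tu|ut] := leP t u.
  apply: le_trans tu _; rewrite lerDl; apply: mulr_ge0 => //.
  by apply: divr_ge0; apply: ltW.
have t1 : 0 < t by apply: lt_trans ut.
have l1 : 1 <= t / u by rewrite ler_pdivlMr // mul1r ltW.
have := psi_scale psi_orlicz t0 l1.
have -> : t / (t / u) = u by field; rewrite !gt_eqF.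
have -> : psi t / (t / u) = psi t * u / t by field; rewrite !gt_eqF.
rewrite ler_pdivlMr // => h.
apply: le_trans (_ : u / psi u * psi t <= _); last by rewrite lerDr ltW.
by rewrite mulrAC ler_pdivlMr // mulrC [u * _]mulrC.
Qed.

(** The mean of [|f|] over a square around [z], of size comparable to [1 - |z|],
    is estimated by [le_threshold] with a threshold [u] at which [psi u] is a
    power of [1 / (1 - |z|)] times [M]: this power is large enough to compensate
    both the smallness of the weight on the square and that of its area. *)
Lemma point_evaluation : exists2 K : R, 0 < K &
  forall f c M, holomorphic_disc f ->
  0 < c -> 1 <= M -> (modular alpha psi f c <= M%:E)%E ->
  forall z, disc z -> normc (f z) <= K * M * c * critical_growth psi z.
Proof.
have cn0 : 0 < c_norm alpha by exact: c_norm_gt0.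
have [m wm] := weight_lower alpha.
have [K K1 hK] := psi_inv_exp psi_orlicz psi_Delta2 (m + 2).
have K0 : 0 < K by apply: lt_le_trans K1.
set A := 1 + 16 * 2 ^+ m / c_norm alpha.
have p2m : 0 < (2 : R) ^+ m by exact: exprn_gt0.
have A1 : 1 <= A by rewrite lerDl divr_ge0 ?mulr_ge0 ?(ltW p2m) ?(ltW cn0).
have A0 : 0 < A by apply: lt_le_trans A1.
exists (80 * A * K) => [|f c M fh c0 M1 fM b bD]; first by rewrite !mulr_gt0.
have M0 : 0 < M by apply: lt_le_trans M1.
have fo := holomorphic_holo_off fh.
have /andP[t0 t1] := disc_gap bD; set t := 1 - normc b in t0 t1.
set rho := t / 4; have r0 : 0 < rho by rewrite divr_gt0.
have QD z : square b rho z ->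
  disc z /\ t / 2 <= 1 - normc z by exact: square_in_disc.
have QD1 : square b rho `<=` disc by move=> z /QD[].
have := area_mean r0 QD1 fo.
pose Q := to_plane (square b rho).
have QDp : Q `<=` to_plane disc by move=> p; exact: QD1.
have mQ : measurable Q by exact: measurable_square.
pose N (p : R * R) := normc (f (p.1 +i* p.2)%C).
pose W (p : R * R) := psi (normc (f (p.1 +i* p.2)%C) / c) *
   (c_norm alpha * weight alpha (p.1 +i* p.2)%C).
set D := (2 / t) ^+ m / c_norm alpha.
have D0 : 0 < D by rewrite divr_gt0 // exprn_gt0 // divr_gt0.
set Y := D * M / rho ^+ 2.
have Y0 : 0 < Y by apply: divr_gt0; [exact: mulr_gt0|exact: exprn_gt0].
set u := X Y; have u0 : 0 < u by exact: psi_inv_gt0.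
have pu : psi u = Y by rewrite /u psi_invK // ltW.
have mW : measurable_fun (to_plane disc) (EFin \o W).
  by apply/measurable_EFinP; exact: (measurable_modular alpha psi_orlicz c0 fh).
have mWQ : measurable_fun Q (EFin \o W).
  by apply: measurable_funS mW => //; exact: measurable_disc.
have W0 p : (0 <= (EFin \o W) p)%E by rewrite lee_fin;
  exact: (modular_integrand_ge0 alpha_gt psi_orlicz f (p.1 +i* p.2)%C c0).
have pQ : measurable_fun Q (fun p : R * R => N p).
  apply: (@measurable_funS _ _ _ _ (to_plane disc)) => //;
    first exact: measurable_disc.
  exact: measurable_normc.
have ptw p : Q p -> N p <= c * u + c * (u / Y * D) * W p.
  move=> Qp; have [zD zt] := QD _ Qp.
  have n0 : 0 <= N p / c by rewrite divr_ge0 ?normc_ge0 // ltW.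
  have := le_threshold n0 u0; rewrite pu => h1.
  have -> : N p = c * (N p / c) by rewrite mulrC divfK // gt_eqF.
  have -> : c * u + c * (u / Y * D) * W p = c * (u + u / Y * (D * W p)) by ring.
  rewrite ler_wpM2l ?(ltW c0) //; apply: le_trans h1 _; rewrite lerD2l.
  apply: ler_wpM2l; first by apply: divr_ge0; apply: ltW.
  rewrite /W /D; set ps := psi _.
  have ps0 : 0 <= ps by apply: psi_ge0.
  have hw : (t / 2) ^+ m <= weight alpha (p.1 +i* p.2)%C.
    apply: le_trans (wm _ zD); rewrite lerXn2r // nnegrE; last lra.
    by rewrite divr_ge0 // ltW.
  have -> : (2 / t) ^+ m / c_norm alpha *
    (ps * (c_norm alpha * weight alpha (p.1 +i* p.2)%C))
     = ps * ((2 / t) ^+ m * weight alpha (p.1 +i* p.2)%C) by field;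
       rewrite gt_eqF.
  rewrite ler_peMr //; apply: le_trans (_ : (2 / t) ^+ m * (t / 2) ^+ m <= _).
    rewrite -exprMn; have -> : 2 / t * (t / 2) = 1 by field; rewrite gt_eqF.
    by rewrite expr1n.
  by rewrite ler_wpM2l // exprn_ge0 // divr_ge0 // ltW.
have k0 : 0 <= c * (u / Y * D).
  by rewrite mulr_ge0 ?(ltW c0) // mulr_ge0 ?(ltW D0) // divr_ge0 // ltW.
have IW : (\int[@plane_measure R]_(p in Q) (EFin \o W) p <= M%:E)%E.
  apply: le_trans fM; apply: ge0_subset_integral => //; exact: measurable_disc.
have IN : (\int[@plane_measure R]_(p in Q) (N p)%:E <=
  (5 * c * u * rho ^+ 2)%R%:E)%E.
  apply: (@le_trans _ _ (\int[@plane_measure R]_(p in Q)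
     ((c * u)%R%:E + (c * (u / Y * D))%R%:E * (EFin \o W) p))%E).
    apply: ge0_le_integral.
    - exact: mQ.
    - by move=> p _; rewrite lee_fin normc_ge0.
    - exact/measurable_EFinP.
    - by apply: emeasurable_funD => //; exact: measurable_funeM.
    - by move=> p /ptw; rewrite -EFinM -EFinD lee_fin.
  rewrite ge0_integralD //; last 3 first.
  - by move=> p _; rewrite lee_fin mulr_ge0 // ltW.
  - by move=> p _; rewrite mule_ge0 // lee_fin.
  - exact: measurable_funeM.
  rewrite integral_cst // ge0_integralZl //.
  rewrite [X in (_ * X + _)%E]plane_measure_square //.
  apply: (@le_trans _ _ ((c * u)%R%:E * (4 * rho ^+ 2)%R%:E +
    (c * (u / Y * D))%R%:E * M%:E)%E).
    by rewrite leeD2l // lee_wpmul2l // lee_fin.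
  rewrite -!EFinM -EFinD lee_fin.
  have -> : c * (u / Y * D) * M = c * u * rho ^+ 2.
    by rewrite /Y; field; rewrite !gt_eqF // mulr_gt0.
  by apply: le_of_eq; ring.
rewrite -/Q => hfb.
have fb : normc (f b) <= 80 * c * u.
  rewrite -lee_fin; apply: le_trans hfb _.
  apply: (@le_trans _ _ ((16 / rho ^+ 2)%R%:E * (5 * c * u * rho ^+ 2)%R%:E)%E).
    by rewrite lee_wpmul2l // lee_fin divr_ge0 // sqr_ge0.
  rewrite -EFinM lee_fin; apply: le_of_eq; field.
  by rewrite gt_eqF.
apply: le_trans fb _.
set x := 1 / t; have x1 : 1 <= x by exact: disc_inv_gap.
have x0 : 0 <= x by apply: le_trans x1.
have YE : Y = M * (16 * 2 ^+ m / c_norm alpha) * x ^+ (m + 2).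
  rewrite /Y /D /rho /x div1r exprD exprMn !exprVn.
  by field; rewrite !expf_neq0 ?(gt_eqF cn0) ?(gt_eqF t0).
have hu : u <= M * A * (K * X x).
  have MA1 : 1 <= M * A by rewrite mulr_ege1.
  apply: (@le_trans _ _ (X (M * A * x ^+ (m + 2)))).
    apply: le_psi_inv => //; first exact: ltW.
    rewrite YE ler_wpM2r ?exprn_ge0 // ler_wpM2l ?(ltW M0) //.
    by rewrite /A lerDr.
  apply: le_trans (psi_inv_scale _ MA1 _) _ => //; first exact: exprn_ge0.
  by rewrite ler_wpM2l ?mulr_ge0 ?(ltW M0) ?(ltW A0) // hK.
apply: le_trans (_ : 80 * c * (M * A * (K * X x)) <= _).
  by rewrite ler_wpM2l // mulr_ge0 // ltW.
by rewrite /critical_growth -/t -/x; apply: le_of_eq; ring.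
Qed.

End PointEvaluation.

(** * Cluster points and subsequences *)

Section Subsequences.
Variable R : realType.

(** Tychonoff's theorem, for any index set: [n] can be chosen so that finitely
    many coordinates are simultaneously close to those of the cluster point. *)
Lemma bounded_cluster (I : eqType) (u : nat -> I -> R) (b : I -> R) :
  (forall n i, `|u n i| <= b i) ->
  exists p : I -> R, forall (s : seq I) (e : R) (N : nat), 0 < e ->
    exists2 n, (N <= n)%N & forall i, i \in s -> `|u n i - p i| <= e.
Proof.
move=> ub.
pose T := fun _ : I => (R : topologicalType).
have cK := @tychonoff I T (fun i => [set` `[- b i, b i]])
  (fun i => @segment_compact R (- b i) (b i)).
have [|p [_ pcl]] := cK ((u : nat -> prod_topology T) @ \oo) _.
  exists 0%N => // n _ i /=; rewrite in_itv /= -ler_norml; exact: ub.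
exists p => s e N e0.
have nb : nbhs (p : prod_topology T)
    [set q : prod_topology T | forall i, i \in s -> `|q i - p i| <= e].
  elim: s => [|i s IH]; first by apply: filterE.
  have ni : nbhs (p : prod_topology T)
    [set q : prod_topology T | `|q i - p i| <= e].
    have /= c := @proj_continuous I T i p.
    apply: (c [set x : R | `|x - p i| <= e]).
    apply/nbhs_ballP; exists e => //= x; rewrite /ball_ /= distrC => /ltW;
      exact.
  apply: filterS (filterI ni IH) => q [h1 h2] j.
  by rewrite inE => /predU1P[->//|]; exact: h2.
have FA : ((u : nat -> prod_topology T) @ \oo) (u @` [set n | (N <= n)%N]).
  by exists N => // n Nn; exists n.
by have [_ [[n Nn <-] h]] := pcl _ _ FA nb; exists n.
Qed.

Lemma extract_subsequence (P : nat -> nat -> Prop) :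
  (forall k N, exists2 n, (N <= n)%N & P k n) ->
  exists2 s : nat -> nat, increasing_seq s & forall k, P k (s k).
Proof.
move=> h.
have /choice[g hg] : forall kN : nat * nat, exists n, (kN.2 <= n)%N /\ P kN.1 n.
  by move=> [k N]; have [n ? ?] := h k N; exists n.
pose s := fix s k := if k is k'.+1 then g (k, (s k').+1) else g (0%N, 0%N).
exists s; first by apply/increasing_seqP => k; have [] := hg (k.+1, (s k).+1).
by case=> [|k]; [have [] := hg (0%N, 0%N)|have [] := hg (k.+1, (s k).+1)].
Qed.

End Subsequences.

(** * Montel's theorem *)

Section Montel.
Variable R : realType.
Local Notation C := R[i].

Lemma inv_nat_le (t : R) n : 0 < t -> (Num.bound t^-1 <= n)%N ->
  n.+1%:R^-1 <= t.
Proof.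
move=> t0 tn; rewrite -[leRHS]invrK lef_pV2 ?posrE ?invr_gt0 //.
apply: le_trans (_ : (Num.bound t^-1)%:R <= _); last by rewrite ler_nat ltnW.
by apply/ltW/archi_boundP; rewrite invr_ge0 ltW.
Qed.

Lemma interval_net (d : R) : 0 < d ->
  exists s : seq R, forall x, `|x| <= 1 -> exists2 y, y \in s & `|x - y| <= d.
Proof.
move=> d0; pose m := (Num.bound d^-1).+1.
have m0 : 0 < m%:R :> R by rewrite ltr0n.
have md : m%:R^-1 <= d by exact: inv_nat_le.
exists [seq -1 + j%:R / m%:R | j <- iota 0 (2 * m).+1] => x;
  rewrite ler_norml => /andP[x1 x2].
have y0 : 0 <= (x + 1) * m%:R by rewrite mulr_ge0 ?(ltW m0) //; lra.
have /andP[h1 h2] := truncn_itv y0.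
set j := Num.truncn _ in h1 h2.
exists (-1 + j%:R / m%:R).
  apply/mapP; exists j => //; rewrite mem_iota /= add0n ltnS -(ler_nat R).
  apply: le_trans h1 _; rewrite natrM; apply: ler_wpM2r; [exact: ltW|lra].
apply: le_trans md.
have -> : x - (-1 + j%:R / m%:R) = ((x + 1) * m%:R - j%:R) / m%:R.
  by field; rewrite gt_eqF.
rewrite normrM [X in _ * X]ger0_norm ?invr_ge0 ?(ltW m0) //.
rewrite ler_piMl ?invr_ge0 ?(ltW m0) // ger0_norm ?subr_ge0 //.
by move: h2; rewrite -natr1; lra.
Qed.

Lemma disc_net (d : R) : 0 < d -> exists s : seq C,
  forall z, normc z <= 1 -> exists2 w, w \in s & normc (z - w) <= d.
Proof.
move=> d0; have [s hs] := @interval_net (d / 2) ltac:(by rewrite divr_gt0).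
exists [seq (x +i* y)%C | x <- s, y <- s] => z z1.
have [x xs xd] := hs (Re z) (le_trans (normc_Re z) z1).
have [y ys yd] := hs (Im z) (le_trans (normc_Im z) z1).
exists (x +i* y)%C; first by apply/allpairsP; exists (x, y).
by apply: le_trans (normc_le_ReIm _) _; rewrite ReB ImB /=; lra.
Qed.

Definition locally_bounded (B : C -> R) :=
  forall rho : R, 0 <= rho -> rho < 1 ->
  exists2 M, 0 < M & forall z, normc z <= rho -> B z <= M.

(** The discs of radius [3 * q] around the points of the disc of radius
    [rho] stay in a larger disc of radius less than [1], on which all [f]
    share the bound [M]. *)
Lemma holo_uniform (B : C -> R) rho : locally_bounded B -> 0 <= rho ->
  rho < 1 ->
  exists L Q r : R, [/\ 0 < L, 0 < Q, 0 < r & forall f, holomorphic_disc f ->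
    (forall z, disc z -> normc (f z) <= B z) -> forall z d, normc z <= rho ->
    cdiff f z d ->
    [/\ normc d <= L,
        forall w, normc (w - z) <= r -> normc (f w - f z) <= L * normc (w - z) &
        forall w, normc (w - z) <= r ->
          normc (f w - f z - d * (w - z)) <= Q * normc (w - z) ^+ 2]].
Proof.
move=> Bb r0 r1; set q := (1 - rho) / 6;
  have q0 : 0 < q by rewrite divr_gt0 ?subr_gt0.
have q3 : rho + 3 * q < 1 by rewrite /q; lra.
have q3' : 0 <= rho + 3 * q by lra.
have [M M0 hM] := Bb _ q3' q3.
exists (64 * M / q), (2176 * M / q ^+ 2), (q / 4); split.
- by rewrite divr_gt0 // mulr_gt0.
- by apply: divr_gt0; [apply: mulr_gt0;
  [rewrite ltr0n|exact: M0]|exact: exprn_gt0].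
- by rewrite divr_gt0.
move=> f fh fB z d zr fd.
have near w : normc (w - z) <= 3 * q -> normc w <= rho + 3 * q.
  move=> wz; have -> : w = z + (w - z) by ring.
  by apply: le_trans (normc_triangle _ _) _; exact: lerD.
have f1 w : normc (w - z) <= 3 * q -> normc (f w) <= M.
  move=> /near h; apply: le_trans (hM _ h); apply: fB; exact: le_lt_trans h q3.
have f2 w : normc (w - z) <= 3 * q -> exists d, cdiff f w d.
  by move=> /near h; apply/derivableP_cdiff; apply: fh; exact: le_lt_trans h q3.
split.
- exact: (holo_derivative_bound q0 f1 f2 fd).
- by move=> w wz; apply: (holo_lipschitz q0 f1 f2 fd); lra.
- by move=> w wz; apply: (holo_taylor q0 f1 f2 fd).
Qed.

(** The values and the derivatives of the given functions at all points have a
    common cluster point. The uniform Taylor estimates pass to this cluster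
    point, which is therefore holomorphic, and the uniform Lipschitz estimates
    improve proximity on a finite net to uniform proximity. *)
Lemma montel (B : C -> R) (f : nat -> C -> C) : locally_bounded B ->
  (forall n, holomorphic_disc (f n)) ->
  (forall n z, disc z -> normc (f n z) <= B z) ->
  exists s : nat -> nat, exists g : C -> C,
    [/\ increasing_seq s, holomorphic_disc g,
    forall z, disc z -> normc (g z) <= B z &
    forall rho e : R, 0 <= rho -> rho < 1 -> 0 < e ->
      exists N, forall k, (N <= k)%N -> forall z, normc z <= rho ->
        normc (f (s k) z - g z) <= e].
Proof.
move=> Bb fh fB.
have /choice[D hD] : forall nz : nat * C, exists d,
  disc nz.2 -> cdiff (f nz.1) nz.2 d.
  move=> [n z]; have [zD|nD] := pselect (disc z); last by exists 0 => /nD.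
  by have /derivableP_cdiff[d hd] := fh n z zD; exists d.
pose val n (v : bool) z := if `[< disc z >] then
  (if v then f n z else D (n, z)) else 0.
pose u n (i : bool * bool * C) : R :=
  if i.1.2 then Re (val n i.1.1 i.2) else Im (val n i.1.1 i.2).
have /choice[b hb] : forall i, exists b, forall n, `|u n i| <= b.
  move=> [[v r] z]; have [zD|nD] := pselect (disc z); last first.
    by exists 0 => n; rewrite /u /val /= asboolF //; case: r; rewrite /= normr0.
  have [L [Q [q [L0 _ _ hL]]]] := holo_uniform Bb (normc_ge0 z) zD.
  exists (`|B z| + L) => n.
  have h : normc (val n v z) <= `|B z| + L.
    rewrite /val asboolT //; case: v.
      apply: le_trans (fB n z zD) _; apply: le_trans (ler_norm _) _.
      by rewrite lerDl ltW.
    have [h _ _] := hL _ (fh n) (fB n) z _ (lexx _) (hD (n, z) zD).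
    by apply: le_trans h _; rewrite lerDr.
  rewrite /u /=; case: r; apply: le_trans h; [exact: normc_Re|exact: normc_Im].
have [p hp] := bounded_cluster (fun n i => hb i n).
pose lim v z : C := (p (v, true, z) +i* p (v, false, z))%C.
pose g z := lim true z; pose G z := lim false z.
have cl (zs : seq C) e N : 0 < e -> exists2 n, (N <= n)%N &
    forall z, z \in zs -> disc z -> normc (f n z - g z) <= e /\
      normc (D (n, z) - G z) <= e.
  move=> e0; pose I := [seq (vr, z) | vr <- [:: (true, true); (true, false);
    (false, true); (false, false)], z <- zs].
  have [n Nn hn] := hp I (e / 2) N ltac:(by rewrite divr_gt0).
  exists n => // z zz zD.
  have h v : normc (val n v z - lim v z) <= e.
    apply: le_trans (normc_le_ReIm _) _; rewrite ReB ImB /=.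
    have hr := hn (v, true, z); have hi := hn (v, false, z).
    have ir : (v, true, z) \in I.
      by apply/allpairsP; exists ((v, true), z); split => //; case: (v).
    have ii : (v, false, z) \in I.
      by apply/allpairsP; exists ((v, false), z); split => //; case: (v).
    by move: (hr ir) (hi ii); rewrite /u /=; lra.
  have := h true; have := h false; rewrite /val asboolT //.
have gB z : disc z -> normc (g z) <= B z.
  move=> zD; apply/ler_addgt0Pr => e e0.
  have [n _ /(_ z (mem_head _ _) zD)[h _]] := cl [:: z] e 0%N e0.
  have -> : g z = f n z - (f n z - g z) by ring.
  by apply: normc_sub_le => //; exact: fB.
have gd z : disc z -> cdiff g z (G z).
  move=> zD; have [L [Q [q [L0 Q0 q0 hL]]]] := holo_uniform Bb (normc_ge0 z) zD.
  have [s s0 hs] := disc_nbhs zD.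
  have key w : normc (w - z) <= q -> normc (w - z) < s ->
      normc (g w - g z - G z * (w - z)) <= Q * normc (w - z) ^+ 2.
    move=> wq ws; apply/ler_addgt0Pr => e e0.
    set c := 2 + normc (w - z).
    have c0 : 0 < c by rewrite ltr_wpDr // normc_ge0.
    have [n _ hn] := cl [:: z; w] (e / c) 0%N (divr_gt0 e0 c0).
    have [h1 h2] : normc (f n z - g z) <= e / c /\ normc (D (n, z) - G z) <=
      e / c.
      by apply: hn => //; rewrite !inE eqxx.
    have [h3 _] : normc (f n w - g w) <= e / c /\ normc (D (n, w) - G w) <=
      e / c.
      by apply: hn; [rewrite !inE eqxx orbT|exact: hs].
    have [_ _ h4] := hL _ (fh n) (fB n) z _ (lexx _) (hD (n, z) zD).
    have {}h4 := h4 w wq.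
    have -> : g w - g z - G z * (w - z) =
      (f n w - f n z - D (n, z) * (w - z)) - ((f n w - g w) -
        ((f n z - g z) + (D (n, z) - G z) * (w - z))) by ring.
    apply: normc_sub_le => //.
    have -> : e = e / c + (e / c + e / c * normc (w - z)).
      rewrite addrA -mulr2n -mulr_natr -mulrDr -/c divfK // gt_eqF //.
    apply: normc_sub_le => //; apply: le_trans (normc_triangle _ _) _.
    by rewrite lerD // normcM ler_wpM2r ?normc_ge0.
  move=> e e0; exists (Num.min (Num.min q s) (e / Q)) => [|w].
    by rewrite !lt_min q0 s0 divr_gt0.
  rewrite !lt_min => /andP[/andP[w1 w2] w3].
  apply: le_trans (key w (ltW w1) w2) _.
  rewrite expr2 mulrA ler_wpM2r ?normc_ge0 // mulrC -ler_pdivlMr //; exact: ltW.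
have gh : holomorphic_disc g.
  by move=> z zD; apply/derivableP_cdiff; exists (G z); exact: gd.
have unif rho e N : 0 <= rho -> rho < 1 -> 0 < e ->
    exists2 n, (N <= n)%N & forall z,
      normc z <= rho -> normc (f n z - g z) <= e.
  move=> r0 r1 e0; set rho' := (1 + rho) / 2.
  have r0' : 0 <= rho' by rewrite /rho'; lra.
  have r1' : rho' < 1 by rewrite /rho'; lra.
  have [L [Q [q [L0 Q0 q0 hL]]]] := holo_uniform Bb r0' r1'.
  set d := Num.min (Num.min q ((1 - rho) / 2)) (e / (3 * L)).
  have d0 : 0 < d by rewrite !lt_min q0 !divr_gt0 ?mulr_gt0 ?subr_gt0.
  have [d1 d2 d3] : [/\ d <= q, d <= (1 - rho) / 2 & d <= e / (3 * L)].
    by rewrite /d !ge_min !lexx !orbT.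
  have [zs hzs] := disc_net d0.
  have [n Nn hn] := cl zs (e / 3) N ltac:(by rewrite divr_gt0).
  exists n => // z zr.
  have [w ws wz] := hzs z (le_trans zr (ltW r1)).
  have wr : normc w <= rho'.
    have -> : w = z - (z - w) by ring.
    by apply: le_trans (normc_sub_le zr wz) _; rewrite /rho'; lra.
  have wD : disc w by exact: le_lt_trans wr r1'.
  have [h1 _] := hn w ws wD.
  have [_ h2 _] := hL _ (fh n) (fB n) w _ wr (hD (n, w) wD).
  have [_ h3 _] := hL _ gh gB w _ wr (gd w wD).
  have {}h2 := h2 z (le_trans wz d1); have {}h3 := h3 z (le_trans wz d1).
  have Ld : L * normc (z - w) <= e / 3.
    apply: le_trans (_ : L * (e / (3 * L)) <= _).
      by rewrite ler_wpM2l ?(ltW L0) //; exact: le_trans wz d3.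
    by apply: le_of_eq; field; rewrite gt_eqF.
  have -> : f n z - g z = (f n z - f n w) - ((g z - g w) - (f n w - g w)) by
    ring.
  have -> : e = e / 3 + (e / 3 + e / 3) by lra.
  apply: normc_sub_le; first exact: le_trans h2 Ld.
  by apply: normc_sub_le => //; exact: le_trans h3 Ld.
pose rk (k : nat) : R := 1 - k.+1%:R^-1.
have rk0 k : 0 <= rk k by rewrite subr_ge0 invf_le1 ?ltr0n // ler1n.
have rk1 k : rk k < 1 by rewrite ltrBlDr ltrDl invr_gt0 ltr0n.
have [s si hs] := @extract_subsequence
  (fun k n => forall z, normc z <= rk k -> normc (f n z - g z) <= k.+1%:R^-1)
  (fun k N => unif (rk k) (k.+1%:R^-1) N (rk0 k) (rk1 k)
    (ltac:(by rewrite invr_gt0 ltr0n))).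
exists s, g; split => // rho e r0 r1 e0.
set t := Num.min e (1 - rho); have t0 : 0 < t by rewrite lt_min e0 subr_gt0.
have [t1 t2] : t <= e /\ t <= 1 - rho by rewrite /t !ge_min !lexx orbT.
exists (Num.bound t^-1) => k Nk z zr.
have kt := inv_nat_le t0 Nk.
apply: le_trans (hs k z _) _; last exact: le_trans t1.
by apply: le_trans zr _; rewrite /rk lerBrDl -lerBrDr; exact: le_trans kt t2.
Qed.

(** Points [zs n] of the closed disc of radius [rho] whose images tend to the
    circle would cluster at a point whose image is on the circle. *)
Lemma self_map_compact (phi : C -> C) rho : self_map phi -> 0 <= rho ->
  rho < 1 ->
  exists2 rho' : R, 0 <= rho' < 1 &
    forall z, normc z <= rho -> normc (phi z) <= rho'.
Proof.
move=> [ph pD] r0 r1; apply: contrapT => no.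
have /choice[zs hzs] : forall n : nat, exists z, normc z <= rho /\
    1 - n.+1%:R^-1 < normc (phi z).
  move=> n; apply: contrapT => no'; apply: no; exists (1 - n.+1%:R^-1).
    by rewrite subr_ge0 invf_le1 ?ltr0n // ler1n /= ltrBlDr ltrDl invr_gt0
      ltr0n.
  by move=> z zr; rewrite leNgt; apply/negP => h; apply: no'; exists z.
have [|p hp] := @bounded_cluster R bool
  (fun n b => if b then Re (zs n) else Im (zs n))
    (fun=> rho) _.
  by move=> n [|]; have [h _] := hzs n; apply: le_trans h;
    [exact: normc_Re|exact: normc_Im].
pose z : C := (p true +i* p false)%C.
have cl e N : 0 < e -> exists2 n, (N <= n)%N & normc (zs n - z) <= e.
  move=> e0; have [n Nn hn] :=
    hp [:: true; false] (e / 2) N ltac:(by rewrite divr_gt0).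
  exists n => //; apply: le_trans (normc_le_ReIm _) _; rewrite ReB ImB /=.
  by move: (hn true isT) (hn false isT); lra.
have zr : normc z <= rho.
  apply/ler_addgt0Pr => e e0; have [n _ hn] := cl e 0%N e0; have [h _] := hzs n.
  have -> : z = zs n - (zs n - z) by ring.
  exact: normc_sub_le.
have zD : disc z by exact: le_lt_trans zr r1.
have pz : normc (phi z) < 1 by exact: pD.
set e := (1 - normc (phi z)) / 3;
  have e0 : 0 < e by rewrite divr_gt0 // subr_gt0.
have /derivableP_cdiff[d /cdiff_ccont/(_ e e0)[r rr0 hr]] := ph z zD.
have [n Nn hn] := cl (r / 2) (Num.bound e^-1) ltac:(by rewrite divr_gt0).
have [_ h] := hzs n.
have ne := inv_nat_le e0 Nn.
have zn : normc (zs n - z) < r by lra.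
have h1 := hr _ zn.
have h2 := normc_triangle (phi (zs n) - phi z) (phi z); rewrite subrK in h2.
have h3 : 1 - e < normc (phi (zs n)) by apply: le_lt_trans h; rewrite lerB.
move: h1 h2 h3; rewrite /e; move: pz;
  move: (normc (phi z)) (normc (phi (zs n))) (normc _); move=> a b c. lra.
Qed.

End Montel.

(** * The Luxemburg norm as a weighted supremum norm *)

Section Elementary.
Variable R : realType.

Lemma bernoulli_sub (y : R) n : 0 <= y -> y <= 1 ->
  1 - n%:R * y <= (1 - y) ^+ n.
Proof.
move=> y0 y1; elim: n => [|n IH]; first by rewrite mul0r subr0 expr0.
rewrite exprS; apply: le_trans (_ : (1 - y) * (1 - n%:R * y) <= _); last first.
  by rewrite ler_wpM2l // subr_ge0.
rewrite -natr1; have n0 : 0 <= n%:R * y by rewrite mulr_ge0.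
by move: n0; move: (n%:R) => m m0; nra.
Qed.

Lemma bernoulli_add (y : R) n : 0 <= y -> 1 + n%:R * y <= (1 + y) ^+ n.
Proof.
move=> y0; elim: n => [|n IH]; first by rewrite mul0r addr0 expr0.
rewrite exprS; apply: le_trans (_ : (1 + y) * (1 + n%:R * y) <= _); last first.
  by rewrite ler_wpM2l // addr_ge0.
rewrite -natr1; have n0 : 0 <= n%:R * y by rewrite mulr_ge0.
by move: n0; move: (n%:R) => m m0; nra.
Qed.

(** Quadratic decay of [(1 - s)^n] in [n s]; it makes lacunary sums of
    normalized monomials converge. *)
Lemma exp_decay (s : R) n : 0 <= s -> s <= 1 ->
  (1 - s) ^+ n * (1 + n%:R * s / 2) ^+ 2 <= 1.
Proof.
move=> s0 s1; have b := @bernoulli_add (s / 2) n (divr_ge0 s0 (ler0n _ _)).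
have q0 : 0 <= 1 + n%:R * s / 2 by rewrite addr_ge0 // divr_ge0 // mulr_ge0.
apply: le_trans (_ : (1 - s) ^+ n * ((1 + s / 2) ^+ n) ^+ 2 <= _).
  rewrite ler_wpM2l ?exprn_ge0 ?subr_ge0 // lerXn2r ?nnegrE //.
    by rewrite exprn_ge0 // addr_ge0 // divr_ge0.
  by rewrite -mulrA.
rewrite -exprM mulnC exprM -exprMn exprn_ile1 //.
  by rewrite mulr_ge0 ?sqr_ge0 // subr_ge0.
by have : 0 <= s ^+ 2 by [exact: sqr_ge0]; nra.
Qed.

(** This lemma and the next reduce the comparison of extended real quantities to
    real numbers on one side of [G], which covers infinite values. *)
Lemma lee_scaled (F G : \bar R) (c : R) : 0 < c -> (0 <= G)%E ->
  (forall l : R, 0 < l -> (G < l%:E)%E -> (F <= (c * l)%:E)%E) ->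
    (F <= c%:E * G)%E.
Proof.
move=> c0; case: G => [g| |] // g0 h; last by rewrite gt0_muley ?lte_fin ?leey.
apply/lee_addgt0Pr => e e0; have ec : 0 < e / c by rewrite divr_gt0.
rewrite lee_fin in g0; have l0 : 0 < g + e / c by rewrite ltr_wpDl.
apply: le_trans (h _ l0 _) _; first by rewrite lte_fin ltrDl.
rewrite -EFinM -EFinD lee_fin; apply: le_of_eq; field.
by rewrite gt_eqF.
Qed.

Lemma scaled_lee (F G : \bar R) (c : R) : 0 < c -> (0 <= F)%E ->
  (forall b : R, 0 < b -> (b%:E < G)%E -> ((c * b)%:E <= F)%E) ->
    (c%:E * G <= F)%E.
Proof.
move=> c0 F0; case: G => [g| |] h.
- apply/lee_addgt0Pr => e e0; have ec : 0 < e / c by rewrite divr_gt0.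
  have [b0|b0] := ltP 0 (g - e / c).
    have := h _ b0; rewrite lte_fin gtrBl => /(_ ec) hb.
    have -> : (c%:E * g%:E = (c * (g - e / c))%:E + e%:E)%E.
      by rewrite -EFinM -EFinD; congr _%:E; field; rewrite gt_eqF.
    by rewrite leeD2r.
  apply: le_trans (_ : e%:E <= _)%E; last by rewrite leeDr.
  rewrite -EFinM lee_fin mulrC -ler_pdivlMr //; lra.
- case: F F0 h => [f| |] // F0 h; last by rewrite leey.
  rewrite lee_fin in F0; have f1 : 0 < (f + 1) / c by rewrite divr_gt0 //
    ltr_wpDl.
  have := h _ f1 (ltry _); rewrite lee_fin mulrC divfK ?gt_eqF //.
  by rewrite gerDl ler10.
- by rewrite gt0_muleNy ?lte_fin // leNye.
Qed.

End Elementary.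

Section LuxNorm.
Variables (R : realType) (alpha : R) (psi : R -> R).
Hypotheses (alpha_gt : -1 < alpha) (psi_orlicz : orlicz psi).
Hypothesis psi_Delta2 : Delta2_upper psi.
Local Notation C := R[i].
Local Notation X := (psi_inv psi).
Local Notation growth := (critical_growth psi).
Local Notation lux := (lux_norm alpha psi).
Implicit Types f F : C -> C.

Lemma lux_norm_ge0 f : (0 <= lux f)%E.
Proof. by apply: le_ereal_inf_tmp => _ [c [c0 _] <-]; rewrite lee_fin ltW. Qed.

Lemma lux_norm_upper : exists2 K : R, 0 < K &
  forall f b, holomorphic_disc f -> 0 < b ->
  (forall z, disc z -> normc (f z) <= b * growth z) ->
  (lux f <= (K * b)%:E)%E /\ bergman_orlicz alpha psi f.
Proof.
have [K K0 hK] := modular_upper alpha_gt psi_orlicz psi_Delta2.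
exists K => // f b fh b0 fb; have h := hK f b fh b0 fb.
have Kb : 0 < K * b by rewrite mulr_gt0.
split; first by apply: ereal_inf_lbound; exists (K * b).
split=> //; exists (K * b) => //; apply: le_lt_trans h _; exact: ltry.
Qed.

Lemma lux_norm_lower : exists2 K : R, 0 < K &
  forall f (l : R), holomorphic_disc f ->
  0 <= l -> (lux f <= l%:E)%E -> forall z,
    disc z -> normc (f z) <= K * l * growth z.
Proof.
have [K K0 hK] := point_evaluation alpha_gt psi_orlicz psi_Delta2.
exists K => // f l fh l0 fl z zD; have g0 := growth_gt0 psi_orlicz zD.
apply/ler_addgt0Pr => e e0.
have Kg : 0 < K * growth z by rewrite mulr_gt0.
have e1 : 0 < e / (K * growth z) by rewrite divr_gt0.
have : (lux f < (l + e / (K * growth z))%:E)%E.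
  by apply: le_lt_trans fl _; rewrite lte_fin ltrDl.
move=> /ereal_inf_lt[_ [c [c0 hc] <-]]; rewrite lte_fin => cl.
apply: le_trans (hK f c 1 fh c0 (lexx _) hc z zD) _; rewrite mulr1.
apply: le_trans (_ : K * (l + e / (K * growth z)) * growth z <= _).
  by rewrite ler_wpM2r ?(ltW g0) // ler_wpM2l ?(ltW K0) //; exact: ltW.
apply: le_of_eq; field.
by rewrite !gt_eqF.
Qed.

(** Elements of the space satisfy the growth bound even when nothing is known of
    the value of their norm: a finite modular is enough. *)
Lemma bergman_growth f : bergman_orlicz alpha psi f ->
  exists2 b : R, 0 < b & forall z, disc z -> normc (f z) <= b * growth z.
Proof.
move=> [fh [c c0 fc]].
have [K K0 hK] := point_evaluation alpha_gt psi_orlicz psi_Delta2.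
have m0 : (0 <= modular alpha psi f c)%E.
  apply: integral_ge0 => p _; rewrite lee_fin.
  exact: (modular_integrand_ge0 alpha_gt psi_orlicz).
set M := 1 + fine (modular alpha psi f c).
have M1 : 1 <= M by rewrite lerDl fine_ge0.
exists (K * M * c); first by rewrite !mulr_gt0 // (lt_le_trans _ M1).
apply: hK => //; rewrite -[leLHS]fineK ?ge0_fin_numE // lee_fin lerDr.
exact: ler01.
Qed.

Lemma growth_locally_bounded (K : R) : 0 < K ->
  locally_bounded (fun z => K * growth z).
Proof.
move=> K0 rho r0 r1; have s0 : 0 < 1 - rho by rewrite subr_gt0.
exists (K * X (1 / (1 - rho))).
  by rewrite mulr_gt0 // psi_inv_gt0 // divr_gt0.
move=> z zr; rewrite ler_wpM2l ?(ltW K0) //; apply: le_psi_inv => //.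
  by rewrite divr_ge0 // subr_ge0; apply: le_trans zr _; exact: ltW.
rewrite !div1r lef_pV2 ?posrE //; first by rewrite lerB.
by rewrite subr_gt0; exact: le_lt_trans zr r1.
Qed.

Lemma growth_mono z w : disc w -> normc z <= normc w -> growth z <= growth w.
Proof.
move=> wD zw; have w0 : 0 < 1 - normc w by rewrite subr_gt0; exact: wD.
have z0 : 0 < 1 - normc z by apply: lt_le_trans w0 _; rewrite lerB.
apply: le_psi_inv => //; first by rewrite divr_ge0 // ltW.
by rewrite !div1r lef_pV2 ?posrE // lerB.
Qed.

(** If [n * (1 - |z|) <= 1], then [X n] is below [growth z] already.
    Otherwise it exceeds [growth z] at most by the factor [n * (1 - |z|)],
    which the decay of [|z| ^ n] compensates. *)
Lemma monomial_growth (z : C) n : disc z ->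
  normc z ^+ n * X n%:R <= growth z.
Proof.
move=> zD; have /andP[s0 s1] := disc_gap zD; set s := 1 - normc z in s0 s1.
have zs : normc z = 1 - s by rewrite /s; ring.
have g0 := growth_gt0 psi_orlicz zD.
have [ns|ns] := leP (n%:R * s) 1.
  have h : n%:R <= 1 / s by rewrite ler_pdivlMr.
  apply: le_trans (_ : 1 * X n%:R <= _).
    rewrite ler_wpM2r ?psi_inv_ge0 // exprn_ile1 ?normc_ge0 //; exact: ltW.
  by rewrite mul1r; apply: le_psi_inv.
have h : X n%:R <= n%:R * s * growth z.
  have -> : n%:R = n%:R * s * (1 / s) by field; rewrite gt_eqF.
  rewrite [X in _ <= X * _](_ : _ = n%:R * s); last by field; rewrite gt_eqF.
  by apply: psi_inv_scale => //; [exact: ltW|rewrite divr_ge0 // ltW].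
have e := @exp_decay R s n (ltW s0) s1; rewrite zs.
have p0 : 0 <= (1 - s) ^+ n by rewrite exprn_ge0 // -zs normc_ge0.
apply: le_trans (_ : (1 - s) ^+ n * (n%:R * s * growth z) <= _).
  by rewrite ler_wpM2l.
rewrite mulrA ler_piMl ?(ltW g0) //; apply: le_trans e.
rewrite ler_wpM2l // ; move: ns; move: (n%:R * s) => m m1; nra.
Qed.

Lemma holomorphic_expn (phi : C -> C) n : holomorphic_disc phi ->
  holomorphic_disc (fun z => phi z ^+ n).
Proof.
move=> ph z zD; have d := ph z zD.
have -> : (fun z => phi z ^+ n) = ((phi : C^o -> C^o) ^+ n).
  apply/funext => w; elim: n => [|n IH]; first by rewrite !expr0.
  by rewrite !exprS IH.
by apply: derivableX.
Qed.

Lemma holomorphic_id : holomorphic_disc (id : C -> C).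
Proof. by move=> z zD; exact: derivable_id. Qed.

Lemma holomorphic_sub f g : holomorphic_disc f -> holomorphic_disc g ->
  holomorphic_disc (fun z => f z - g z).
Proof. by move=> fh gh z zD; apply: (derivableB (fh z zD) (gh z zD)). Qed.

Lemma holomorphic_lin (a : C) f g : holomorphic_disc f -> holomorphic_disc g ->
  holomorphic_disc (fun z => a * f z + g z).
Proof.
move=> fh gh z zD.
have dc : derivable (cst a : C^o -> C^o) z 1 by exact: derivable_cst.
have d1 := @derivableM C C^o _ _ z 1 dc (fh z zD).
exact: (derivableD d1 (gh z zD)).
Qed.

Lemma holomorphic_cst (a : C) : holomorphic_disc (fun=> a).
Proof. by move=> z zD; exact: derivable_cst. Qed.

Lemma holomorphic_monomial (a : C) n : holomorphic_disc
  (fun z : C => a * z ^+ n).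
Proof.
have h : holomorphic_disc (fun z : C => a * z ^+ n + 0).
  apply: holomorphic_lin; last exact: holomorphic_cst.
  by apply: (@holomorphic_expn id); exact: holomorphic_id.
by congr holomorphic_disc: h; apply/funext => z; rewrite addr0.
Qed.

Lemma holomorphic_comp f phi : holomorphic_disc f -> holomorphic_disc phi ->
  (forall z, disc z -> disc (phi z)) -> holomorphic_disc (f \o phi).
Proof.
move=> fh ph pD z zD; apply/derivableP_cdiff.
have /derivableP_cdiff[d hd] := ph z zD.
have /derivableP_cdiff[d' hd'] := fh _ (pD z zD).
by exists (d' * d); exact: cdiff_comp.
Qed.

End LuxNorm.

(** * The limit over points whose image tends to the circle *)

Section AngularQuantity.
Variables (R : realType) (psi : R -> R).
Hypothesis psi_orlicz : orlicz psi.
Local Notation C := R[i].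
Local Notation X := (psi_inv psi).
Local Notation growth := (critical_growth psi).
Variable phi : C -> C.
Hypothesis phi_self : self_map phi.

Let half_lt1 : (2^-1 : R) < 1 /\ (0 : R) < 2^-1.
Proof. by split; lra. Qed.

Let radius_near_one (e : R) : 0 < e -> exists r : R,
  [/\ r < 1, `|1 - r| < e & 0 < r].
Proof.
move=> e0; exists (Num.max (1 - e / 2) 2^-1).
have [h1 h0] := half_lt1.
rewrite gt_max lt_max h1 h0 orbT andbT; split => //; first lra.
rewrite ltr_norml /Num.max; case: ifP => h; lra.
Qed.

(* The nonincreasing function of [r] whose limit is [lim_sup_phi]. *)
Let S (r : R) : \bar R :=
  sup0 [set psi_ratio psi phi z | z in [set z | disc z /\ r < normc (phi z)]].

Let ratioE z : psi_ratio psi phi z = (growth (phi z) / growth z)%:E.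
Proof. by []. Qed.

Let ratio_ge0 z : disc z -> (0 <= psi_ratio psi phi z)%E.
Proof.
move=> zD; rewrite ratioE lee_fin divr_ge0 ?(ltW (growth_gt0 psi_orlicz _)) //.
by case: phi_self => _; exact.
Qed.

Let S_ge0 r : (0 <= S r)%E.
Proof.
rewrite /S /sup0; case: asboolP => // /eqP/set0P[_ [z [zD h] _]].
apply: le_trans (ratio_ge0 zD) _; apply: ereal_sup_ubound; by exists z.
Qed.

Let S_ub r z : disc z -> r < normc (phi z) -> (psi_ratio psi phi z <= S r)%E.
Proof.
move=> zD zr; rewrite /S /sup0; case: asboolP => [h|_].
  have : (set0 : set (\bar R)) (psi_ratio psi phi z) by rewrite -h; exists z.
  by [].
by apply: ereal_sup_ubound; exists z.
Qed.

Let S_le r (l : \bar R) : (0 <= l)%E ->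
  (forall z, disc z -> r < normc (phi z) -> (psi_ratio psi phi z <= l)%E) ->
    (S r <= l)%E.
Proof.
move=> l0 h; rewrite /S /sup0; case: asboolP => // _.
by apply: ge_ereal_sup => _ [z [zD zr] <-]; exact: h.
Qed.

Let S_mono r s : r <= s -> (S s <= S r)%E.
Proof.
by move=> rs; apply: S_le => // z zD zs; apply: S_ub => //;
  exact: le_lt_trans zs.
Qed.

Let B := ereal_inf [set S r | r in [set r : R | 0 < r < 1]].

(* A monotone function has its infimum as limit, and so infinite values have
   to be distinguished. *)
Let lim_sup_phiE : lim_sup_phi psi phi = B.
Proof.
have B0 : (0 <= B)%E by apply: le_ereal_inf_tmp => _ [r _ <-].
have lb r : r < 1 -> (B <= S r)%E.
  move=> r1; set s := Num.max r 2^-1.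
  have [h1 h0] := half_lt1.
  apply: le_trans (_ : S s <= _)%E; last by apply: S_mono; rewrite le_max lexx.
  apply: ereal_inf_lbound; exists s => //=.
  by rewrite gt_max r1 h1 lt_max h0 orbT.
apply/cvg_lim => //; rewrite -/S.
have [Bf|Bn] := boolP (B \is a fin_num); last first.
  have By : B = +oo%E by apply/eqP; rewrite -leye_eq leNgt; apply: contra Bn;
    rewrite -ge0_fin_numE.
  rewrite By; apply/cvgeyPge => A; near=> r; have r1 : r < 1 by near: r;
    exact: nbhs_left_lt.
  by apply: le_trans (lb r r1); rewrite By leey.
have [r1 [/= /andP[r0 r11] hr1]] : exists r, 0 < r < 1 /\ (S r < B + 1%:E)%E.
  by have [_ [r hr <-] h] := lb_ereal_inf_adherent ltr01 Bf; exists r.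
have fin r : r1 <= r -> r < 1 -> S r \is a fin_num.
  move=> rr rl; rewrite ge0_fin_numE //; apply: le_lt_trans (S_mono rr) _.
  by apply: lt_le_trans hr1 _; rewrite leey.
rewrite -(fineK Bf); apply/fine_cvgP; split.
  near=> r; apply: fin; last by near: r; exact: nbhs_left_lt.
  by apply/ltW; near: r; exact: nbhs_left_gt.
apply/cvgrPdist_le => e e0.
have [_ [r2 /= /andP[r20 r21] <-] hr2] := lb_ereal_inf_adherent e0 Bf.
near=> r.
have rl : r < 1 by near: r; exact: nbhs_left_lt.
have rr1 : r1 <= r by apply/ltW; near: r; exact: nbhs_left_gt.
have rr2 : r2 <= r by apply/ltW; near: r; exact: nbhs_left_gt.
have h1 := lb r rl; have h2 := le_lt_trans (S_mono rr2) hr2.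
have fr := fin r rr1 rl.
have {}h1 : fine B <= fine (S r) by rewrite -lee_fin !fineK.
have {}h2 : fine (S r) < fine B + e by rewrite -lte_fin EFinD !fineK.
by rewrite /= distrC ger0_norm ?subr_ge0 //; lra.
Unshelve. all: by end_near. Qed.

Lemma lim_sup_phi_ge0 : (0 <= lim_sup_phi psi phi)%E.
Proof. by rewrite lim_sup_phiE; apply: le_ereal_inf_tmp => _ [r _ <-]. Qed.

Lemma lim_sup_phi_upper (l : R) : (lim_sup_phi psi phi < l%:E)%E ->
  exists2 r, 0 < r < 1 & forall z, disc z -> r < normc (phi z) ->
    growth (phi z) <= l * growth z.
Proof.
rewrite lim_sup_phiE => /ereal_inf_lt[_ [r r01 <-] h]; exists r => // z zD zr.
have := le_trans (S_ub zD zr) (ltW h).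
by rewrite ratioE lee_fin ler_pdivrMr // growth_gt0.
Qed.

Lemma lim_sup_phi_lower (b : R) : 0 < b -> (b%:E < lim_sup_phi psi phi)%E ->
  forall r, r < 1 -> exists z, [/\ disc z, r < normc (phi z) &
    b * growth z <= growth (phi z)].
Proof.
move=> b0 hb r r1; apply: contrapT => no.
suff : (lim_sup_phi psi phi <= b%:E)%E by rewrite leNgt hb.
set s := Num.max r 2^-1.
have [h1 h0] := half_lt1.
rewrite lim_sup_phiE; apply: ge_ereal_inf; exists (S s).
  by exists s => //=; rewrite gt_max r1 h1 lt_max h0 orbT.
apply: S_le => [|z zD zs]; first by rewrite lee_fin ltW.
rewrite ratioE lee_fin leNgt; apply/negP => h; apply: no; exists z; split=> //.
  by apply: le_lt_trans zs; rewrite le_max lexx.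
by apply: ltW; rewrite -ltr_pdivlMr // growth_gt0.
Qed.

Lemma limsup_circle_ge0 : (0 <= limsup_circle (psi_ratio psi phi))%E.
Proof.
apply: le_ereal_inf_tmp => _ [V [e /= e0 hV] <-].
have [r [r1 re r0]] := radius_near_one e0.
have VD := hV r re r1.
set z : C := ((1 + r) / 2)%:C%C.
have zn : normc z = (1 + r) / 2 by rewrite normc_real ger0_norm //; lra.
have zD : disc z by change (normc z < 1); rewrite zn; lra.
apply: le_trans (ratio_ge0 zD) _; apply: ereal_sup_ubound; exists z => //.
by apply: VD; split=> //; rewrite zn; lra.
Qed.

Lemma limsup_circle_upper (l : R) :
  (limsup_circle (psi_ratio psi phi) < l%:E)%E ->
  exists2 r, 0 < r < 1 & forall z, disc z -> r < normc z ->
    growth (phi z) <= l * growth z.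
Proof.
move=> /ereal_inf_lt[_ [V [e /= e0 hV] <-] hl].
have [r [r1 re r0]] := radius_near_one e0.
exists r => [|z zD zr]; first by rewrite r0.
have : (psi_ratio psi phi z <= l%:E)%E.
  apply: le_trans (ltW hl); apply: ereal_sup_ubound; exists z => //.
  by apply: (hV r re r1); split.
by rewrite ratioE lee_fin ler_pdivrMr // growth_gt0.
Qed.

Lemma limsup_circle_le (l r : R) : 0 < r < 1 ->
  (forall z, disc z -> r < normc z -> growth (phi z) <= l * growth z) ->
  (limsup_circle (psi_ratio psi phi) <= l%:E)%E.
Proof.
move=> /andP[r0 r1] h; apply: ge_ereal_inf.
exists (ereal_sup (psi_ratio psi phi @` [set z | disc z /\ r < normc z])).
  exists [set z | disc z /\ r < normc z] => //.
  rewrite /to_circle /=; near=> s => z [zD zs]; split=> //; apply: lt_trans zs.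
  by near: s; exact: nbhs_left_gt.
apply: ge_ereal_sup => _ [z [zD zr] <-].
by rewrite ratioE lee_fin ler_pdivrMr ?growth_gt0 //; exact: h.
Unshelve. all: by end_near. Qed.

(** By [self_map_compact], [|phi z|] close to one forces [|z|] close to one. In
    the other direction, where [|z|] tends to one but [|phi z| <= r], the ratio
    tends to zero because its denominator is unbounded. *)
Lemma limsup_circle_eq0 :
  limsup_circle (psi_ratio psi phi) = 0%E <-> lim_sup_phi psi phi = 0%E.
Proof.
have [ph pD] := phi_self.
split=> h0.
- apply/eqP; rewrite eq_le lim_sup_phi_ge0 andbT; apply/lee_addgt0Pr => e e0;
  rewrite add0e.
  have [|r /andP[r0 r1] hr] := @limsup_circle_upper e;
    first by rewrite h0 lte_fin.
  have [rho /andP[p0 p1] hrho] := self_map_compact phi_self (ltW r0) r1.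
  set s := Num.max rho 2^-1.
  have [h1 h2] := half_lt1.
  rewrite lim_sup_phiE; apply: ge_ereal_inf; exists (S s).
    by exists s => //=; rewrite gt_max p1 h1 lt_max h2 orbT.
  apply: S_le => [|z zD zs]; first by rewrite lee_fin ltW.
  rewrite ratioE lee_fin ler_pdivrMr ?growth_gt0 //; apply: hr => //.
  rewrite ltNge; apply/negP => zr; have := hrho z zr.
  by apply/negP; rewrite -ltNge; apply: le_lt_trans zs; rewrite le_max lexx.
- apply/eqP; rewrite eq_le limsup_circle_ge0 andbT; apply/lee_addgt0Pr => e e0;
  rewrite add0e.
  have [|r /andP[r0 r1] hr] := @lim_sup_phi_upper e;
    first by rewrite h0 lte_fin.
  set G := X (1 / (1 - r)).
  have sr : 0 < 1 - r by rewrite subr_gt0.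
  have G0 : 0 <= G by apply: psi_inv_ge0 => //; rewrite divr_ge0 // ltW.
  (* As soon as [1 / (1 - |z|)] exceeds [T], [growth z] exceeds [G / e]. *)
  set T := psi (G / e) + 2.
  have T2 : 2 <= T by rewrite lerDr psi_ge0 // divr_ge0 // ltW.
  have T0 : 0 < T by apply: lt_le_trans T2.
  have Ti : T^-1 <= 2^-1 by rewrite lef_pV2 // posrE.
  have Ti0 : 0 < T^-1 by rewrite invr_gt0.
  have [h2 _] := half_lt1.
  apply: (@limsup_circle_le _ (1 - T^-1)); first by apply/andP; split; lra.
  move=> z zD zT; have gz := growth_gt0 psi_orlicz zD.
  have [pz|pz] := leP (normc (phi z)) r; last exact: hr.
  apply: le_trans (_ : G <= _).
    apply: le_psi_inv => //; first by rewrite divr_ge0 // subr_ge0;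
      apply/ltW/pD.
    rewrite !div1r lef_pV2 ?posrE ?subr_gt0 //; first by rewrite lerB.
    exact: le_lt_trans pz r1.
  rewrite mulrC -ler_pdivrMr //.
  have /andP[z0 z1] := disc_gap zD.
  rewrite -[leLHS](psiK psi_orlicz) ?divr_ge0 // ?(ltW e0) //.
  apply: le_psi_inv => //; first by apply: psi_ge0 => //;
    rewrite divr_ge0 // ltW.
  rewrite div1r; apply: le_trans (_ : T <= _); first by rewrite lerDl.
  by rewrite -[T]invrK lef_pV2 ?posrE //; lra.
Qed.

End AngularQuantity.

(** * Norms of the powers of a self-map *)

Section PowerRatios.
Variables (R : realType) (alpha : R) (psi : R -> R).
Hypotheses (alpha_gt : -1 < alpha) (psi_orlicz : orlicz psi).
Hypothesis psi_Delta2 : Delta2_upper psi.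
Local Notation C := R[i].
Local Notation X := (psi_inv psi).
Local Notation growth := (critical_growth psi).
Local Notation lux := (lux_norm alpha psi).

Lemma psi_inv_nat_gt0 n : (0 < n)%N -> 0 < X n%:R.
Proof. by move=> n0; apply: psi_inv_gt0 => //; rewrite ltr0n. Qed.

(** An exponent of order [1 / (1 - |w|)] attains the bound of
    [monomial_growth] up to a constant. *)
Lemma monomial_growth_sharp (w : C) : disc w -> 3 / 4 <= normc w ->
  exists2 n, (0 < n)%N /\ 1 / (4 * (1 - normc w)) <= n%:R &
    growth w <= 8 * (normc w ^+ n * X n%:R).
Proof.
move=> wD w34; have /andP[t0 t1] := disc_gap wD;
  set t := 1 - normc w in t0 t1 *.
have wt : normc w = 1 - t by rewrite /t; ring.
have t4 : t <= 1 / 4 by move: w34; rewrite wt; lra.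
(* [n] is the integer part of [1 / (2 t)]: by the Bernoulli inequality [|w| ^ n]
   is at least [1 / 2]. *)
have y0 : 0 <= 1 / (2 * t) by rewrite divr_ge0 // mulr_ge0 // ltW.
have /andP[n1 n2] := truncn_itv y0; set n := Num.truncn _ in n1 n2.
have e2 : 1 / (2 * t) = 2 * (1 / (4 * t)) by field; rewrite gt_eqF.
have q1 : 1 <= 1 / (4 * t) by rewrite ler_pdivlMr ?mulr_gt0 //; lra.
have n3 : 1 / (4 * t) <= n%:R.
  by move: n1 n2 q1; rewrite e2 -[n.+1%:R]natr1;
    move: (1 / (4 * t)) (n%:R) => a b; lra.
have nt : n%:R * t <= 1 / 2.
  move: n1; rewrite ler_pdivlMr ?mulr_gt0 // mulrCA.
  by move: (n%:R * t) => a; lra.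
have n0 : (0 < n)%N by rewrite -(ltr0n R); apply: lt_le_trans n3;
  exact: lt_le_trans q1.
have half : 1 / 2 <= normc w ^+ n.
  by rewrite wt; apply: le_trans (bernoulli_sub n (ltW t0) t1); lra.
exists n => //.
have X0 : 0 <= X n%:R by apply/ltW/psi_inv_nat_gt0.
apply: le_trans (_ : 4 * X n%:R <= _); last first.
  have : 0 <= (normc w ^+ n - 1 / 2) * X n%:R by rewrite mulr_ge0 // subr_ge0.
  by lra.
apply: le_trans (_ : X (4 * n%:R) <= _); last by apply: psi_inv_scale => //;
  lra.
apply: le_psi_inv => //; first by rewrite divr_ge0 // ltW.
have -> : 1 / t = 4 * (1 / (4 * t)) by field; rewrite gt_eqF.
by rewrite ler_pM2l.
Qed.

(** By the definition of the limit there are points [z] with [|phi z|] as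
    close to one as desired at which the ratio is at least [b]; the exponent
    is the one supplied by [monomial_growth_sharp] at [phi z]. *)
Lemma exponents_unbounded (phi : C -> C) (b : R) N : self_map phi -> 0 < b ->
  (b%:E < lim_sup_phi psi phi)%E -> exists n z,
    [/\ (N <= n)%N, (0 < n)%N, disc z &
    b * growth z <= 8 * (normc (phi z) ^+ n * X n%:R)].
Proof.
move=> ps b0 hb; have [ph pD] := ps.
set r : R := 1 - (4 * (N%:R + 1))^-1.
have N0 : 0 < (4 * (N%:R + 1))^-1 :> R by rewrite invr_gt0 mulr_gt0 // ltr_wpDl.
have N1 : (4 * (N%:R + 1))^-1 <= 1 / 4 :> R.
  by rewrite -div1r ler_pdivrMr ?mulr_gt0 ?ltr_wpDl //; have := ler0n R N; lra.
have r1 : r < 1 by rewrite gtrBl.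
have [z [zD zr hz]] := lim_sup_phi_lower psi_orlicz ps b0 hb r1.
have pz : disc (phi z) by exact: pD.
have [|n [n0 nn] hn] := monomial_growth_sharp pz; first by move: zr;
  rewrite /r; lra.
have /andP[t0 t1] := disc_gap pz.
have Nn : (N <= n)%N.
  rewrite -(ler_nat R); apply: le_trans nn; rewrite ler_pdivlMr ?mulr_gt0 //.
  have h : (1 - normc (phi z)) <= (4 * (N%:R + 1))^-1 by move: zr; rewrite /r;
    lra.
  apply: le_trans (_ : (N%:R + 1) * (4 * (4 * (N%:R + 1))^-1) <= _).
    apply: ler_pM => //; [by rewrite mulr_ge0 // ltW|by rewrite lerDl|].
    by rewrite ler_pM2l.
  apply: le_of_eq; field.
  by rewrite gt_eqF // ltr_wpDl.
by exists n, z; split=> //; exact: le_trans hz hn.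
Qed.

(** The upper bound is [monomial_growth]; for the lower one, [z ^ n] is
    evaluated at distance [1 / (2 n)] from the circle. *)
Lemma lux_norm_monomial : exists2 K : R, 0 < K & forall n, (0 < n)%N ->
  [/\ lux (fun z => z ^+ n) \is a fin_num,
      (K * X n%:R)^-1 <= fine (lux (fun z => z ^+ n)) &
      fine (lux (fun z => z ^+ n)) <= K / X n%:R].
Proof.
have [K1 K10 hK1] := lux_norm_lower alpha_gt psi_orlicz psi_Delta2.
have [K2 K20 hK2] := lux_norm_upper alpha_gt psi_orlicz psi_Delta2.
exists (4 * K1 + K2) => [|n n0]; first by rewrite addr_gt0 // mulr_gt0.
have X0 := psi_inv_nat_gt0 n0.
have zh : holomorphic_disc (fun z : C => z ^+ n).
  by apply: (@holomorphic_expn _ id); exact: holomorphic_id.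
have [up _] : (lux (fun z => (z ^+ n)%R) <= (K2 * (X n%:R)^-1)%:E)%E /\
    bergman_orlicz alpha psi (fun z => z ^+ n).
  apply: hK2 => //; first by rewrite invr_gt0.
  move=> z zD; rewrite normcX mulrC ler_pdivlMr //; exact: monomial_growth.
have l0 := lux_norm_ge0 alpha psi (fun z => z ^+ n).
have lf : lux (fun z => z ^+ n) \is a fin_num.
  by rewrite ge0_fin_numE //; apply: le_lt_trans up (ltry _).
split=> //; last first.
  rewrite -lee_fin fineK //; apply: le_trans up _; rewrite lee_fin.
  by rewrite ler_wpM2r ?invr_ge0 ?(ltW X0) // lerDr mulr_ge0 // ltW.
set l := fine _; have l0' : 0 <= l by exact: fine_ge0.
have lE : (lux (fun z => (z ^+ n)%R) <= l%:E)%E by rewrite fineK.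
have n2 : 0 < 2 * n%:R :> R by rewrite mulr_gt0 // ltr0n.
have n2' : (2 * n%:R : R)^-1 <= 1.
  by rewrite invf_le1 // -natrM ler1n muln_gt0.
have n2'' : 0 < (2 * n%:R : R)^-1 by rewrite invr_gt0.
pose z : C := (1 - (2 * n%:R)^-1)%:C%C.
have zn : normc z = 1 - (2 * n%:R)^-1 by rewrite normc_real ger0_norm //
  subr_ge0.
have zD : disc z by change (normc z < 1); rewrite zn gtrBl.
have := hK1 _ l zh l0' lE z zD; rewrite normcX zn.
have gz : growth z <= 2 * X n%:R.
  rewrite /critical_growth zn opprB addrC subrK div1r invrK.
  by apply: psi_inv_scale => //; rewrite ler1n.
have half : 1 / 2 <= (1 - (2 * n%:R)^-1) ^+ n :> R.
  apply: le_trans (bernoulli_sub n (ltW n2'') n2').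
  have -> : n%:R * (2 * n%:R)^-1 = 1 / 2 :> R by field; rewrite pnatr_eq0 -lt0n.
  by lra.
move=> h; have h1 : 1 / 2 <= K1 * l * (2 * X n%:R).
  apply: le_trans half (le_trans h _); apply: ler_wpM2l => //.
  by rewrite mulr_ge0 // ltW.
have K0 : 0 < 4 * K1 + K2 by rewrite addr_gt0 // mulr_gt0.
have h2 : 1 <= 4 * K1 * X n%:R * l by move: h1; lra.
rewrite -div1r ler_pdivrMr ?mulr_gt0 //; apply: le_trans h2 _.
have : 0 <= K2 * X n%:R * l by rewrite !mulr_ge0 // ltW.
by lra.
Qed.

Section SelfMap.
Variable phi : C -> C.
Hypothesis phi_self : self_map phi.

Let phi_disc z : disc z -> disc (phi z).
Proof. by case: phi_self => _; exact. Qed.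

Let phi_holo n : holomorphic_disc (fun z => phi z ^+ n).
Proof. by apply: holomorphic_expn; case: phi_self. Qed.

Lemma lux_norm_power_fin K2 n : 0 < K2 ->
  (forall f b, holomorphic_disc f -> 0 < b ->
    (forall z, disc z -> normc (f z) <= b * growth z) ->
    (lux f <= (K2 * b)%:E)%E /\ bergman_orlicz alpha psi f) ->
  lux (fun z => phi z ^+ n) \is a fin_num.
Proof.
move=> K20 hK2; have X1 := psi_inv_gt0 psi_orlicz ltr01.
rewrite ge0_fin_numE ?lux_norm_ge0 //.
have [|z zD|h _] := hK2 (fun z => phi z ^+ n) (X 1)^-1 (@phi_holo n).
- by rewrite invr_gt0.
- rewrite normcX mulrC ler_pdivlMr //;
  apply: le_trans (growth_ge1 psi_orlicz zD).
  rewrite ler_piMl ?(ltW X1) // exprn_ile1 ?normc_ge0 //; exact/ltW/phi_disc.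
- by apply: le_lt_trans h (ltry _).
Qed.

Lemma power_ratioE n p q : lux (fun z => phi z ^+ n) = q%:E ->
  lux (fun z => z ^+ n) = p%:E -> 0 < p ->
    power_ratio alpha psi phi n = (q / p)%:E.
Proof.
by move=> hq hp p0; rewrite /power_ratio hq hp inver gt_eqF // -EFinM.
Qed.

(** [X n] is at most [n * X 1], so the geometric factor wins. *)
Lemma geometric_psi_inv r (d : R) : 0 <= r -> r < 1 -> 0 < d ->
  exists N, forall n, (N <= n)%N -> r ^+ n * X n%:R <= d.
Proof.
move=> r0 r1 d0; have X1 := psi_inv_gt0 psi_orlicz ltr01.
set s := 1 - r; have s0 : 0 < s by rewrite subr_gt0.
have s1 : s <= 1 by rewrite gerBl.
exists (Num.bound (4 * X 1 / s ^+ 2 / d)).+1 => n Nn.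
have n0 : 0 < n%:R :> R by rewrite ltr0n; apply: leq_trans Nn.
have n1 : 1 <= n%:R :> R by rewrite ler1n -(ltr0n R).
have hb : 4 * X 1 / s ^+ 2 / d <= n%:R.
  apply: le_trans (_ : (Num.bound (4 * X 1 / s ^+ 2 / d))%:R <= _).
    by apply/ltW/archi_boundP; rewrite !divr_ge0 ?sqr_ge0 ?mulr_ge0 // ltW.
  by rewrite ler_nat; apply: leq_trans Nn.
have Xn : X n%:R <= n%:R *
  X 1 by rewrite -[in X in X <= _](mulr1 n%:R) psi_inv_scale.
have e := @exp_decay R s n (ltW s0) s1.
have rE : r = 1 - s by rewrite /s; ring.
have rn0 : 0 <= r ^+ n by rewrite exprn_ge0.
have e2 : r ^+ n * (n%:R * s) ^+ 2 <= 4.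
  have : r ^+ n * ((n%:R * s / 2) ^+ 2) <= 1.
    apply: le_trans e; rewrite -rE ler_wpM2l // lerXn2r // ?nnegrE;
      last by rewrite lerDr.
      by rewrite divr_ge0 // mulr_ge0 // ltW.
    by rewrite addr_ge0 // divr_ge0 // mulr_ge0 // ltW.
  by rewrite exprMn [2^-1 ^+ 2](_ : _ = 1 / 4); [lra|field].
apply: le_trans (_ : r ^+ n * (n%:R * X 1) <= _); first by rewrite ler_wpM2l.
have -> : r ^+ n * (n%:R * X 1) = r ^+ n * (n%:R * s) ^+ 2 *
  (X 1 / s ^+ 2 / n%:R).
  by field; rewrite !gt_eqF.
apply: le_trans (_ : 4 * (X 1 / s ^+ 2 / n%:R) <= _).
  by rewrite ler_wpM2r // !divr_ge0 ?sqr_ge0 // ltW.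
move: hb; rewrite ler_pdivrMr // => hb.
by rewrite mulrA ler_pdivrMr // mulrA [d * _]mulrC.
Qed.

Lemma power_ratio_ge0 n : (0 <= power_ratio alpha psi phi n)%E.
Proof. by rewrite /power_ratio mule_ge0 ?inve_ge0 ?lux_norm_ge0. Qed.

Lemma limn_power_ratio_ge0 : (0 <= limn_esup (power_ratio alpha psi phi))%E.
Proof.
apply: le_ereal_inf_tmp => _ [V [N _ hV] <-].
apply: le_trans (power_ratio_ge0 N) _; apply: ereal_sup_ubound; exists N => //.
exact: hV (leqnn N).
Qed.

End SelfMap.

(** In the weighted supremum norm, the [n]-th ratio is comparable to the
    supremum over [z] of [|phi z| ^ n * X n / growth z]. It is bounded above
    by [monomial_growth] at [phi z], up to the points where [|phi z| <= r],
    which become negligible; below, by [exponents_unbounded]. *)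
Lemma power_ratio_comparison : exists a b : R, [/\ 0 < a, 0 < b &
  forall phi : C -> C, self_map phi ->
    (limn_esup (power_ratio alpha psi phi) <= b%:E * lim_sup_phi psi phi)%E /\
    (a%:E * lim_sup_phi psi phi <= limn_esup (power_ratio alpha psi phi))%E].
Proof.
have [K1 K10 hK1] := lux_norm_lower alpha_gt psi_orlicz psi_Delta2.
have [K2 K20 hK2] := lux_norm_upper alpha_gt psi_orlicz psi_Delta2.
have [K K0 hK] := lux_norm_monomial.
exists (8 * K1 * K)^-1, (K2 * K); split; rewrite ?invr_gt0 ?mulr_gt0 //.
move=> phi ps; have [ph pD] := ps; split.
- apply: lee_scaled; [by rewrite mulr_gt0|exact: lim_sup_phi_ge0|move=> l l0
  /lim_sup_phi_upper].
  move=> /(_ psi_orlicz ps)[r /andP[r0 r1] hr].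
  have X1 := psi_inv_gt0 psi_orlicz ltr01.
  have [N hN] := geometric_psi_inv (ltW r0) r1 (mulr_gt0 l0 X1).
  apply: ge_ereal_inf; exists
    (ereal_sup (power_ratio alpha psi phi @` [set n | (maxn N 1 <= n)%N])).
    by exists [set n | (maxn N 1 <= n)%N] => //; exists (maxn N 1).
  apply: ge_ereal_sup => _ [n /= Nn <-].
  have n0 : (0 < n)%N by apply: leq_trans Nn; rewrite leq_maxr.
  have {}Nn : (N <= n)%N by apply: leq_trans Nn; rewrite leq_maxl.
  have Xn := psi_inv_nat_gt0 n0.
  have pn z : disc z -> normc (phi z ^+ n) <= l / X n%:R * growth z.
    move=> zD; rewrite normcX mulrAC ler_pdivlMr //.
    have [pz|pz] := leP (normc (phi z)) r.
      apply: le_trans (_ : l * X 1 <= _);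
        last by rewrite ler_pM2l // growth_ge1.
      apply: le_trans (hN n Nn); rewrite ler_wpM2r ?(ltW Xn) //.
      by rewrite lerXn2r ?nnegrE ?normc_ge0 // ltW.
    by apply: le_trans (hr z zD pz); apply: monomial_growth => //; exact: pD.
  have lX : 0 < l / X n%:R by rewrite divr_gt0.
  have [up _] := hK2 _ _ (@holomorphic_expn R phi n ph) lX pn.
  have [pf p1 _] := hK n n0; set p := fine _ in p1.
  have qf := lux_norm_power_fin ps n K20 hK2;
    set q := fine (lux (fun z => phi z ^+ n)).
  have p0 : 0 < p by apply: lt_le_trans p1; rewrite invr_gt0 mulr_gt0.
  rewrite (power_ratioE (esym (fineK qf)) (esym (fineK pf)) p0) lee_fin
    ler_pdivrMr //.
  have : q <= K2 * (l / X n%:R) by rewrite -lee_fin fineK.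
  move=> /le_trans; apply.
  have -> : K2 * (l / X n%:R) = K2 * K * l * (K * X n%:R)^-1.
    by field; rewrite !gt_eqF.
  by rewrite ler_wpM2l // !mulr_ge0 // ltW.
- apply: scaled_lee; [by rewrite invr_gt0 !mulr_gt0|exact:
  limn_power_ratio_ge0|].
  move=> b b0 hb; apply: le_ereal_inf_tmp => _ [V [N _ hV] <-].
  have [n [z [Nn n0 zD hn]]] := exponents_unbounded N ps b0 hb.
  apply: le_trans (_ : power_ratio alpha psi phi n <= _)%E; last first.
    by apply: ereal_sup_ubound; exists n => //; exact: hV.
  have [pf p1 p2] := hK n n0; set p := fine _ in p1 p2.
  have qf := lux_norm_power_fin ps n K20 hK2;
    set q := fine (lux (fun z => phi z ^+ n)).
  have Xn := psi_inv_nat_gt0 n0.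
  have p0 : 0 < p by apply: lt_le_trans p1; rewrite invr_gt0 mulr_gt0.
  have pr := power_ratioE (esym (fineK qf)) (esym (fineK pf)) p0.
  rewrite pr.
  rewrite lee_fin.
  rewrite ler_pdivlMr; last exact: p0.
  have q0 : 0 <= q by rewrite fine_ge0 // lux_norm_ge0.
  have qE : (lux (fun z => (phi z ^+ n)%R) <= q%:E)%E by rewrite fineK.
  have := hK1 _ q (@holomorphic_expn R phi n ph) q0 qE z zD;
    rewrite normcX => hq.
  have gz := growth_gt0 psi_orlicz zD.
  have h1 : b * growth z <= 8 * (K1 * q * growth z * X n%:R).
    by apply: le_trans hn _; rewrite ler_pM2l // ler_wpM2r // ltW.
  have h2 : b <= 8 * (K1 * q * X n%:R).
    by rewrite -(ler_pM2r gz); apply: le_trans h1 _; apply: le_of_eq; ring.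
  have c0 : 0 <= (8 * K1 * K)^-1 *
    b by rewrite mulr_ge0 ?invr_ge0 ?mulr_ge0 // ltW.
  apply: le_trans (ler_wpM2l c0 p2) _.
  have -> : (8 * K1 * K)^-1 * b * (K / X n%:R) = b / (8 * K1 * X n%:R).
    by field; rewrite !gt_eqF.
  have d0 : 0 < 8 * K1 * X n%:R by rewrite !mulr_gt0.
  rewrite ler_pdivrMr //; apply: le_trans h2 _.
  have -> : 8 * (K1 * q * X n%:R) = q * (8 * K1 * X n%:R) by ring.
  by [].
Qed.

End PowerRatios.

(** * Lacunary sums of monomials *)

Section EssentialNorm.
Variables (R : realType) (alpha : R) (psi : R -> R).
Hypotheses (alpha_gt : -1 < alpha) (psi_orlicz : orlicz psi).
Hypothesis psi_Delta2 : Delta2_upper psi.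
Local Notation C := R[i].
Local Notation X := (psi_inv psi).
Local Notation growth := (critical_growth psi).
Local Notation lux := (lux_norm alpha psi).
Local Notation bergman := (bergman_orlicz alpha psi).

(** Below the critical exponent [1 / (1 - |z|)] the terms are at most
    [X (nu k)], which grows geometrically up to [growth z]; beyond it,
    [exp_decay] makes them decay geometrically. *)
Lemma lacunary_sum (nu : nat -> nat) (z : C) : disc z ->
  (forall k, (0 < nu k)%N) ->
  (forall k, 2 * X (nu k)%:R <= X (nu k.+1)%:R) ->
  forall N, \sum_(k < N) normc z ^+ nu k * X (nu k)%:R <= 10 * growth z.
Proof.
move=> zD nu0 nuX; have /andP[s0 s1] := disc_gap zD;
  set s := 1 - normc z in s0 s1.
have zs : normc z = 1 - s by rewrite /s; ring.
have h0 := growth_gt0 psi_orlicz zD; set h := growth z in h0 *.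
pose x k := X (nu k)%:R; pose u k : R := (nu k)%:R * s.
have u0 k : 0 < u k by rewrite mulr_gt0 // ltr0n.
have x0 k : 0 < x k by apply: psi_inv_gt0 => //; rewrite ltr0n.
have xh k : u k <= 1 -> x k <= h.
  move=> uk; apply: le_psi_inv => //; rewrite ?ler0n //.
  by rewrite ler_pdivlMr.
have xu k : 1 <= u k -> x k <= u k * h.
  move=> uk; rewrite /x.
  have -> : (nu k)%:R = u k * (1 / s) by rewrite /u; field; rewrite gt_eqF.
  by apply: psi_inv_scale => //; rewrite divr_ge0 // ltW.
(* As [psi_inv] is concave, its doubling implies the doubling of the
   exponent. *)
have uu k : 2 * u k <= u k.+1.
  rewrite /u mulrA ler_pM2r // leNgt; apply/negP => lt.
  have n1 : (nu k.+1)%:R < 2 * (nu k)%:R :> R by [].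
  have h1 : psi (X (nu k.+1)%:R) < psi (2 * X (nu k)%:R).
    rewrite psi_invK // ?ler0n //; apply: lt_le_trans n1 _.
    have l1 : (1 : R) <= 2 by rewrite ler1n.
    have p0 : 0 <= 2 * X (nu k)%:R by rewrite mulr_ge0 // ltW // x0.
    have := psi_scale psi_orlicz p0 l1;
      rewrite mulrC mulKf // psi_invK // ?ler0n //.
    by rewrite ler_pdivlMr // mulrC.
  have h2 := psi_le psi_orlicz (_ : 0 <= 2 * X (nu k)%:R) (nuX k).
  have p0 : 0 <= 2 * X (nu k)%:R by rewrite mulr_ge0 // ltW // x0.
  by have := lt_le_trans h1 (h2 p0); rewrite ltxx.
pose T k := normc z ^+ nu k * x k.
have Tx k : T k <= x k.
  rewrite /T ler_piMl ?(ltW (x0 k)) // exprn_ile1 ?normc_ge0 //; exact: ltW.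
have Tu k : 1 <= u k -> T k <= 4 * h / u k.
  move=> uk; have e := @exp_decay R s (nu k) (ltW s0) s1.
  have p0 : 0 <= normc z ^+ nu k by rewrite exprn_ge0 // normc_ge0.
  apply: le_trans (_ : normc z ^+ nu k * (u k * h) <= _);
    first by rewrite ler_wpM2l // xu.
  rewrite ler_pdivlMr //.
  have -> : normc z ^+ nu k * (u k * h) * u k = (normc z ^+ nu k * u k ^+ 2) *
    h by ring.
  rewrite ler_pM2r // zs.
  have q0 : 0 <= (1 - s) ^+ nu k by rewrite -zs.
  have e' : (1 - s) ^+ nu k * (u k / 2) ^+ 2 <= 1.
    apply: le_trans e; rewrite ler_wpM2l // -/(u k) lerXn2r // ?nnegrE;
      last by rewrite lerDr.
      by rewrite divr_ge0 // ltW.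
    by rewrite addr_ge0 // divr_ge0 // ltW.
  have -> : (1 - s) ^+ nu k * u k ^+ 2 = 4 *
    ((1 - s) ^+ nu k * (u k / 2) ^+ 2) by field.
  by lra.
(* The subtracted term leaves room for the geometric tail. *)
have inv N : if u N <= 1 then \sum_(k < N.+1) T k <= 2 * x N
             else \sum_(k < N.+1) T k <= 10 * h - 4 * h / u N.
  elim: N => [|N IH].
    rewrite big_ord_recr big_ord0 /= add0r; case: ifP => [_|/negbT].
      by have := Tx 0%N; have := x0 0%N; lra.
    rewrite -ltNge => /ltW uk; have := Tu _ uk.
    have : 4 * h / u 0%N <= 4 *
      h by rewrite ler_pdivrMr // ler_peMr // mulr_ge0 // ltW.
    by move: h0; move: (4 * h / u 0%N) => a; lra.
  rewrite big_ord_recr /=; case: ifP => [uk|/negbT].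
    have uN : u N <= 1 by have := uu N; have := u0 N; lra.
    move: IH; rewrite uN => IH; have := Tx N.+1; have := nuX N;
      rewrite -/(x N) -/(x N.+1).
    by move: IH; move: (\sum_(_ < _) _) => a; lra.
  rewrite -ltNge => /ltW uk; have t := Tu _ uk.
  have c : 4 * h / u N.+1 <= 4 * h.
    by rewrite ler_pdivrMr // ler_peMr // mulr_ge0 // ltW.
  case: ifP IH => [uN|uN] IH.
    have xN := xh N uN.
    by move: IH t c; move: (\sum_(_ < _) _) (4 * h / u N.+1) => a b; lra.
  have d : 2 * (4 * h / u N.+1) <= 4 * h / u N.
    rewrite mulrA ler_pdivrMr // mulrAC ler_pdivlMr //.
    have := uu N; have := h0; nra.
  by move: IH t d; move: (\sum_(_ < _) _) (4 * h / u N.+1) (4 * h / u N) =>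
    a b c'; lra.
case=> [|N]; first by rewrite big_ord0 mulr_ge0 // ltW.
have := inv N; case: ifP => [uN|_] h1; apply: le_trans h1 _.
  by have := xh N uN; move: h0; lra.
have : 0 <= 4 * h / u N by rewrite divr_ge0 ?mulr_ge0 // ltW.
by move: h0; lra.
Qed.

Lemma linear_op_sum (T : (C -> C) -> (C -> C)) (f : nat -> C -> C)
  (a : nat -> C) :
  linear_op alpha psi T ->
    (forall N, bergman (fun w => \sum_(k < N) a k * f k w)) ->
  (forall k, bergman (f k)) ->
  forall N z, disc z -> T (fun w => \sum_(k < N) a k * f k w) z = \sum_(k < N)
    a k * T (f k) z.
Proof.
move=> [Tb Tl] fs fb N z zD; elim: N => [|N IH].
  rewrite big_ord0.
  have b0 : bergman (fun=> 0).
    by have := fs 0%N; congr (bergman _); apply/funext => w; rewrite big_ord0.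
  have -> : (fun w => \sum_(k < 0) a k * f k w) = (fun=> 0 : C).
    by apply/funext => w; rewrite big_ord0.
  have := Tl (-1) _ _ b0 b0 z zD.
  have -> : (fun _ : C => -1 * 0 + 0) = (fun=> 0 : C) by apply/funext => w;
    ring.
  by rewrite mulN1r addNr.
rewrite big_ord_recr /= -IH.
have -> : (fun w => \sum_(k < N.+1) a k * f k w) =
    (fun w => a N * f N w + (fun w => \sum_(k < N) a k * f k w) w).
  by apply/funext => w; rewrite big_ord_recr /= addrC.
by rewrite (Tl _ _ _ (fb N) (fs N) z zD) addrC.
Qed.

End EssentialNorm.

(** * Compact operators on lacunary monomials *)

Section CompactOperators.
Variables (R : realType) (alpha : R) (psi : R -> R).
Hypotheses (alpha_gt : -1 < alpha) (psi_orlicz : orlicz psi).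
Hypothesis psi_Delta2 : Delta2_upper psi.
Local Notation C := R[i].
Local Notation X := (psi_inv psi).
Local Notation growth := (critical_growth psi).
Local Notation lux := (lux_norm alpha psi).
Local Notation bergman := (bergman_orlicz alpha psi).

Lemma cvg0_eventually (u : nat -> \bar R) (e : R) : 0 < e ->
  u @ \oo --> 0%E -> exists N, forall k, (N <= k)%N -> (u k <= e%:E)%E.
Proof.
move=> e0 h.
have [|N _ hN] := h [set y | (y <= e%:E)%E].
  exists e => //= x; rewrite /ball_ /= sub0r normrN => xe.
  by rewrite lee_fin; apply: le_trans (ler_norm _) (ltW xe).
by exists N => k Nk; exact: hN.
Qed.

Lemma eventually_cvg0 (u : nat -> \bar R) : (forall n, (0 <= u n)%E) ->
  (forall e : R, 0 < e -> exists N, forall k, (N <= k)%N -> (u k <= e%:E)%E) ->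
  u @ \oo --> 0%E.
Proof.
move=> u0 h A [e /= e0 eA]; have [N hN] := h (e / 2) (divr_gt0 e0 (ltr0Sn _ 1)).
exists N => // k /= Nk; have := hN k Nk; have := u0 k.
case: (u k) => [r| |] //; rewrite !lee_fin => r0 re.
by apply: eA; rewrite /ball_ /= sub0r normrN ger0_norm //; lra.
Qed.

Lemma lux_cvg_pointwise : exists2 K : R, 0 < K &
  forall (F : nat -> C -> C) (g : C -> C),
  (forall k, holomorphic_disc (F k)) -> holomorphic_disc g ->
  (lux (fun z => F k z - g z) @[k --> \oo] --> 0%E) ->
  forall e : R, 0 < e -> exists N, forall k, (N <= k)%N -> forall z, disc z ->
    normc (F k z - g z) <= K * e * growth z.
Proof.
have [K K0 hK] := lux_norm_lower alpha_gt psi_orlicz psi_Delta2.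
exists K => // F g Fh gh cv e e0; have [N hN] := cvg0_eventually e0 cv.
exists N => k Nk z zD.
apply: (hK _ e (holomorphic_sub (Fh k) gh) (ltW e0) (hN k Nk) z zD).
Qed.

(** The images of these normalized monomials have a subsequence converging to
    some [g]. If [g z] were not [0], the images at [z] of the partial sums
    along this subsequence would grow linearly with the number of terms. The
    partial sums stay in a multiple of the unit ball by [lacunary_sum], so
    a subsequence of their images converges, a contradiction. *)
Lemma compact_lacunary (T : (C -> C) -> (C -> C)) (nu : nat -> nat) (c : R) :
  compact_op alpha psi T -> (forall k, (0 < nu k)%N) ->
  (forall k, 2 * X (nu k)%:R <= X (nu k.+1)%:R) -> 0 < c ->
  (forall f, holomorphic_disc f ->
    (forall z, disc z -> normc (f z) <= c * growth z) ->
     bergman f /\ (lux f <= 1)%E) ->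
  forall e : R, 0 < e -> exists k, forall z, disc z ->
    normc (T (fun w => (c * X (nu k)%:R)%:C%C * w ^+ nu k) z) <= e * growth z.
Proof.
move=> [Tlin Tc] nu0 nuX c0 hc e e0.
pose x k := X (nu k)%:R.
have x0 k : 0 < x k by apply: psi_inv_gt0 => //; rewrite ltr0n.
have xS k : x k <= x k.+1 by have := nuX k; have := x0 k;
  rewrite -/(x k) -/(x k.+1); lra.
have xm : {homo x : j k / (j <= k)%N >-> j <= k}.
  by apply: homo_leq => // a b d; exact: le_trans.
have x2 j k : (j < k)%N -> 2 * x j <= x k.
  by move=> jk; apply: le_trans (nuX j) (xm _ _ jk).
pose f k : C -> C := fun w => (c * x k)%:C%C * w ^+ nu k.
have fn k z : normc (f k z) = c * (normc z ^+ nu k * x k).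
  by rewrite /f normcM normcX normc_real ger0_norm ?mulr_ge0 ?(ltW c0)
    ?(ltW (x0 k)) //; ring.
have fh k : holomorphic_disc (f k) by exact: holomorphic_monomial.
have fb k : bergman (f k) /\ (lux (f k) <= 1)%E.
  by apply: hc => // z zD; rewrite fn ler_pM2l //; exact: monomial_growth.
have [s [g [si gb cv]]] := Tc f fb.
have Tfh k : holomorphic_disc (T (f k)) by have [] := Tlin.1 _ (fb k).1.
have [K K0 hK] := lux_cvg_pointwise.
have pw := hK _ _ (fun k => Tfh (s k)) gb.1 cv.
have sm j k : (j < k)%N -> (s j < s k)%N.
  by move=> jk; rewrite ltnNge -leEnat si -ltnNge.
have g0 z : disc z -> g z = 0.
  move=> zD; apply/eqP; rewrite -normr_eq0 normrE; apply: contrapT => gz0.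
  have gz : 0 < normc (g z).
    by rewrite normc_gt0; apply/eqP => h; apply: gz0; rewrite h normc0.
  have hz := growth_gt0 psi_orlicz zD.
  have d0 : 0 < normc (g z) / 2 / (K * growth z) by rewrite !divr_gt0 //
    mulr_gt0.
  have [k0 hk0] := pw _ d0.
  have wz k : normc (T (f (s (k0 + k)%N)) z - g z) <= normc (g z) / 2.
    apply: le_trans (hk0 _ (leq_addr _ _) z zD) _.
    by apply: le_of_eq; field; rewrite !gt_eqF.
  (* The factor [10^-1] compensates the constant of [lacunary_sum]. *)
  pose F N : C -> C := fun w => \sum_(k < N) (10^-1)%:C%C * f (s (k0 + k)%N) w.
  have Fh N : holomorphic_disc (F N).
    elim: N => [|N IH].
      by congr holomorphic_disc: (@holomorphic_cst R 0); apply/funext => w;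
        rewrite /F big_ord0.
    congr holomorphic_disc: (@holomorphic_lin R (10^-1)%:C%C _ _
      (fh (s (k0 + N)%N)) IH).
    by apply/funext => w; rewrite /F big_ord_recr /= addrC.
  have FN N w : disc w -> normc (F N w) <= c * growth w.
    move=> wD; apply: le_trans
      (_ : \sum_(k < N) normc ((10^-1)%:C%C * f (s (k0 + k)%N) w) <= _).
      rewrite /F; elim: N => [|N IH]; first by rewrite !big_ord0 normc0.
      rewrite !big_ord_recr /=; apply: le_trans (normc_triangle _ _) _.
      by rewrite lerD2r.
    under eq_bigr => k _ do rewrite normcM normc_real ger0_norm ?invr_ge0 // fn.
    rewrite -mulr_sumr -mulr_sumr mulrCA ler_pM2l //.
    rewrite mulrC ler_pdivrMr // mulrC.
    apply: (@lacunary_sum R psi psi_orlicz (fun k => nu (s (k0 + k)%N))) => //.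
    by move=> k; rewrite addnS; apply: x2; exact: sm.
  have Fb N := hc (F N) (Fh N) (FN N).
  have [s' [G [s'i Gb Gcv]]] := Tc F Fb.
  have TFh k : holomorphic_disc (T (F k)) by have [] := Tlin.1 _ (Fb k).1.
  have Gpw := hK _ _ (fun k => TFh (s' k)) Gb.1 Gcv.
  have [j0 hj0] := Gpw 1 ltr01.
  have TF N : T (F N) z = \sum_(k < N) (10^-1)%:C%C * T (f (s (k0 + k)%N)) z.
    apply: (@linear_op_sum R alpha psi T (fun k => f (s (k0 + k)%N))
      (fun=> (10^-1)%:C%C)) => //.
      by move=> M; exact: (Fb M).1.
    by move=> k; exact: (fb _).1.
  have low N : N%:R * (normc (g z) / 2) <= 10 * normc (T (F N) z).
    have up : normc (\sum_(k < N) T (f (s (k0 + k)%N)) z - N%:R%:C%C * g z) <=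
        N%:R * (normc (g z) / 2).
      elim: N => [|N IH]; first by rewrite big_ord0 !mul0r subrr normc0.
      rewrite big_ord_recr /= -natr1 rmorphD /=.
      have -> : \sum_(k < N) T (f (s (k0 + k)%N)) z + T (f (s (k0 + N)%N)) z -
          (N%:R%:C%C + 1%:C%C) * g z =
          (\sum_(k < N) T (f (s (k0 + k)%N)) z - N%:R%:C%C * g z) +
          (T (f (s (k0 + N)%N)) z - g z).
        by rewrite (_ : 1%:C%C = 1) //; ring.
      apply: le_trans (normc_triangle _ _) _.
      by rewrite mulrDl mul1r lerD.
    have E : \sum_(k < N) T (f (s (k0 + k)%N)) z = 10%:C%C * T (F N) z.
      rewrite TF -mulr_sumr mulrA -rmorphM /= divff ?mul1r //.
    rewrite E in up.
    have h := normc_sub_le (lexx (normc (10%:C%C * T (F N) z))) up.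
    move: h; rewrite opprB addrC subrK !normcM !normc_real !ger0_norm ?ler0n //.
    by move: (N%:R) (normc (T (F N) z)) (normc (g z)) => a b d; lra.
  set Bd := normc (G z) + K * 1 * growth z.
  have TFb k : (j0 <= k)%N -> normc (T (F (s' k)) z) <= Bd.
    move=> jk; have -> : T (F (s' k)) z = G z - (G z - T (F (s' k)) z) by ring.
    apply: normc_sub_le => //; rewrite normc_dist; exact: hj0.
  have s'k k : (k <= s' k)%N.
    elim: k => [|k IH] //; apply: leq_ltn_trans IH _.
    by rewrite ltnNge -leEnat s'i -ltnNge.
  pose m := (j0 + Num.bound (20 * Bd / normc (g z)))%N.
  have Bd0 : 0 <= Bd by rewrite addr_ge0 ?normc_ge0 // !mulr_ge0 // ltW.
  have h1 := low (s' m); have h2 := TFb m (leq_addr _ _).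
  have h3 : 20 * Bd / normc (g z) < (s' m)%:R.
    apply: lt_le_trans (archi_boundP _) _;
      first by rewrite divr_ge0 ?mulr_ge0 // ltW.
    by rewrite ler_nat; apply: leq_trans (s'k m); rewrite leq_addl.
  by move: h3 h1 h2; rewrite ltr_pdivrMr //; lra.
have [N hN] := pw (e / K) (divr_gt0 e0 K0).
exists (s N) => z zD; have := hN N (leqnn _) z zD.
by rewrite g0 // subr0 [K * _]mulrC divfK // gt_eqF.
Qed.

End CompactOperators.

(** * Composition operators *)

Section CompositionOperators.
Variables (R : realType) (alpha : R) (psi : R -> R).
Hypotheses (alpha_gt : -1 < alpha) (psi_orlicz : orlicz psi).
Hypothesis psi_Delta2 : Delta2_upper psi.
Local Notation C := R[i].
Local Notation X := (psi_inv psi).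
Local Notation growth := (critical_growth psi).
Local Notation lux := (lux_norm alpha psi).
Local Notation bergman := (bergman_orlicz alpha psi).

Lemma op_norm_ge0 T : (0 <= op_norm alpha psi T)%E.
Proof.
have [K K0 hK] := lux_norm_upper alpha_gt psi_orlicz psi_Delta2.
have [|z zD|l0 b0] := hK (fun=> 0) K^-1 (@holomorphic_cst R 0).
- by rewrite invr_gt0.
- by rewrite normc0 mulr_ge0 ?invr_ge0 // ltW // growth_gt0.
apply: le_trans (lux_norm_ge0 alpha psi (T (fun=> 0))) _;
  apply: ereal_sup_ubound.
by exists (fun=> 0) => //; split=> //; move: l0; rewrite divff ?gt_eqF.
Qed.

Lemma essential_norm_ge0 T : (0 <= essential_norm alpha psi T)%E.
Proof. by apply: le_ereal_inf_tmp => _ [K _ <-]; exact: op_norm_ge0. Qed.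

Lemma lux_norm_zero : lux (fun=> 0) = 0%E.
Proof.
have [K K0 hK] := lux_norm_upper alpha_gt psi_orlicz psi_Delta2.
apply/eqP; rewrite eq_le lux_norm_ge0 andbT; apply/lee_addgt0Pr => e e0;
  rewrite add0e.
have [|z zD|l0 _] := hK (fun=> 0) (e / K) (@holomorphic_cst R 0).
- by rewrite divr_gt0.
- by rewrite normc0 mulr_ge0 ?divr_ge0 // ltW // growth_gt0.
by move: l0; rewrite mulrC divfK ?gt_eqF.
Qed.

(** Normalized monomials with exponents adapted to [phi] are moved by
    [comp_op phi] as much as [lim_sup_phi] predicts, while a compact operator
    makes them small. *)
Lemma essential_norm_lower : exists2 a : R, 0 < a &
  forall phi : C -> C, self_map phi ->
  (a%:E * lim_sup_phi psi phi <= essential_norm alpha psi (comp_op phi))%E.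
Proof.
have [K1 K10 hK1] := lux_norm_lower alpha_gt psi_orlicz psi_Delta2.
have [K2 K20 hK2] := lux_norm_upper alpha_gt psi_orlicz psi_Delta2.
have unit f : holomorphic_disc f ->
  (forall z, disc z -> normc (f z) <= K2^-1 * growth z) ->
    bergman f /\ (lux f <= 1)%E.
  move=> fh fK; have K2i : 0 < K2^-1 by rewrite invr_gt0.
  by have [] := hK2 f _ fh K2i fK; rewrite divff ?gt_eqF.
exists (8 * K1 * K2)^-1; first by rewrite invr_gt0 !mulr_gt0.
move=> phi ps; have [ph pD] := ps.
apply: scaled_lee; [by rewrite invr_gt0 !mulr_gt0|exact: essential_norm_ge0|].
move=> b b0 hb; apply: le_ereal_inf_tmp => _ [T Tc <-].
have /choice[g hg] : forall N, exists n, (N <= n)%N /\ (0 < n)%N /\ exists z,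
  disc z /\
    b * growth z <= 8 * (normc (phi z) ^+ n * X n%:R).
  move=> N; have [n [z [? ? ? ?]]] := exponents_unbounded psi_orlicz N ps b0 hb.
  by exists n; do !split => //; exists z.
(* The exponents are taken from the adapted ones, each so large that [X] at
   least doubles. *)
pose M (n : nat) := Num.bound (psi (2 * X n%:R)).
pose nu := fix nu k := if k is k'.+1 then g (M (nu k')) else g 0%N.
have nuE k : exists N, nu k = g N by case: k => [|k]; eexists.
have nu0 k : (0 < nu k)%N by have [N ->] := nuE k; have [_ []] := hg N.
have Xn0 n : 0 <= X n%:R by apply: psi_inv_ge0.
have nuX k : 2 * X (nu k)%:R <= X (nu k.+1)%:R.
  have [h _] := hg (M (nu k));
    have q0 : 0 <= 2 * X (nu k)%:R by rewrite mulr_ge0.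
  rewrite -[leLHS](psiK psi_orlicz) //; apply: le_psi_inv => //;
    first exact: psi_ge0.
  apply: le_trans (_ : (M (nu k))%:R <= _); last by rewrite ler_nat.
  by apply/ltW/archi_boundP; exact: psi_ge0.
have K2i : 0 < K2^-1 by rewrite invr_gt0.
have small := compact_lacunary alpha_gt psi_orlicz psi_Delta2 Tc nu0 nuX K2i
  unit.
rewrite leNgt; apply/negP => hop.
have op0 := op_norm_ge0 (fun f z => comp_op phi f z - T f z).
have opf : op_norm alpha psi (fun f z => comp_op phi f z - T f z) \is a fin_num.
  by rewrite ge0_fin_numE //; apply: lt_trans hop (ltry _).
set l := fine (op_norm alpha psi (fun f z => comp_op phi f z - T f z)).
have l0 : 0 <= l by exact: fine_ge0.
have lE : op_norm alpha psi (fun f z => comp_op phi f z - T f z) = l%:E by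
  rewrite fineK.
have lb : l < (8 * K1 * K2)^-1 * b by rewrite -lte_fin -lE.
have lb' : K1 * l < b / (8 * K2).
  have := lb; rewrite -(ltr_pM2l K10) => h; apply: lt_le_trans h _.
  by apply: le_of_eq; field; rewrite !gt_eqF.
set e := (b / (8 * K2) - K1 * l) / 2.
have e0 : 0 < e by rewrite divr_gt0 // subr_gt0.
have [k hk] := small e e0.
set f : C -> C := fun w => (K2^-1 * X (nu k)%:R)%:C%C * w ^+ nu k in hk.
have fn z : normc (f z) = K2^-1 * (normc z ^+ nu k * X (nu k)%:R).
  rewrite /f normcM normcX normc_real ger0_norm; first by ring.
  by rewrite mulr_ge0 // ltW.
have fh : holomorphic_disc f by exact: holomorphic_monomial.
have [fb f1] : bergman f /\ (lux f <= 1)%E.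
  by apply: unit => // z zD; rewrite fn ler_pM2l //; exact: monomial_growth.
have Fh : holomorphic_disc (fun z => comp_op phi f z - T f z).
  apply: holomorphic_sub; first exact: holomorphic_comp.
  by have [] := Tc.1.1 f fb.
have Fl : (lux (fun z => (comp_op phi f z - T f z)%R) <= l%:E)%E.
  by rewrite -lE; apply: ereal_sup_ubound; exists f.
have [N nuN] := nuE k; have [_ [_ [z [zD hz]]]] := hg N; rewrite -nuN in hz.
have gz := growth_gt0 psi_orlicz zD.
have h1 := hK1 _ l Fh l0 Fl z zD; have h2 := hk z zD.
have h3 : b / (8 * K2) * growth z <= normc (f (phi z)).
  rewrite fn mulrC -[growth z * _]mulrC -(ler_pM2l K20) mulrA mulVKf ?gt_eqF //.
  have -> : K2 * (b / (8 * K2)) * growth z = b * growth z / 8 by field;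
    rewrite gt_eqF.
  by rewrite ler_pdivrMr // [leRHS]mulrC.
have h4 : normc (f (phi z)) <= K1 * l * growth z + e * growth z.
  have -> : f (phi z) = (comp_op phi f z - T f z) +
    T f z by rewrite /comp_op /= subrK.
  by apply: le_trans (normc_triangle _ _) _; exact: lerD.
have := le_trans h3 h4; rewrite -mulrDl ler_pM2r //.
by rewrite /e; lra.
Qed.

(** Montel's theorem provides a locally uniform limit of a subsequence. Where
    [phi z] is in the smaller disc this makes the differences small, and
    elsewhere both terms are negligible against [growth z] by assumption. *)
Lemma compact_comp_op (phi : C -> C) : self_map phi ->
  (forall e : R, 0 < e -> exists2 rho, 0 <= rho < 1 &
    forall z, disc z -> rho < normc (phi z) ->
     growth (phi z) <= e * growth z) ->
  compact_op alpha psi (comp_op phi).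
Proof.
move=> [ph pD] hphi.
have [K1 K10 hK1] := lux_norm_lower alpha_gt psi_orlicz psi_Delta2.
have [K2 K20 hK2] := lux_norm_upper alpha_gt psi_orlicz psi_Delta2.
have X1 := psi_inv_gt0 psi_orlicz ltr01.
have bounded (f : C -> C) b : holomorphic_disc f -> 0 < b ->
    (forall z, disc z -> normc (f z) <= b * growth z) -> bergman (f \o phi).
  move=> fh b0 fb; have [rho /andP[r0 r1] hr] := hphi 1 ltr01.
  set G := X (1 / (1 - rho)).
  have G0 : 0 < G by apply: psi_inv_gt0 => //; rewrite divr_gt0 // subr_gt0.
  have c0 : 0 < b * (1 + G / X 1) by rewrite mulr_gt0 // ltr_wpDr // divr_ge0
    // ltW.
  have [] // := hK2 (f \o phi) _ (holomorphic_comp fh ph pD) c0.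
  move=> z zD; apply: le_trans (fb _ (pD z zD)) _; rewrite -mulrA ler_pM2l //.
  have gz := growth_ge1 psi_orlicz zD.
  have [pz|pz] := leP (normc (phi z)) rho.
    apply: le_trans (_ : G <= _).
      apply: le_psi_inv => //; first by rewrite divr_ge0 // subr_ge0;
        apply/ltW/pD.
      rewrite !div1r lef_pV2 ?posrE ?subr_gt0 //; first by rewrite lerB.
      exact: le_lt_trans pz r1.
    apply: le_trans (_ : G / X 1 * X 1 <= _); first by rewrite divfK // gt_eqF.
    apply: ler_pM => //; [by rewrite divr_ge0 // ltW|exact: ltW|by rewrite
      lerDr].
  apply: le_trans (hr z zD pz) _; apply: ler_wpM2r;
    first exact: le_trans (ltW X1) gz.
  by rewrite lerDl divr_ge0 // ltW.
split.
  split; last by [].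
  move=> f fb; have [b b0 hb] :=
    bergman_growth alpha_gt psi_orlicz psi_Delta2 fb.
  exact: (bounded f b fb.1 b0 hb).
move=> f fb.
have fB n z : disc z -> normc (f n z) <= K1 * growth z.
  move=> zD; have [[fh _] f1] := fb n.
  by have := hK1 (f n) 1 fh ler01 f1 z zD; rewrite mulr1.
have [s [g [si gh gB unif]]] := montel (growth_locally_bounded psi_orlicz K10)
  (fun n => (fb n).1.1) fB.
exists s, (g \o phi); split; [exact: si|exact: (bounded g K1 gh K10 gB)|].
apply: eventually_cvg0 => [k|e e0]; first exact: lux_norm_ge0.
set d := e / K2; have d0 : 0 < d by rewrite divr_gt0.
have d1 : 0 < d / (2 * K1) by rewrite divr_gt0 // mulr_gt0.
have [rho /andP[r0 r1] hr] := hphi _ d1.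
have [N hN] := unif rho (d * X 1) r0 r1 (mulr_gt0 d0 X1).
exists N => k Nk.
have -> : e = K2 * d by rewrite /d mulrC divfK // gt_eqF.
have Fh : holomorphic_disc (fun z => comp_op phi (f (s k)) z - (g \o phi) z).
  apply: holomorphic_sub; last exact: (holomorphic_comp gh ph pD).
  exact: (holomorphic_comp (fb (s k)).1.1 ph pD).
suff Fd : forall z, disc z ->
    normc (comp_op phi (f (s k)) z - (g \o phi) z) <= d * growth z.
  exact: (hK2 _ _ Fh d0 Fd).1.
move=> z zD; have gz := growth_ge1 psi_orlicz zD; have pz := pD z zD.
have [h|h] := leP (normc (phi z)) rho.
  by apply: le_trans (hN k Nk _ h) _; rewrite ler_pM2l.
apply: le_trans (normc_sub_le (fB _ _ pz) (gB _ pz)) _.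
have := hr z zD h; rewrite -(ler_pM2l K10) => h1.
have e1 : K1 * (d / (2 * K1) * growth z) = d * growth z / 2 by field;
  rewrite gt_eqF.
by move: h1; rewrite e1; lra.
Qed.

(** The compact operator approximating [comp_op phi] is [comp_op (t phi)]
    with [t = 1 - d]. Where [|phi z| <= r] the difference is controlled by
    the uniform Lipschitz estimate, for [d] small; elsewhere both terms are
    at most a multiple of [growth (phi z) <= l * growth z]. *)
Lemma essential_norm_upper : exists2 b : R, 0 < b &
  forall phi : C -> C, self_map phi ->
  (essential_norm alpha psi (comp_op phi) <= b%:E * lim_sup_phi psi phi)%E.
Proof.
have [K1 K10 hK1] := lux_norm_lower alpha_gt psi_orlicz psi_Delta2.
have [K2 K20 hK2] := lux_norm_upper alpha_gt psi_orlicz psi_Delta2.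
have X1 := psi_inv_gt0 psi_orlicz ltr01.
have b0 : 0 < K2 * (2 * K1 + 1) by rewrite mulr_gt0 // addr_gt0 // mulr_gt0.
exists (K2 * (2 * K1 + 1)) => // phi ps; have [ph pD] := ps.
apply: lee_scaled => //; first exact: lim_sup_phi_ge0.
move=> l l0 /(lim_sup_phi_upper psi_orlicz ps)[r /andP[r0 r1] hr].
have [L [Q [q [L0 _ q0 hL]]]] :=
  holo_uniform (growth_locally_bounded psi_orlicz K10) (ltW r0) r1.
set d := Num.min (Num.min q 2^-1) (l * X 1 / L).
have d0 : 0 < d by rewrite !lt_min q0 invr_gt0 ltr0n divr_gt0 // mulr_gt0.
have [dq d2 dL] : [/\ d <= q, d <= 2^-1 & d <= l * X 1 / L].
  by rewrite /d !ge_min !lexx !orbT.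
have d1 : d < 1 by apply: le_lt_trans d2 _; rewrite invf_lt1 // ltr1n.
pose t : R := 1 - d; pose psi_t : C -> C := fun z => t%:C%C * phi z.
have t0 : 0 < t by rewrite subr_gt0.
have tn z : normc (psi_t z) = t *
  normc (phi z) by rewrite normcM normc_real gtr0_norm.
have tself : self_map psi_t.
  split.
    have h := @holomorphic_lin R t%:C%C _ _ ph (@holomorphic_cst R 0).
    by congr holomorphic_disc: h; apply/funext => z; rewrite addr0.
  move=> z zD; rewrite /disc /= -/(normc _) tn.
  apply: le_lt_trans (pD z zD); rewrite ler_piMl ?normc_ge0 //.
  by rewrite gerBl ltW.
have tc : compact_op alpha psi (comp_op psi_t).
  apply: compact_comp_op => // e _; exists t; first by rewrite (ltW t0) gtrBl.
  move=> z zD; rewrite tn ltNge ler_piMr ?(ltW t0) //; exact/ltW/pD.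
apply: ge_ereal_inf; exists
  (op_norm alpha psi (fun f z => comp_op phi f z - comp_op psi_t f z)).
  by exists (comp_op psi_t).
apply: ge_ereal_sup => _ [f [[fh fb] f1] <-].
have fB z : disc z -> normc (f z) <= K1 * growth z.
  by move=> zD; have := hK1 f 1 fh ler01 f1 z zD; rewrite mulr1.
have c0 : 0 < (2 * K1 + 1) * l by rewrite mulr_gt0 // addr_gt0 // mulr_gt0.
have Fh : holomorphic_disc (fun z => comp_op phi f z - comp_op psi_t f z).
  apply: holomorphic_sub; first exact: (holomorphic_comp fh ph pD).
  exact: (holomorphic_comp fh tself.1 tself.2).
suff Fd : forall z, disc z ->
    normc (comp_op phi f z - comp_op psi_t f z) <= (2 * K1 + 1) * l * growth z.
  by rewrite -mulrA; exact: (hK2 _ _ Fh c0 Fd).1.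
move=> z zD; have pz := pD z zD; have tz := tself.2 z zD.
have gz := growth_gt0 psi_orlicz zD; have g1 := growth_ge1 psi_orlicz zD.
rewrite /comp_op /=; have [h|h] := leP (normc (phi z)) r.
  have /derivableP_cdiff[D hD] := fh _ pz.
  have [_ lip _] := hL f fh fB (phi z) D h hD.
  have dist : normc (psi_t z - phi z) <= d.
    have -> : psi_t z - phi z = - (d%:C%C * phi z).
      by rewrite /psi_t /t rmorphB /= (_ : 1%:C%C = 1) //; ring.
    rewrite normc_opp normcM normc_real gtr0_norm // ler_piMr ?(ltW d0) //.
    exact/ltW/pz.
  rewrite normc_dist; apply: le_trans (lip _ (le_trans dist dq)) _.
  apply: le_trans (_ : l * X 1 <= _).
    apply: le_trans (ler_wpM2l (ltW L0) (le_trans dist dL)) _.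
    by rewrite mulrC divfK // gt_eqF.
  apply: ler_pM => //; [exact: ltW|exact: ltW|].
  by rewrite ler_peMl ?(ltW l0) // lerDr mulr_ge0 // ltW.
apply: le_trans (normc_sub_le (fB _ pz) (fB _ tz)) _.
have gt : growth (psi_t z) <= growth (phi z).
  by apply: growth_mono => //; rewrite tn ler_piMl ?normc_ge0 // gerBl ltW.
have h1 := hr z zD h.
have h2 : K1 * growth (psi_t z) <= K1 * growth (phi z) by rewrite ler_pM2l.
have h3 : K1 * growth (phi z) <= K1 * (l * growth z) by rewrite ler_pM2l.
have h4 : 0 <= l * growth z by rewrite mulr_ge0 // ltW.
have -> : (2 * K1 + 1) * l * growth z = 2 * (K1 * (l * growth z)) +
  l * growth z by ring.
by lra.
Qed.

(** A compact operator is at distance [0] from the compact operators, so the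
    lower bound of its essential norm applies. *)
Lemma compact_comp_op_iff (phi : C -> C) : self_map phi ->
  compact_op alpha psi (comp_op phi) <-> lim_sup_phi psi phi = 0%E.
Proof.
move=> ps; split=> [cc|h0].
- have [a a0 ha] := essential_norm_lower.
  have B0 := lim_sup_phi_ge0 psi_orlicz ps.
  have : (a%:E * lim_sup_phi psi phi <= 0)%E.
    apply: le_trans (ha phi ps) _; apply: ge_ereal_inf.
    exists (op_norm alpha psi (fun f z => comp_op phi f z - comp_op phi f z)).
      by exists (comp_op phi).
    apply: ge_ereal_sup => _ [f _ <-].
    apply: le_of_eq; rewrite -lux_norm_zero.
    by congr lux; apply/funext => z; rewrite subrr.
  by rewrite pmule_rle0 ?lte_fin // => B1; apply/eqP; rewrite eq_le B1 B0.
- apply: compact_comp_op => // e e0.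
  have [|r /andP[r0 r1] hr] := @lim_sup_phi_upper R psi psi_orlicz phi ps e.
    by rewrite h0 lte_fin.
  by exists r; rewrite ?(ltW r0).
Qed.

End CompositionOperators.

Theorem corollary3p21 (R : realType) (alpha : R) (psi : R -> R)
    (halpha : -1 < alpha) (hpsi : orlicz psi) (hDelta2 : Delta2_upper psi) :
  [/\ comparable (@self_map R)
        (fun phi => essential_norm alpha psi (comp_op phi))
        (lim_sup_phi psi),
      comparable (@self_map R)
        (lim_sup_phi psi)
        (fun phi => limn_esup (power_ratio alpha psi phi)) &
      forall phi : R[i] -> R[i], self_map phi ->
        (compact_op alpha psi (comp_op phi) <->
           limsup_circle (psi_ratio psi phi) = 0%E) /\
        (compact_op alpha psi (comp_op phi) <->
           limn_esup (power_ratio alpha psi phi) = 0%E)].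
Proof.
have [c [d [c0 d0 hcd]]] := power_ratio_comparison halpha hpsi hDelta2.
split.
- have [a a0 ha] := essential_norm_lower halpha hpsi hDelta2.
  have [b b0 hb] := essential_norm_upper halpha hpsi hDelta2.
  by exists a, b; split=> // phi ps; rewrite ha ?hb.
- exists d^-1, c^-1; split; rewrite ?invr_gt0 // => phi ps.
  have [up low] := hcd phi ps; apply/andP; split.
    by rewrite lee_pdivrMl.
  by rewrite lee_pdivlMl.
move=> phi ps; have cc := compact_comp_op_iff halpha hpsi hDelta2 ps.
split; first by rewrite cc limsup_circle_eq0.
rewrite cc; have [up low] := hcd phi ps.
have B0 := lim_sup_phi_ge0 hpsi ps.
have D0 := limn_power_ratio_ge0 alpha psi phi.
split=> h0; apply/eqP; rewrite eq_le.
  by rewrite D0 andbT; move: up; rewrite h0 mule0.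
by rewrite B0 andbT; move: low; rewrite h0 pmule_rle0 // lte_fin.
Qed.
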